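(* Let $p\in\mathbb{R}^2_+=\{(x,y)\in\mathbb{R}^2: x>0\}$. There is an $\epsilon>0$, which depends on $p$ but not on $q$, such that for every point $q\in\mathbb{R}^2_+$ with $q\ne p$, if the distance between $p$ and $q$ is less than $\epsilon$, then the curve $\alpha$ in $\mathcal{C}$ which satisfies \[ \lambda_1(\alpha) = \sup \{ \lambda_1(\gamma) : \gamma \in \mathcal{C} \} \] is unique up to reparametrization (that is, any two curves in $\mathcal{C}$ satisfying this equality are reparametrizations of each other). Here $\mathcal{C}$ is the set of smooth, regular curves $\gamma:[0,1]\to\mathbb{R}^2_+$ with $\gamma(0)=p$ and $\gamma(1)=q$.
   Context: For a curve $\gamma=(F,G)$ in $\mathcal{C}$, \[ \lambda_1(\gamma) = \inf \Bigg\{ \frac{ \int_0^1 \frac{|w'|^2 F}{|\gamma '|} \,dt}{ \int_0^1 |w|^2 F | \gamma' | \,dt} : w \in C_0^\infty(0,1),\ w\not\equiv 0 \Bigg\}. \] (This is the first Dirichlet eigenvalue of the surface of revolution obtained by rotating $\gamma$ about the axis $x=0$.) *)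

(* Defs.v *)
From Stdlib Require Import Reals.
From Coquelicot Require Import Coquelicot.
Open Scope R_scope.

(* A function on [0,1] is represented by a total function; only its values on
   [0,1] matter.  Smoothness up to the boundary means that the representative
   is C^infty on an open interval containing [0,1], so that [Derive] computes
   the correct one-sided derivatives at 0 and 1. *)
Definition smooth_on_I (f : R -> R) : Prop :=
  exists d : R, 0 < d /\
    forall (n : nat) (t : R), - d < t < 1 + d -> ex_derive_n f n t.

Definition half_plane (p : R * R) : Prop := 0 < fst p.

Definition dist_plane (p q : R * R) : R :=
  dist_euc (fst p) (snd p) (fst q) (snd q).

(* The pair (F, G) of coordinate functions. *)
Definition curve : Type := ((R -> R) * (R -> R))%type.

Definition point (g : curve) (t : R) : R * R := (fst g t, snd g t).

Definition velocity (g : curve) (t : R) : R * R :=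
  (Derive (fst g) t, Derive (snd g) t).

Definition speed (g : curve) (t : R) : R :=
  sqrt (Derive (fst g) t ^ 2 + Derive (snd g) t ^ 2).

Definition admissible (p q : R * R) (g : curve) : Prop :=
  smooth_on_I (fst g) /\ smooth_on_I (snd g) /\
  (forall t : R, 0 <= t <= 1 -> half_plane (point g t)) /\
  (forall t : R, 0 <= t <= 1 -> velocity g t <> (0, 0)) /\
  point g 0 = p /\ point g 1 = q.

(* C_0^infty(0,1), each function being extended by zero to the line. *)
Definition test_function (w : R -> R) : Prop :=
  (forall (n : nat) (t : R), ex_derive_n w n t) /\
  exists a b : R, 0 < a /\ a < b /\ b < 1 /\
    forall t : R, ~ (a <= t <= b) -> w t = 0.

Definition rayleigh (g : curve) (w : R -> R) : R :=
  RInt (fun t => Rabs (Derive w t) ^ 2 * fst g t / speed g t) 0 1 /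
  RInt (fun t => Rabs (w t) ^ 2 * fst g t * speed g t) 0 1.

Definition lambda1 (g : curve) : Rbar :=
  Glb_Rbar (fun x : R =>
    exists w : R -> R,
      test_function w /\ (exists t : R, w t <> 0) /\ x = rayleigh g w).

Definition sup_lambda1 (p q : R * R) : Rbar :=
  Rbar_lub (fun l : Rbar => exists g : curve, admissible p q g /\ l = lambda1 g).

(* [b] is [a] precomposed with a smooth diffeomorphism of [0,1]; injectivity
   of [phi] on [0,1] follows from its derivative not vanishing there. *)
Definition reparametrization (a b : curve) : Prop :=
  exists phi : R -> R,
    smooth_on_I phi /\
    (forall t : R, 0 <= t <= 1 -> 0 <= phi t <= 1) /\
    (forall s : R, 0 <= s <= 1 -> exists t : R, 0 <= t <= 1 /\ phi t = s) /\
    (forall t : R, 0 <= t <= 1 -> Derive phi t <> 0) /\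
    (forall t : R, 0 <= t <= 1 -> point b t = point a (phi t)).

(* Main.v *)
Require Import Defs.
From Stdlib Require Import Reals Lra Psatz Lia Factorial.
From Coquelicot Require Import Coquelicot.
Open Scope R_scope.

(** Why maximizers are unique when q is close to p.

    Put kappa = F(p), x = F / kappa and sigma = sqrt lambda.  Along a curve the
    eigenvalue equation (F w' / |g'|)' + lambda F |g'| w = 0 has a Pruefer form:
    with F w' / (|g'| w) = kappa sigma cot T, the angle T satisfies
      T' = sigma |g'| n(T, x),   n(T, x) = x sin^2 T + cos^2 T / x,
    and w vanishes exactly when T is a multiple of pi.  So lambda1 of a curve is
    sigma^2 exactly when the angle started at 0 at p arrives at q with the value
    pi.  Reading T as a clock, a maximizer is a light ray from p to q which
    minimizes travel time in an isotropic medium whose refractive index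
    n(T, x) depends on time and height.  Two maximizers are two rays with the
    same travel time pi, and uniqueness is a convexity statement: between them
    one would find a faster ray.

    The two comparison principles behind this dictionary need no spectral
    theory.  If an angle on a curve runs at least as fast as the equation asks
    and ends below pi, the Picone identity gives lambda1 > sigma^2
    (strict_barta).  If the solution of the angle equation exceeds pi, its
    eigenfunction has an interior zero, and flattening that eigenfunction near
    its zeros yields C_0^infty test functions showing lambda1 <= sigma^2
    (lambda1_le_of_angle).

    Let alpha and beta be maximizers, with common value sigma^2, and let phi
    match equal angles: Ta (phi t) = Tb t.  Put D = alpha o phi - beta and
    consider the competitor m = beta + tau D.  At equal times both velocities
    have length omega / (sigma n), where omega = Tb', so the parallelogram
    identity puts sigma n |m'| below omega by a multiple of
    sigma^2 |D'|^2 / omega, whereas the variation of the index with the height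
    costs at most a constant times omega |D|^2.  The length of the segment from
    p to q shows that sigma is at least 1 / (4 |q - p|), hence the gain beats
    the loss once integrated, because D vanishes at both ends.  The integration
    is done explicitly: the angle
      U = Tb + c (Y |D|^2 - z),  Y = Y0 exp (11 Tb),
      z = exp (- 10 Tb) int_0^t omega |D|^2,
    satisfies the inequality needed on m (corrected_rate), and it ends at
    pi - c z(1).  Unless D vanishes identically, strict_barta gives
    lambda1 m > sigma^2, contradicting maximality.  Hence
    beta = alpha o phi, and phi is a smooth diffeomorphism of [0,1] because it
    is a smooth angle followed by the inverse of another, both with positive
    derivatives. *)

(** * Smooth functions on open sets of the line *)

(** Undoes the eta-expansions left by auto_derive. *)
Ltac eta :=
  repeat match goal with
  | |- context [Derive (fun x => ?f x) ?t] =>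
      progress change (Derive (fun x => f x) t) with (Derive f t)
  end.

Lemma ex_derive_continuity_pt (f : R -> R) (t : R) :
  ex_derive f t -> continuity_pt f t.
Proof.
  intros df. apply continuity_pt_filterlim.
  exact (ex_derive_continuous (V:=R_NormedModule) f t df).
Qed.

(** Existence of the first n derivatives at all points of D, in the form that makes
    the bootstrap of an equation f' = H (f) an induction on n. *)
Fixpoint diff_on (D : R -> Prop) (n : nat) (f : R -> R) : Prop :=
  match n with
  | O => True
  | S m => (forall t, D t -> ex_derive f t) /\ diff_on D m (Derive f)
  end.

Definition smooth (D : R -> Prop) (f : R -> R) : Prop :=
  forall n, diff_on D n f.

Lemma diff_on_ext (D : R -> Prop) (n : nat) (f g : R -> R) :
  open D -> (forall t, D t -> f t = g t) -> diff_on D n f -> diff_on D n g.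
Proof.
  intros oD; revert f g; induction n as [|n IH]; intros f g efg; [easy|].
  intros [df dDf]; split.
  - intros t Dt. apply ex_derive_ext_loc with f; [|now apply df].
    apply (filter_imp D); [exact efg | now apply oD].
  - apply (IH (Derive f)); [|exact dDf].
    intros t Dt. apply Derive_ext_loc.
    apply (filter_imp D); [exact efg | now apply oD].
Qed.

Lemma diff_on_S (D : R -> Prop) (n : nat) (f f' : R -> R) :
  open D -> (forall t, D t -> is_derive f t (f' t)) -> diff_on D n f' ->
  diff_on D (S n) f.
Proof.
  intros oD df dn; split.
  - intros t Dt. exists (f' t). now apply df.
  - apply diff_on_ext with f'; [exact oD| |exact dn].
    intros t Dt. symmetry. now apply is_derive_unique, df.
Qed.

Lemma diff_on_subset (D E : R -> Prop) (n : nat) (f : R -> R) :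
  (forall t, D t -> E t) -> diff_on E n f -> diff_on D n f.
Proof.
  intros sDE; revert f; induction n as [|n IH]; intros f; [easy|].
  intros [df dDf]; split; auto.
Qed.

Lemma diff_on_pred (D : R -> Prop) (n : nat) (f : R -> R) :
  diff_on D (S n) f -> diff_on D n f.
Proof.
  revert f; induction n as [|n IH]; intros f; [easy|].
  intros [df dDf]; split; [exact df | now apply IH].
Qed.

Lemma diff_on_const (D : R -> Prop) (n : nat) (c : R) :
  open D -> diff_on D n (fun _ => c).
Proof.
  intros oD; revert c; induction n as [|n IH]; intros c; [easy|].
  apply diff_on_S with (fun _ => 0); auto.
  intros t _. auto_derive; auto.
Qed.

Lemma diff_on_id (D : R -> Prop) (n : nat) : open D -> diff_on D n (fun t => t).
Proof.
  intros oD; destruct n as [|n]; [easy|].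
  apply diff_on_S with (fun _ => 1); [exact oD| |now apply diff_on_const].
  intros t _. auto_derive; auto.
Qed.

Lemma diff_on_plus (D : R -> Prop) (n : nat) (f g : R -> R) :
  open D -> diff_on D n f -> diff_on D n g -> diff_on D n (fun t => f t + g t).
Proof.
  intros oD; revert f g; induction n as [|n IH]; intros f g; [easy|].
  intros [df dDf] [dg dDg].
  apply diff_on_S with (fun t => Derive f t + Derive g t); auto.
  intros t Dt. auto_derive; [auto|]. eta. ring.
Qed.

Lemma diff_on_mult (D : R -> Prop) (n : nat) (f g : R -> R) :
  open D -> diff_on D n f -> diff_on D n g -> diff_on D n (fun t => f t * g t).
Proof.
  intros oD; revert f g; induction n as [|n IH]; intros f g; [easy|].
  intros Hf Hg. pose proof Hf as [df dDf]. pose proof Hg as [dg dDg].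
  apply diff_on_S with (fun t => Derive f t * g t + f t * Derive g t); auto.
  - intros t Dt. auto_derive; [auto|]. eta. ring.
  - apply diff_on_pred in Hf; apply diff_on_pred in Hg.
    now apply diff_on_plus; auto.
Qed.

(** The outer function is composed at order n and its derivative at order n - 1, so
    the chain rule closes the induction. *)
Lemma diff_on_comp (D E : R -> Prop) (n : nat) (f g : R -> R) :
  open D -> (forall t, D t -> E (g t)) ->
  diff_on E n f -> diff_on D n g -> diff_on D n (fun t => f (g t)).
Proof.
  intros oD gDE; revert f g gDE; induction n as [|n IH]; intros f g gDE; [easy|].
  intros Hf Hg. pose proof Hf as [df dDf]. pose proof Hg as [dg dDg].
  apply diff_on_S with (fun t => Derive f (g t) * Derive g t); auto.
  - intros t Dt. auto_derive; [auto|]. eta. ring.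
  - apply diff_on_pred in Hg.
    apply diff_on_mult; [exact oD| |exact dDg].
    now apply IH.
Qed.

Lemma open_bounded_interval (a b : R) : open (fun t : R => a < t < b).
Proof. apply open_and; [apply open_gt | apply open_lt]. Qed.

Lemma diff_on_sin_cos (n : nat) :
  diff_on (fun _ => True) n sin /\ diff_on (fun _ => True) n cos.
Proof.
  induction n as [|n [IHs IHc]]; [easy|]; split.
  - apply diff_on_S with cos; auto using open_true.
    intros t _. apply is_derive_Reals, derivable_pt_lim_sin.
  - apply diff_on_S with (fun t => (-1) * sin t); auto using open_true.
    + intros t _. auto_derive; [auto|ring].
    + apply diff_on_mult; auto using open_true, diff_on_const.
Qed.

Lemma diff_on_exp (n : nat) : diff_on (fun _ => True) n exp.
Proof.
  induction n as [|n IH]; [easy|].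
  apply diff_on_S with exp; auto using open_true.
  intros t _. apply is_derive_Reals, derivable_pt_lim_exp.
Qed.

Lemma diff_on_inv (D : R -> Prop) (n : nat) (f : R -> R) :
  open D -> (forall t, D t -> f t <> 0) ->
  diff_on D n f -> diff_on D n (fun t => / f t).
Proof.
  intros oD nz; induction n as [|n IH]; [easy|].
  intros Hf. pose proof Hf as [df dDf].
  assert (IH' := IH (diff_on_pred _ _ _ Hf)).
  apply diff_on_S with (fun t => ((-1) * Derive f t) * (/ f t * / f t)); auto.
  - intros t Dt. auto_derive; [auto|]. eta. field. auto.
  - apply diff_on_mult; auto; apply diff_on_mult; auto using diff_on_const.
Qed.

Lemma diff_on_sqrt (D : R -> Prop) (n : nat) (f : R -> R) :
  open D -> (forall t, D t -> 0 < f t) ->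
  diff_on D n f -> diff_on D n (fun t => sqrt (f t)).
Proof.
  intros oD nz; induction n as [|n IH]; [easy|].
  intros Hf. pose proof Hf as [df dDf].
  assert (IH' := IH (diff_on_pred _ _ _ Hf)).
  assert (sp : forall t, D t -> sqrt (f t) <> 0).
  { intros t Dt. apply Rgt_not_eq, sqrt_lt_R0; auto. }
  apply diff_on_S with (fun t => (/ 2 * Derive f t) * / sqrt (f t)); auto.
  - intros t Dt. auto_derive; [auto|]. eta. field. auto.
  - apply diff_on_mult; auto using diff_on_inv.
    apply diff_on_mult; auto using diff_on_const.
Qed.

Section SmoothClosure.
Variable D : R -> Prop.
Hypothesis oD : open D.

Lemma smooth_const (c : R) : smooth D (fun _ => c).
Proof. intros n. now apply diff_on_const. Qed.
Lemma smooth_id : smooth D (fun t => t).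
Proof. intros n. now apply diff_on_id. Qed.
Lemma smooth_plus (f g : R -> R) :
  smooth D f -> smooth D g -> smooth D (fun t => f t + g t).
Proof. intros Hf Hg n. now apply diff_on_plus. Qed.
Lemma smooth_mult (f g : R -> R) :
  smooth D f -> smooth D g -> smooth D (fun t => f t * g t).
Proof. intros Hf Hg n. now apply diff_on_mult. Qed.
Lemma smooth_minus (f g : R -> R) :
  smooth D f -> smooth D g -> smooth D (fun t => f t - g t).
Proof.
  intros Hf Hg n. apply diff_on_ext with (fun t => f t + (-1) * g t); auto.
  - intros; ring.
  - apply diff_on_plus; auto. apply diff_on_mult; auto using diff_on_const.
Qed.
Lemma smooth_inv (f : R -> R) :
  (forall t, D t -> f t <> 0) -> smooth D f -> smooth D (fun t => / f t).
Proof. intros nz Hf n. now apply diff_on_inv. Qed.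
Lemma smooth_div (f g : R -> R) : (forall t, D t -> g t <> 0) ->
  smooth D f -> smooth D g -> smooth D (fun t => f t / g t).
Proof. intros nz Hf Hg. apply smooth_mult; auto using smooth_inv. Qed.
Lemma smooth_sqrt (f : R -> R) :
  (forall t, D t -> 0 < f t) -> smooth D f -> smooth D (fun t => sqrt (f t)).
Proof. intros nz Hf n. now apply diff_on_sqrt. Qed.
Lemma smooth_comp (E : R -> Prop) (f g : R -> R) :
  (forall t, D t -> E (g t)) ->
  smooth E f -> smooth D g -> smooth D (fun t => f (g t)).
Proof. intros gDE Hf Hg n. now apply (diff_on_comp D E). Qed.
Lemma smooth_exp (f : R -> R) : smooth D f -> smooth D (fun t => exp (f t)).
Proof. intros Hf. apply (smooth_comp (fun _ => True)); auto. exact diff_on_exp. Qed.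
Lemma smooth_sin (f : R -> R) : smooth D f -> smooth D (fun t => sin (f t)).
Proof.
  intros Hf. apply (smooth_comp (fun _ => True)); auto.
  intros n; apply diff_on_sin_cos.
Qed.
Lemma smooth_cos (f : R -> R) : smooth D f -> smooth D (fun t => cos (f t)).
Proof.
  intros Hf. apply (smooth_comp (fun _ => True)); auto.
  intros n; apply diff_on_sin_cos.
Qed.
Lemma smooth_pow2 (f : R -> R) : smooth D f -> smooth D (fun t => f t ^ 2).
Proof.
  intros Hf n. apply diff_on_ext with (fun t => f t * f t); auto.
  - intros; ring.
  - now apply smooth_mult.
Qed.
Lemma smooth_Derive (f : R -> R) : smooth D f -> smooth D (Derive f).
Proof. intros Hf n. apply (Hf (S n)). Qed.
Lemma smooth_ex_derive (f : R -> R) (t : R) : smooth D f -> D t -> ex_derive f t.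
Proof. intros Hf Dt. now apply (Hf 1%nat). Qed.
Lemma smooth_is_derive (f : R -> R) (t : R) :
  smooth D f -> D t -> is_derive f t (Derive f t).
Proof. intros Hf Dt. now apply Derive_correct, (smooth_ex_derive f). Qed.
Lemma smooth_continuous (f : R -> R) (t : R) : smooth D f -> D t -> continuous f t.
Proof. intros Hf Dt. now apply (ex_derive_continuous (V:=R_NormedModule)), (smooth_ex_derive f). Qed.
Lemma smooth_ext (f g : R -> R) :
  (forall t, D t -> f t = g t) -> smooth D f -> smooth D g.
Proof. intros e Hf n. now apply diff_on_ext with f. Qed.
(** One direction of the bootstrap: a function gains one order over its derivative. *)
Lemma smooth_primitive (f f' : R -> R) :
  (forall t, D t -> is_derive f t (f' t)) -> smooth D f' -> smooth D f.
Proof.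
  intros df Hf' [|n]; [easy|]. now apply diff_on_S with f'.
Qed.

Lemma smooth_ex_derive_n (f : R -> R) (n : nat) (t : R) :
  smooth D f -> D t -> ex_derive_n f n t.
Proof.
  intros Hf Dt. destruct n as [|n]; [easy|].
  revert f Hf; induction n as [|n IH]; intros f Hf.
  - now apply (smooth_ex_derive f).
  - change (ex_derive (Derive_n f (S n)) t).
    apply ex_derive_ext with (Derive_n (Derive f) n).
    + intros s. change (Derive f) with (Derive_n f 1). rewrite Derive_n_comp.
      now replace (n + 1)%nat with (S n) by lia.
    + apply (IH (Derive f)). now apply smooth_Derive.
Qed.

Lemma ex_derive_n_smooth (f : R -> R) :
  (forall n t, D t -> ex_derive_n f n t) -> smooth D f.
Proof.
  intros Hf n. change f with (Derive_n f 0). generalize O as k.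
  induction n as [|n IH]; intros k; [easy|].
  split.
  - intros t Dt. apply (Hf (S k) t Dt).
  - apply (IH (S k)).
Qed.
End SmoothClosure.

Lemma smooth_subset (D E : R -> Prop) (f : R -> R) :
  (forall t, D t -> E t) -> smooth E f -> smooth D f.
Proof. intros s Hf n. now apply diff_on_subset with E. Qed.

(** The functions x^(-k) exp (-1/x), extended by zero: a family closed under
    differentiation up to linear combinations, which makes the smoothness of
    exp (-1/x) at 0 an induction on the order for all k at once. *)
Definition flat (k : nat) (x : R) : R :=
  if Rlt_dec 0 x then (/ x) ^ k * exp (- / x) else 0.

Lemma exp_ge_pow (k : nat) (y : R) : 0 <= y -> y ^ k <= INR (fact k) * exp y.
Proof.
  intros Hy. revert y Hy; induction k as [|k IH]; intros y Hy.
  - simpl. generalize (exp_ineq1_le y); lra.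
  - remember (INR (fact (S k))) as M eqn:EM.
    assert (HM : M = INR (S k) * INR (fact k)) by now rewrite EM, fact_simpl, mult_INR.
    assert (HMp : 0 < M) by (rewrite EM; apply INR_fact_lt_0). clear EM.
    assert (Hmono : forall y, 0 <= y -> 0 <= M * exp y - y ^ S k).
    { clear y Hy; intros y Hy.
      destruct (MVT_gen (fun y => M * exp y - y ^ S k) 0 y
        (fun y => INR (S k) * (INR (fact k) * exp y - y ^ k))) as [c [Hc E]].
      - intros x _. auto_derive; [auto|]. simpl pred.
        change (match k with 0%nat => 1 | S _ => INR k + 1 end) with (INR (S k)).
        rewrite HM. ring.
      - intros x _. apply ex_derive_continuity_pt.
        auto_derive; auto.
      - rewrite Rmin_left, Rmax_right in Hc by lra.
        assert (0 <= INR (S k) * (INR (fact k) * exp c - c ^ k) * (y - 0)).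
        { apply Rmult_le_pos; [|lra]. apply Rmult_le_pos; [apply pos_INR|].
          generalize (IH c (proj1 Hc)); lra. }
        rewrite exp_0, pow_i in E by lia. lra. }
    generalize (Hmono y Hy); lra.
Qed.

(** This linear bound is what gives every member of the family the derivative 0 at
    the origin, since flat k h / h = flat (k + 1) h. *)
Lemma flat_bound (k : nat) (x : R) : 0 < x -> flat k x <= INR (fact (S k)) * x.
Proof.
  intros Hx. unfold flat. destruct (Rlt_dec 0 x) as [_|]; [|lra].
  assert (Hi : 0 < / x) by now apply Rinv_0_lt_compat.
  generalize (exp_ge_pow (S k) (/ x) (Rlt_le _ _ Hi)); intros H.
  rewrite exp_Ropp.
  apply Rmult_le_reg_r with (exp (/ x) * / x).
  { apply Rmult_lt_0_compat; [apply exp_pos | exact Hi]. }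
  simpl in H |- *.
  replace ((/ x) ^ k * / exp (/ x) * (exp (/ x) * / x)) with (/ x * (/ x) ^ k).
  2: { field. split; [lra|apply Rgt_not_eq, exp_pos]. }
  replace (INR (fact k + k * fact k) * x * (exp (/ x) * / x))
    with (INR (fact k + k * fact k) * exp (/ x)) by (field; lra).
  exact H.
Qed.

Lemma flat_pos (k : nat) (x : R) : 0 < x -> 0 < flat k x.
Proof.
  intros Hx. unfold flat. destruct (Rlt_dec 0 x) as [_|]; [|lra].
  apply Rmult_lt_0_compat; [|apply exp_pos].
  now apply pow_lt, Rinv_0_lt_compat.
Qed.

Lemma flat_neg (k : nat) (x : R) : x <= 0 -> flat k x = 0.
Proof. intros Hx. unfold flat. destruct (Rlt_dec 0 x); lra. Qed.

Lemma flat_nonneg (k : nat) (x : R) : 0 <= flat k x.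
Proof.
  destruct (Rlt_le_dec 0 x); [now apply Rlt_le, flat_pos|].
  rewrite flat_neg; lra.
Qed.

Lemma flat_succ (k : nat) (x : R) : flat k x = x * flat (S k) x.
Proof.
  unfold flat. destruct (Rlt_dec 0 x); [|ring]. simpl. field. lra.
Qed.

Lemma is_derive_flat (k : nat) (x : R) :
  is_derive (flat k) x (flat (S (S k)) x - INR k * flat (S k) x).
Proof.
  destruct (Rtotal_order x 0) as [Hx|[Hx|Hx]].
  - apply is_derive_ext_loc with (fun _ => 0).
    + apply (filter_imp (fun y => y < 0)); [|now apply (open_lt 0 x)].
      intros y Hy. now rewrite flat_neg by lra.
    + rewrite !flat_neg by lra. replace (0 - INR k * 0) with 0 by ring.
      apply (is_derive_const (K:=R_AbsRing) (V:=R_NormedModule) 0).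
  - subst x. rewrite !flat_neg by lra. replace (0 - INR k * 0) with 0 by ring.
    apply is_derive_Reals. intros eps Heps.
    set (M := INR (fact (S (S k)))). assert (HM : 0 < M) by apply INR_fact_lt_0.
    assert (Hd : 0 < eps / M) by now apply Rdiv_lt_0_compat.
    exists (mkposreal _ Hd). intros h Hh0 Hh. simpl in Hh.
    rewrite Rplus_0_l, (flat_neg k 0), Rminus_0_r, Rminus_0_r by lra.
    rewrite flat_succ. replace (h * flat (S k) h / h) with (flat (S k) h) by (field; auto).
    rewrite Rabs_right by (apply Rle_ge, flat_nonneg).
    destruct (Rlt_le_dec 0 h) as [Hp|Hn]; [|rewrite flat_neg; lra].
    apply Rle_lt_trans with (M * h); [now apply flat_bound|].
    rewrite Rabs_right in Hh by lra.
    apply Rmult_lt_reg_l with (/ M); [now apply Rinv_0_lt_compat|].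
    replace (/ M * (M * h)) with h by (field; lra). unfold Rdiv in Hh. lra.
  - apply is_derive_ext_loc with (fun y => (/ y) ^ k * exp (- / y)).
    + apply (filter_imp (fun y => 0 < y)); [|now apply (open_gt 0 x)].
      intros y Hy. unfold flat. destruct (Rlt_dec 0 y); lra.
    + unfold flat. destruct (Rlt_dec 0 x) as [_|]; [|lra].
      auto_derive; [split; lra|]. destruct k as [|k].
      * simpl. field. lra.
      * simpl pred. change (match k with 0%nat => 1 | S _ => INR k + 1 end) with (INR (S k)).
        simpl pow. field. lra.
Qed.

Lemma smooth_flat (k : nat) : smooth (fun _ => True) (flat k).
Proof.
  intros n; revert k; induction n as [|n IH]; intros k; [easy|].
  apply diff_on_S with (fun x => flat (S (S k)) x + (- INR k) * flat (S k) x);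
    [apply open_true| |].
  - intros x _. evar_last; [apply is_derive_flat|]. ring.
  - apply diff_on_plus; auto using open_true.
    apply diff_on_mult; auto using open_true, diff_on_const.
Qed.

(** * Ordinary differential equations and inverse functions *)

Lemma derive_nonneg_le (f f' : R -> R) (a b : R) :
  a <= b -> (forall t, a <= t <= b -> is_derive f t (f' t)) ->
  (forall t, a <= t <= b -> 0 <= f' t) -> f a <= f b.
Proof.
  intros ab df pos.
  destruct (MVT_gen f a b f') as [c [Hc E]].
  - rewrite Rmin_left, Rmax_right by lra. intros x Hx. apply df; lra.
  - rewrite Rmin_left, Rmax_right by lra. intros x Hx.
    apply ex_derive_continuity_pt. exists (f' x). apply df; lra.
  - rewrite Rmin_left, Rmax_right in Hc by lra.
    assert (ba : 0 <= b - a) by lra.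
    generalize (Rmult_le_pos _ _ (pos c Hc) ba); lra.
Qed.

(** Working with a primitive H of the bound, in place of its integral, treats both
    signs of t at once. *)
Lemma dominated_primitive (G G' H H' : R -> R) :
  (forall t, is_derive G t (G' t)) -> (forall t, is_derive H t (H' t)) ->
  G 0 = 0 -> H 0 = 0 -> (forall t, Rabs (G' t) <= H' t) ->
  forall t, Rabs (G t) <= Rabs (H t).
Proof.
  intros dG dH G0 H0 le t.
  assert (dm : forall s, is_derive (fun s => H s - G s) s (H' s - G' s)).
  { intros s. exact (is_derive_minus H G s _ _ (dH s) (dG s)). }
  assert (dp : forall s, is_derive (fun s => H s + G s) s (H' s + G' s)).
  { intros s. exact (is_derive_plus H G s _ _ (dH s) (dG s)). }
  assert (bm : forall s, 0 <= H' s - G' s).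
  { intros s. generalize (Rle_abs (G' s)) (le s); lra. }
  assert (bp : forall s, 0 <= H' s + G' s).
  { intros s. generalize (Rabs_maj2 (G' s)) (le s); lra. }
  destruct (Rle_dec 0 t) as [Ht|Ht].
  - generalize (derive_nonneg_le _ _ 0 t Ht (fun s _ => dm s) (fun s _ => bm s)).
    generalize (derive_nonneg_le _ _ 0 t Ht (fun s _ => dp s) (fun s _ => bp s)).
    rewrite G0, H0. intros. rewrite (Rabs_right (H t)) by lra.
    apply Rabs_le; lra.
  - assert (Ht' : t <= 0) by lra.
    generalize (derive_nonneg_le _ _ t 0 Ht' (fun s _ => dm s) (fun s _ => bm s)).
    generalize (derive_nonneg_le _ _ t 0 Ht' (fun s _ => dp s) (fun s _ => bp s)).
    rewrite G0, H0. intros. rewrite (Rabs_left1 (H t)) by lra.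
    apply Rabs_le; lra.
Qed.

Lemma is_derive_primitive (g : R -> R) (a t : R) :
  (forall s, continuous g s) -> is_derive (fun t => RInt g a t) t (g t).
Proof.
  intros cg. apply (is_derive_RInt (V:=R_NormedModule) g _ a).
  - apply filter_forall. intros x. apply (RInt_correct (V:=R_CompleteNormedModule)).
    apply (ex_RInt_continuous (V:=R_CompleteNormedModule)). intros; apply cg.
  - apply cg.
Qed.

Lemma lipschitz_continuous (f : R -> R) (B : R) :
  (forall s t, Rabs (f t - f s) <= B * Rabs (t - s)) -> forall t, continuous f t.
Proof.
  intros lip t. apply continuity_pt_filterlim. intros eps Heps.
  assert (HB : 0 < Rabs B + 1) by (generalize (Rabs_pos B); lra).
  exists (eps / (Rabs B + 1)). split; [now apply Rdiv_lt_0_compat|].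
  intros x [_ Hx]. simpl in *. unfold R_dist in *.
  apply Rle_lt_trans with ((Rabs B + 1) * Rabs (x - t)).
  - apply Rle_trans with (1 := lip t x).
    apply Rmult_le_compat_r; [apply Rabs_pos|]. generalize (Rle_abs B); lra.
  - apply Rmult_lt_reg_l with (/ (Rabs B + 1)); [now apply Rinv_0_lt_compat|].
    rewrite <- Rmult_assoc, Rinv_l, Rmult_1_l, Rmult_comm by lra. exact Hx.
Qed.

Section Picard.
Variables (f : R -> R -> R) (K B : R).
Hypothesis K_pos : 0 < K.
Hypothesis f_bounded : forall t x, Rabs (f t x) <= B.
Hypothesis f_lipschitz : forall t x y, Rabs (f t x - f t y) <= K * Rabs (x - y).
Hypothesis f_continuous : forall x : R -> R,
  (forall t, continuous x t) -> forall t, continuous (fun t => f t (x t)) t.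

Fixpoint picard (n : nat) (t : R) : R :=
  match n with
  | O => 0
  | S m => RInt (fun s => f s (picard m s)) 0 t
  end.

Let W (t : R) : R := exp (2 * K * t) + exp (- (2 * K * t)).
Let H (t : R) : R := (exp (2 * K * t) - exp (- (2 * K * t))) / 2.
Let C : R := B / K.

Lemma picard_bound_nonneg : 0 <= B.
Proof. apply Rle_trans with (2 := f_bounded 0 0), Rabs_pos. Qed.

Lemma weight_pos (t : R) : 0 < W t.
Proof. apply Rplus_lt_0_compat; apply exp_pos. Qed.

Lemma weight_primitive (E t : R) : is_derive (fun t => E * H t) t (K * E * W t).
Proof. unfold H, W. auto_derive; [auto|]. field. Qed.

Lemma weight_primitive_le (t : R) : Rabs (H t) <= W t / 2.
Proof.
  unfold H, W. generalize (exp_pos (2 * K * t)) (exp_pos (- (2 * K * t))); intros.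
  apply Rabs_le; lra.
Qed.

Lemma primitive_weight_bound (E : R) (g : R -> R) :
  (forall s, continuous g s) -> 0 <= E -> (forall s, Rabs (g s) <= K * E * W s) ->
  forall t, Rabs (RInt g 0 t) <= E * W t / 2.
Proof.
  intros cg E0 le t.
  apply Rle_trans with (Rabs (E * H t)).
  - apply (dominated_primitive (fun t => RInt g 0 t) g (fun t => E * H t)
      (fun t => K * E * W t)).
    + intros s. now apply is_derive_primitive.
    + apply weight_primitive.
    + apply (RInt_point (V:=R_CompleteNormedModule)).
    + unfold H. rewrite Rmult_0_r, Ropp_0. field.
    + exact le.
  - rewrite Rabs_mult, (Rabs_right E) by lra.
    generalize (Rmult_le_compat_l E _ _ E0 (weight_primitive_le t)); lra.
Qed.

Lemma picard_continuous (n : nat) (t : R) : continuous (picard n) t.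
Proof.
  revert t; induction n as [|n IH]; intros t.
  - apply continuous_const.
  - apply (ex_derive_continuous (V:=R_NormedModule)).
    eexists. apply is_derive_primitive. apply f_continuous, IH.
Qed.

(** Measured against the weight exp (2 K t) + exp (- 2 K t), each iteration halves
    the distance, so the iterates converge on the whole line without gluing local
    solutions. *)
Lemma picard_step (n : nat) (t : R) :
  Rabs (picard (S n) t - picard n t) <= C * (/ 2) ^ n * W t.
Proof.
  revert t; induction n as [|n IH]; intros t.
  - simpl picard. rewrite Rminus_0_r, pow_O, Rmult_1_r.
    apply Rle_trans with ((C * W t) / 2).
    + apply (primitive_weight_bound C).
      * apply f_continuous. intros; apply continuous_const.
      * apply Rdiv_le_0_compat; [apply picard_bound_nonneg | exact K_pos].
      * intros s. apply Rle_trans with (1 := f_bounded _ _).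
        unfold C. replace (K * (B / K) * W s) with (B * W s) by (field; lra).
        rewrite <- (Rmult_1_r B) at 1.
        apply Rmult_le_compat_l; [apply picard_bound_nonneg|].
        unfold W. generalize (exp_ineq1_le (2 * K * s)) (exp_ineq1_le (- (2 * K * s))); lra.
    + assert (0 <= C * W t); [|lra].
      apply Rmult_le_pos; [|apply Rlt_le, weight_pos].
      apply Rdiv_le_0_compat; [apply picard_bound_nonneg | exact K_pos].
  - replace (picard (S (S n)) t - picard (S n) t)
      with (RInt (fun s => f s (picard (S n) s) - f s (picard n s)) 0 t).
    + replace (C * (/ 2) ^ S n * W t) with (C * (/ 2) ^ n * W t / 2) by (simpl; field).
      apply primitive_weight_bound.
      * intros s. apply (continuous_minus (V:=R_NormedModule));
          apply f_continuous, picard_continuous.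
      * apply Rmult_le_pos; [|apply pow_le; lra].
        apply Rdiv_le_0_compat; [apply picard_bound_nonneg | exact K_pos].
      * intros s. apply Rle_trans with (1 := f_lipschitz _ _ _).
        rewrite !Rmult_assoc. apply Rmult_le_compat_l; [lra|].
        rewrite <- Rmult_assoc. apply IH.
    + apply (RInt_minus (V:=R_CompleteNormedModule));
        apply (ex_RInt_continuous (V:=R_CompleteNormedModule));
        intros; apply f_continuous, picard_continuous.
Qed.

Lemma picard_tail (n k : nat) (t : R) :
  Rabs (picard (n + k) t - picard n t) <= 2 * C * (/ 2) ^ n * W t.
Proof.
  assert (C0 : 0 <= C * W t).
  { apply Rmult_le_pos; [|apply Rlt_le, weight_pos].
    apply Rdiv_le_0_compat; [apply picard_bound_nonneg | exact K_pos]. }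
  assert (le : Rabs (picard (n + k) t - picard n t)
    <= 2 * (C * W t) * ((/ 2) ^ n - (/ 2) ^ (n + k))).
  { induction k as [|k IH].
    - rewrite Nat.add_0_r, !Rminus_diag, Rabs_R0. lra.
    - rewrite Nat.add_succ_r. generalize (picard_step (n + k) t); intros st.
      replace (picard (S (n + k)) t - picard n t) with
        ((picard (S (n + k)) t - picard (n + k) t) + (picard (n + k) t - picard n t)) by ring.
      apply Rle_trans with (1 := Rabs_triang _ _).
      replace (C * (/ 2) ^ (n + k) * W t) with (C * W t * (/ 2) ^ (n + k)) in st by ring.
      simpl pow. lra. }
  apply Rle_trans with (1 := le).
  assert (0 <= (C * W t) * (/ 2) ^ (n + k)) by (apply Rmult_le_pos; [|apply pow_le]; lra).
  lra.
Qed.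

Lemma half_pow_lim (M : R) : is_lim_seq (fun n => M * (/ 2) ^ n) 0.
Proof.
  replace (Finite 0) with (Rbar_mult M 0) by (simpl; f_equal; ring).
  apply is_lim_seq_scal_l, is_lim_seq_geom. rewrite Rabs_right; lra.
Qed.

Lemma picard_limit (t : R) :
  ex_finite_lim_seq (fun n => picard n t).
Proof.
  apply ex_lim_seq_cauchy_corr. intros eps.
  assert (Hl := half_pow_lim (2 * C * W t)).
  apply is_lim_seq_spec in Hl. destruct (Hl (pos_div_2 eps)) as [N HN].
  simpl in HN. exists N.
  assert (tail : forall n, (N <= n)%nat -> Rabs (picard n t - picard N t) < eps / 2).
  { intros n Hn. replace n with (N + (n - N))%nat by lia.
    apply Rle_lt_trans with (1 := picard_tail _ _ _).
    generalize (HN N (Nat.le_refl _)); rewrite Rminus_0_r. intros h.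
    apply Rle_lt_trans with (2 := h).
    replace (2 * C * (/ 2) ^ N * W t) with (2 * C * W t * (/ 2) ^ N) by ring.
    apply Rle_abs. }
  intros n m Hn Hm. generalize (tail n Hn) (tail m Hm); intros h1 h2.
  replace (picard n t - picard m t)
    with ((picard n t - picard N t) + - (picard m t - picard N t)) by ring.
  apply Rle_lt_trans with (1 := Rabs_triang _ _). rewrite Rabs_Ropp. lra.
Qed.

Lemma picard_lipschitz (n : nat) (s t : R) :
  Rabs (picard n t - picard n s) <= B * Rabs (t - s).
Proof.
  destruct n as [|n].
  - simpl. rewrite Rminus_diag, Rabs_R0.
    apply Rmult_le_pos; [apply picard_bound_nonneg | apply Rabs_pos].
  - destruct (MVT_gen (picard (S n)) s t (fun s => f s (picard n s))) as [c [_ E]].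
    + intros x _. apply (is_derive_primitive (fun s => f s (picard n s))).
      apply f_continuous, picard_continuous.
    + intros x _. apply continuity_pt_filterlim. apply (picard_continuous (S n)).
    + rewrite E, Rabs_mult. apply Rmult_le_compat_r; [apply Rabs_pos | apply f_bounded].
Qed.

(** The limit of the iterates solves the integral equation: it inherits the common
    Lipschitz constant B, hence is continuous, and both sides are within a multiple
    of 2^(-n) of the n-th iterate. *)
Theorem global_solution :
  exists x : R -> R, x 0 = 0 /\ forall t, is_derive x t (f t (x t)).
Proof.
  pose (x := fun t => real (Lim_seq (fun n => picard n t))).
  assert (xlim : forall t, is_lim_seq (fun n => picard n t) (x t)).
  { intros t. destruct (picard_limit t) as [l Hl].
    unfold x. now rewrite (is_lim_seq_unique _ _ Hl). }
  assert (xc : forall t, continuous x t).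
  { apply (lipschitz_continuous _ B). intros s t.
    assert (HL : is_lim_seq (fun n => Rabs (picard n t - picard n s)) (Rabs (x t - x s))).
    { apply (is_lim_seq_abs _ (x t - x s)). apply is_lim_seq_minus'; apply xlim. }
    exact (is_lim_seq_le _ (fun _ => B * Rabs (t - s)) _ (B * Rabs (t - s))
      (fun n => picard_lipschitz n s t) HL (is_lim_seq_const _)). }
  assert (xn : forall n t, Rabs (x t - picard n t) <= 2 * C * (/ 2) ^ n * W t).
  { intros n t.
    assert (HL : is_lim_seq (fun k => Rabs (picard (n + k) t - picard n t))
      (Rabs (x t - picard n t))).
    { apply (is_lim_seq_abs _ (x t - picard n t)).
      apply is_lim_seq_minus'; [|apply is_lim_seq_const].
      apply (is_lim_seq_ext (fun k => picard (k + n) t)).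
      - intros k. now rewrite Nat.add_comm.
      - apply -> (is_lim_seq_incr_n (fun k => picard k t) n). apply xlim. }
    exact (is_lim_seq_le _ (fun _ => 2 * C * (/ 2) ^ n * W t) _
      (2 * C * (/ 2) ^ n * W t)
      (fun k => picard_tail n k t) HL (is_lim_seq_const _)). }
  pose (y := fun t => RInt (fun s => f s (x s)) 0 t).
  assert (xy : forall t, x t = y t).
  { intros t.
    assert (le : forall n, Rabs (x t - y t) <= 2 * C * W t * (/ 2) ^ n).
    { intros n. generalize (xn (S n) t); intros h1.
      assert (h2 : Rabs (RInt (fun s => f s (x s) - f s (picard n s)) 0 t)
        <= (2 * C * (/ 2) ^ n) * W t / 2).
      { apply primitive_weight_bound.
        - intros s. apply (continuous_minus (V:=R_NormedModule)).
          + now apply f_continuous.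
          + apply f_continuous, picard_continuous.
        - apply Rmult_le_pos; [|apply pow_le; lra].
          assert (0 <= C); [|lra].
          apply Rdiv_le_0_compat; [apply picard_bound_nonneg | exact K_pos].
        - intros s. apply Rle_trans with (1 := f_lipschitz _ _ _).
          rewrite !Rmult_assoc. apply Rmult_le_compat_l; [lra|].
          rewrite <- !Rmult_assoc. apply xn. }
      assert (e : RInt (fun s => f s (x s) - f s (picard n s)) 0 t = y t - picard (S n) t).
      { apply (RInt_minus (V:=R_CompleteNormedModule));
        apply (ex_RInt_continuous (V:=R_CompleteNormedModule)); intros;
        apply f_continuous; auto using picard_continuous. }
      rewrite e in h2.
      replace (x t - y t) with ((x t - picard (S n) t) + - (y t - picard (S n) t)) by ring.
      apply Rle_trans with (1 := Rabs_triang _ _). rewrite Rabs_Ropp.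
      simpl pow in h1. lra. }
    assert (h := is_lim_seq_le _ _ _ _ le (is_lim_seq_const _) (half_pow_lim _)).
    simpl in h. generalize (Rabs_pos (x t - y t)); intros h'.
    apply Rminus_diag_uniq. apply Rabs_eq_0. lra. }
  exists x. split.
  - rewrite xy. apply (RInt_point (V:=R_CompleteNormedModule)).
  - intros t. apply is_derive_ext with y; [intros; symmetry; apply xy|].
    unfold y. apply (is_derive_primitive (fun s => f s (x s))). now apply f_continuous.
Qed.
End Picard.

(** A derivative bounded below by l > 0 gives surjectivity by the intermediate value
    theorem, and a 1/l-Lipschitz inverse, whose difference quotients are the inverses
    of those of f. *)
Lemma global_inverse (f f' : R -> R) (l : R) : 0 < l ->
  (forall t, is_derive f t (f' t)) -> (forall t, l <= f' t) ->
  exists g : R -> R, (forall y, f (g y) = y) /\ (forall t, g (f t) = t) /\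
    forall y, is_derive g y (/ f' (g y)).
Proof.
  intros Hl df f'l.
  assert (grow : forall s t, s <= t -> l * (t - s) <= f t - f s).
  { intros s t st.
    assert (h : f s - l * s <= f t - l * t).
    { apply (derive_nonneg_le (fun t => f t - l * t) (fun t => f' t - l)); [exact st| |].
      - intros r _. apply (is_derive_minus f (fun t => l * t)); [apply df|].
        auto_derive; [auto|ring].
      - intros r _. generalize (f'l r); lra. }
    lra. }
  assert (fc : forall t, continuity_pt f t).
  { intros t. apply ex_derive_continuity_pt. exists (f' t). apply df. }
  assert (surj : forall y, {x | f x = y}).
  { intros y. set (M := Rabs (y - f 0) / l + 1).
    assert (HM : 0 < M).
    { unfold M. generalize (Rdiv_le_0_compat _ _ (Rabs_pos (y - f 0)) Hl); lra. }
    assert (HlM : Rabs (y - f 0) < l * M).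
    { unfold M. replace (l * (Rabs (y - f 0) / l + 1)) with (Rabs (y - f 0) + l) by (field; lra).
      lra. }
    destruct (IVT_gen f (- M) M y) as [x [_ Hx]].
    - exact fc.
    - generalize (grow (- M) 0) (grow 0 M). intros h1 h2.
      generalize (Rle_abs (y - f 0)) (Rabs_maj2 (y - f 0)); intros.
      rewrite Rmin_left, Rmax_right; lra.
    - exists x. exact Hx. }
  pose (g := fun y => proj1_sig (surj y)).
  assert (fg : forall y, f (g y) = y) by (intros y; exact (proj2_sig (surj y))).
  assert (glip : forall s t, Rabs (g t - g s) <= / l * Rabs (t - s)).
  { intros s t. rewrite <- (fg s), <- (fg t) at 2.
    apply Rmult_le_reg_l with l; [exact Hl|].
    rewrite <- Rmult_assoc, Rinv_r, Rmult_1_l by lra.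
    destruct (Rle_dec (g s) (g t)) as [h|h].
    - generalize (grow _ _ h). intros. rewrite (Rabs_right (g t - g s)) by lra.
      apply Rle_trans with (1 := H), Rle_abs.
    - assert (h' : g t <= g s) by lra. generalize (grow _ _ h'). intros.
      rewrite (Rabs_left1 (g t - g s)) by lra. rewrite Rabs_minus_sym.
      apply Rle_trans with (f (g s) - f (g t)); [lra | apply Rle_abs]. }
  exists g. split; [exact fg|]. split.
  - intros t. destruct (Rtotal_order (g (f t)) t) as [h|[h|h]]; [|exact h|].
    + assert (h' := grow _ _ (Rlt_le _ _ h)). rewrite fg in h'.
      generalize (Rmult_lt_0_compat l (t - g (f t))); lra.
    + assert (h' := grow _ _ (Rlt_le _ _ h)). rewrite fg in h'.
      generalize (Rmult_lt_0_compat l (g (f t) - t)); lra.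
  - intros y. apply is_derive_Reals. intros eps Heps.
    assert (f'p : 0 < f' (g y)) by (generalize (f'l (g y)); lra).
    assert (Hd := df (g y)). apply is_derive_Reals in Hd.
    destruct (Hd (eps * l * f' (g y))) as [delta Hdelta].
    { apply Rmult_lt_0_compat; [apply Rmult_lt_0_compat|]; lra. }
    assert (dp : 0 < l * delta) by (apply Rmult_lt_0_compat; [lra | apply cond_pos]).
    exists (mkposreal _ dp). intros h h0 Hh. simpl in Hh.
    set (k := g (y + h) - g y).
    assert (fk : f (g y + k) - f (g y) = h).
    { unfold k. replace (g y + (g (y + h) - g y)) with (g (y + h)) by ring.
      rewrite !fg. ring. }
    assert (k0 : k <> 0).
    { intros e. rewrite e, Rplus_0_r, Rminus_diag in fk. lra. }
    assert (kh : Rabs k <= / l * Rabs h).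
    { unfold k. replace h with (y + h - y) at 2 by ring. apply glip. }
    assert (kd : Rabs k < delta).
    { apply Rle_lt_trans with (1 := kh). apply Rmult_lt_reg_l with l; [lra|].
      rewrite <- Rmult_assoc, Rinv_r, Rmult_1_l by lra. exact Hh. }
    specialize (Hdelta k k0 kd). rewrite fk in Hdelta.
    replace (k / h - / f' (g y)) with (- (h / k - f' (g y)) * (k / (h * f' (g y)))).
    2: { field. repeat split; lra. }
    rewrite Rabs_mult, Rabs_Ropp. unfold Rdiv at 2.
    rewrite Rabs_mult, Rabs_inv, Rabs_mult, (Rabs_right (f' (g y))) by lra.
    assert (hp : 0 < Rabs h) by now apply Rabs_pos_lt.
    apply Rle_lt_trans with (Rabs (h / k - f' (g y)) * (/ l * Rabs h * / (Rabs h * f' (g y)))).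
    { apply Rmult_le_compat_l; [apply Rabs_pos|].
      apply Rmult_le_compat_r; [|exact kh]. apply Rlt_le, Rinv_0_lt_compat.
      now apply Rmult_lt_0_compat. }
    replace (/ l * Rabs h * / (Rabs h * f' (g y))) with (/ (l * f' (g y))) by (field; lra).
    assert (lf : 0 < l * f' (g y)) by now apply Rmult_lt_0_compat.
    apply Rmult_lt_reg_r with (l * f' (g y)); [exact lf|].
    rewrite Rmult_assoc, Rinv_l, Rmult_1_r by lra. lra.
Qed.

(** * Energies of curves and the lower bound for the eigenvalue *)

(** The interval ]-d, 1 + d[; derivatives at 0 and 1 are two-sided because curves
    are smooth slightly beyond [0,1]. *)
Definition nbhd (d t : R) : Prop := - d < t < 1 + d.

(** The refractive index of the medium in which curves of given eigenvalue are light
    rays: T plays the time, x the height relative to the starting point. *)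
Definition index (T x : R) : R := x * sin T ^ 2 + cos T ^ 2 / x.

Lemma open_nbhd (d : R) : open (nbhd d).
Proof. apply open_bounded_interval. Qed.

Lemma continuous_pos_nbhd (h : R -> R) (t : R) :
  continuous h t -> 0 < h t -> exists d, 0 < d /\ forall s, t - d < s < t + d -> 0 < h s.
Proof.
  intros ch hp.
  destruct (ch (fun y => 0 < y)) as [d Hd].
  - now apply (open_gt 0 (h t)).
  - exists d. split; [apply cond_pos|]. intros s Hs. apply Hd.
    apply Rabs_lt_between'. exact Hs.
Qed.

Lemma positive_extends (d : R) (h : R -> R) :
  0 < d -> (forall t, nbhd d t -> continuous h t) -> (forall t, 0 <= t <= 1 -> 0 < h t) ->
  exists e, 0 < e <= d /\ forall t, nbhd e t -> 0 < h t.
Proof.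
  intros dp ch hp. unfold nbhd in *.
  destruct (continuous_pos_nbhd h 0) as [d0 [d0p H0]]; [apply ch; lra | apply hp; lra|].
  destruct (continuous_pos_nbhd h 1) as [d1 [d1p H1]]; [apply ch; lra | apply hp; lra|].
  exists (Rmin d (Rmin d0 d1)).
  assert (h1 := Rmin_l d (Rmin d0 d1)). assert (h2 := Rmin_r d (Rmin d0 d1)).
  assert (h3 := Rmin_l d0 d1). assert (h4 := Rmin_r d0 d1).
  split; [split; [repeat apply Rmin_pos|]; assumption|].
  intros t Ht. destruct (Rlt_le_dec t 0); [apply H0; lra|].
  destruct (Rlt_le_dec 1 t); [apply H1; lra|]. apply hp; lra.
Qed.

Record regular_on (d : R) (g : curve) : Prop := {
  reg_width : 0 < d;
  reg_fst : smooth (nbhd d) (fst g);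
  reg_snd : smooth (nbhd d) (snd g);
  reg_speed : smooth (nbhd d) (speed g);
  reg_fst_pos : forall t, nbhd d t -> 0 < fst g t;
  reg_speed_pos : forall t, nbhd d t -> 0 < speed g t }.

Lemma sum_squares_pos (a b : R) : (a, b) <> (0, 0) -> 0 < a ^ 2 + b ^ 2.
Proof.
  intros h. destruct (Req_dec a 0) as [ea|na]; [destruct (Req_dec b 0) as [eb|nb]|].
  - subst. now elim h.
  - generalize (pow2_ge_0 a) (pow2_gt_0 b nb); lra.
  - generalize (pow2_ge_0 b) (pow2_gt_0 a na); lra.
Qed.

(** Positivity of the height and of the speed on the compact interval [0,1] persists
    on a neighbourhood. *)
Lemma admissible_regular (p q : R * R) (g : curve) :
  admissible p q g -> exists d, regular_on d g.
Proof.
  intros [[d1 [d1p s1]] [[d2 [d2p s2]] [Fp [vp _]]]].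
  pose (d := Rmin d1 d2). assert (dp : 0 < d) by now apply Rmin_pos.
  assert (h1 := Rmin_l d1 d2). assert (h2 := Rmin_r d1 d2). fold d in h1, h2.
  assert (sF : smooth (nbhd d) (fst g)).
  { apply ex_derive_n_smooth. intros n t Ht. apply s1. unfold nbhd in Ht; lra. }
  assert (sG : smooth (nbhd d) (snd g)).
  { apply ex_derive_n_smooth. intros n t Ht. apply s2. unfold nbhd in Ht; lra. }
  assert (sq : smooth (nbhd d) (fun t => Derive (fst g) t ^ 2 + Derive (snd g) t ^ 2)).
  { apply smooth_plus; try apply open_nbhd;
      apply smooth_pow2; try apply open_nbhd; now apply smooth_Derive. }
  destruct (positive_extends d (fst g) dp) as [e1 [He1 P1]].
  { intros t Ht. now apply (smooth_continuous (nbhd d)). }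
  { exact Fp. }
  destruct (positive_extends d _ dp (fun t Ht => smooth_continuous _ _ t sq Ht)) as [e2 [He2 P2]].
  { intros t Ht. apply sum_squares_pos. exact (vp t Ht). }
  assert (k1 := Rmin_l e1 e2). assert (k2 := Rmin_r e1 e2).
  assert (sub : forall t, nbhd (Rmin e1 e2) t -> nbhd d t) by (unfold nbhd; intros; lra).
  exists (Rmin e1 e2). split.
  - now apply Rmin_pos.
  - now apply smooth_subset with (nbhd d).
  - now apply smooth_subset with (nbhd d).
  - apply smooth_sqrt; [apply open_nbhd| |now apply smooth_subset with (nbhd d)].
    intros t Ht. apply P2. unfold nbhd in *; lra.
  - intros t Ht. apply P1. unfold nbhd in *; lra.
  - intros t Ht. apply sqrt_lt_R0, P2. unfold nbhd in *; lra.
Qed.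

Lemma nbhd_unit (d : R) (g : curve) (t : R) : regular_on d g -> 0 <= t <= 1 -> nbhd d t.
Proof. intros [dp _ _ _ _ _] Ht. unfold nbhd. lra. Qed.

Lemma RInt_pos (f : R -> R) (t : R) :
  (forall s, 0 <= s <= 1 -> continuous f s) -> (forall s, 0 <= s <= 1 -> 0 <= f s) ->
  0 < t < 1 -> 0 < f t -> 0 < RInt f 0 1.
Proof.
  intros cf nf Ht ft.
  destruct (continuous_pos_nbhd f t (cf t ltac:(lra)) ft) as [d [dp Hd]].
  pose (e := Rmin d (Rmin t (1 - t)) / 2).
  assert (h1 := Rmin_l d (Rmin t (1 - t))). assert (h2 := Rmin_r d (Rmin t (1 - t))).
  assert (h3 := Rmin_l t (1 - t)). assert (h4 := Rmin_r t (1 - t)).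
  assert (ep : 0 < Rmin d (Rmin t (1 - t))) by (repeat apply Rmin_pos; lra).
  assert (ex : forall a b, 0 <= a -> a <= b -> b <= 1 -> ex_RInt f a b).
  { intros a b a0 ab b1. apply (ex_RInt_continuous (V:=R_CompleteNormedModule)).
    intros z. rewrite Rmin_left, Rmax_right by lra. intros Hz. apply cf. lra. }
  rewrite <- (RInt_Chasles f 0 (t - e) 1) by (apply ex; unfold e; lra).
  rewrite <- (RInt_Chasles f (t - e) (t + e) 1) by (apply ex; unfold e; lra).
  change (0 < RInt f 0 (t - e) + (RInt f (t - e) (t + e) + RInt f (t + e) 1)).
  assert (0 <= RInt f 0 (t - e)).
  { apply RInt_ge_0; [unfold e; lra | apply ex; unfold e; lra|].
    intros x Hx. apply nf. unfold e in Hx; lra. }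
  assert (0 <= RInt f (t + e) 1).
  { apply RInt_ge_0; [unfold e; lra | apply ex; unfold e; lra|].
    intros x Hx. apply nf. unfold e in Hx; lra. }
  assert (0 < RInt f (t - e) (t + e)).
  { apply RInt_gt_0; [unfold e; lra| |].
    - intros x Hx. apply Hd. unfold e in Hx; lra.
    - intros x Hx. apply cf. unfold e in Hx; lra. }
  lra.
Qed.

Lemma ex_RInt_unit (f : R -> R) :
  (forall s, 0 <= s <= 1 -> continuous f s) -> ex_RInt f 0 1.
Proof.
  intros cf. apply (ex_RInt_continuous (V:=R_CompleteNormedModule)).
  intros z. rewrite Rmin_left, Rmax_right by lra. apply cf.
Qed.

(** The term V' integrates to zero, so a pointwise inequality up to an exact
    derivative suffices. *)
Lemma integral_comparison (c : R) (f g V V' : R -> R) :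
  (forall t, 0 <= t <= 1 -> continuous f t) ->
  (forall t, 0 <= t <= 1 -> continuous g t) ->
  (forall t, 0 <= t <= 1 -> is_derive V t (V' t)) ->
  (forall t, 0 <= t <= 1 -> continuous V' t) -> V 0 = V 1 ->
  (forall t, 0 <= t <= 1 -> c * f t + V' t <= g t) ->
  c * RInt f 0 1 <= RInt g 0 1.
Proof.
  intros cf cg dV cV V01 le.
  assert (HV : is_RInt V' 0 1 (V 1 - V 0)).
  { apply (is_RInt_derive (V:=R_CompleteNormedModule)); intros x;
      rewrite Rmin_left, Rmax_right by lra; auto. }
  assert (Hf := RInt_correct (V:=R_CompleteNormedModule) _ _ _ (ex_RInt_unit f cf)).
  assert (Hg := RInt_correct (V:=R_CompleteNormedModule) _ _ _ (ex_RInt_unit g cg)).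
  assert (Hs := is_RInt_plus (V:=R_NormedModule) _ _ _ _ _ _
    (is_RInt_scal (V:=R_NormedModule) f 0 1 c _ Hf) HV).
  replace (c * RInt f 0 1) with (c * RInt f 0 1 + (V 1 - V 0)) by (rewrite V01; ring).
  apply (is_RInt_le _ _ _ _ _ _ Rle_0_1 Hs Hg).
  intros t Ht. apply le. lra.
Qed.

Section Energy.
Variables (d : R) (g : curve).
Hypothesis reg : regular_on d g.
Notation F := (fst g).
Notation S := (speed g).

Definition dirichlet (w : R -> R) (t : R) : R := Rabs (Derive w t) ^ 2 * F t / S t.
Definition mass (w : R -> R) (t : R) : R := Rabs (w t) ^ 2 * F t * S t.

Lemma test_smooth (w : R -> R) : test_function w -> smooth (nbhd d) w.
Proof. intros [sw _]. apply ex_derive_n_smooth. intros n t _. apply sw. Qed.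

Lemma test_boundary (w : R -> R) : test_function w -> w 0 = 0 /\ w 1 = 0.
Proof. intros [_ [a [b [H0 [H1 [H2 H]]]]]]. split; apply H; lra. Qed.

Lemma dirichlet_continuous (w : R -> R) (t : R) :
  test_function w -> 0 <= t <= 1 -> continuous (dirichlet w) t.
Proof.
  intros tw Ht. destruct reg as [dp rF rG rS pF pS]. assert (oD := open_nbhd d).
  apply (smooth_continuous (nbhd d)); [|unfold nbhd; lra].
  apply smooth_ext with (fun t => Derive w t ^ 2 * F t / S t); [exact oD| |].
  { intros s _. unfold dirichlet. now rewrite pow2_abs. }
  apply smooth_div; auto.
  - intros s Hs. generalize (pS s Hs); lra.
  - apply smooth_mult; auto. apply smooth_pow2; auto. now apply smooth_Derive, test_smooth.
Qed.

Lemma mass_continuous (w : R -> R) (t : R) :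
  test_function w -> 0 <= t <= 1 -> continuous (mass w) t.
Proof.
  intros tw Ht. destruct reg as [dp rF rG rS pF pS]. assert (oD := open_nbhd d).
  apply (smooth_continuous (nbhd d)); [|unfold nbhd; lra].
  apply smooth_ext with (fun t => w t ^ 2 * F t * S t); [exact oD| |].
  { intros s _. unfold mass. now rewrite pow2_abs. }
  apply smooth_mult; auto. apply smooth_mult; auto.
  apply smooth_pow2; auto. now apply test_smooth.
Qed.

Lemma mass_nonneg (w : R -> R) (t : R) : 0 <= t <= 1 -> 0 <= mass w t.
Proof.
  intros Ht. unfold mass. assert (Hn := nbhd_unit d g t reg Ht).
  apply Rmult_le_pos; [apply Rmult_le_pos|]; [apply pow2_ge_0| |];
    apply Rlt_le; now apply reg.
Qed.

Lemma total_mass_pos (w : R -> R) :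
  test_function w -> (exists t, w t <> 0) -> 0 < RInt (mass w) 0 1.
Proof.
  intros tw [t wt]. destruct (tw) as [_ [a [b [H0 [H1 [H2 H]]]]]].
  assert (Ht : 0 < t < 1).
  { destruct (Rlt_dec t a); [elim wt; apply H; lra|].
    destruct (Rlt_dec b t); [elim wt; apply H; lra|]. lra. }
  apply RInt_pos with t.
  - intros; now apply mass_continuous.
  - intros; now apply mass_nonneg.
  - exact Ht.
  - assert (Hn := nbhd_unit d g t reg ltac:(lra)). unfold mass. rewrite pow2_abs.
    apply Rmult_lt_0_compat; [apply Rmult_lt_0_compat|];
      [now apply pow2_gt_0 | now apply reg..].
Qed.

Lemma lambda1_ge (l : R) :
  (forall w, test_function w -> l * RInt (mass w) 0 1 <= RInt (dirichlet w) 0 1) ->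
  Rbar_le l (lambda1 g).
Proof.
  intros le. unfold lambda1. apply Glb_Rbar_correct.
  intros x [w [tw [wnz ->]]]. simpl. unfold rayleigh. fold (dirichlet w). fold (mass w).
  assert (mp := total_mass_pos w tw wnz).
  apply Rle_div_r; [exact mp|]. now apply le.
Qed.

Lemma lambda1_le_energy (l : R) (w : R -> R) :
  Rbar_le l (lambda1 g) -> test_function w -> (exists t, w t <> 0) ->
  l * RInt (mass w) 0 1 <= RInt (dirichlet w) 0 1.
Proof.
  intros le tw wnz.
  assert (mp := total_mass_pos w tw wnz).
  apply Rle_div_r; [exact mp|].
  change (Rbar_le l (rayleigh g w)). apply Rbar_le_trans with (1 := le).
  unfold lambda1. apply Glb_Rbar_correct. exists w. auto.
Qed.

Section Barta.
Variables kappa sigma : R.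
Hypothesis kappa_pos : 0 < kappa.

(** The Picone identity: with P = kappa sigma cot T,
      (F / S) w'^2 - (P w^2)' = (F / S) (w' - P S w / F)^2 - (P' + P^2 S / F) w^2,
    and the hypothesis on T' is the Riccati inequality
    - P' - P^2 S / F >= sigma^2 F S. *)
Lemma picone (T T' : R -> R) :
  (forall t, 0 <= t <= 1 -> is_derive T t (T' t)) ->
  (forall t, 0 <= t <= 1 -> continuous T' t) ->
  (forall t, 0 <= t <= 1 -> 0 < T t < PI) -> 0 <= sigma ->
  (forall t, 0 <= t <= 1 -> sigma * S t * index (T t) (F t / kappa) <= T' t) ->
  Rbar_le (sigma ^ 2) (lambda1 g).
Proof.
  intros dT cT' rT sp le. apply lambda1_ge. intros w tw.
  assert (sw := test_smooth w tw). destruct (test_boundary w tw) as [w0 w1].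
  assert (dw : forall t, 0 <= t <= 1 -> is_derive w t (Derive w t)).
  { intros t Ht. apply (smooth_is_derive (nbhd d)); [exact sw|]. now apply nbhd_unit with g. }
  pose (V := fun t => kappa * sigma * (cos (T t) / sin (T t)) * w t ^ 2).
  pose (V' := fun t => - (kappa * sigma * T' t / sin (T t) ^ 2) * w t ^ 2
                       + 2 * kappa * sigma * (cos (T t) / sin (T t)) * w t * Derive w t).
  assert (sinp : forall t, 0 <= t <= 1 -> 0 < sin (T t)).
  { intros t Ht. apply sin_gt_0; apply rT; exact Ht. }
  apply (integral_comparison _ _ _ V V').
  - intros; now apply mass_continuous.
  - intros; now apply dirichlet_continuous.
  - intros t Ht. unfold V, V'. assert (h := sinp t Ht).
    evar_last.
    + apply (is_derive_mult (fun t => kappa * sigma * (cos (T t) / sin (T t)))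
        (fun t => w t ^ 2)).
      * apply (is_derive_scal (fun t => cos (T t) / sin (T t))).
        apply is_derive_div; [..|lra].
        -- apply (is_derive_comp cos T); [apply is_derive_Reals, derivable_pt_lim_cos | now apply dT].
        -- apply (is_derive_comp sin T); [apply is_derive_Reals, derivable_pt_lim_sin | now apply dT].
      * apply (is_derive_pow w 2). now apply dw.
      * intros; apply Rmult_comm.
    + unfold mult, scal, plus; simpl. unfold mult; simpl.
      assert (e : cos (T t) * cos (T t) = 1 - sin (T t) * sin (T t)).
      { generalize (sin2_cos2 (T t)). unfold Rsqr. lra. }
      replace ((T' t * - sin (T t) * sin (T t) - cos (T t) * (T' t * cos (T t))) /
        (sin (T t) * (sin (T t) * 1))) with (- T' t / sin (T t) ^ 2).
      2: { replace (T' t * - sin (T t) * sin (T t) - cos (T t) * (T' t * cos (T t)))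
            with (- T' t * (sin (T t) * sin (T t)) - T' t * (cos (T t) * cos (T t))) by ring.
           rewrite e. field. lra. }
      field. lra.
  - intros t Ht. unfold V'. assert (h := sinp t Ht).
    assert (cTt : continuous T t).
    { apply (ex_derive_continuous (V:=R_NormedModule)). eexists. now apply dT. }
    assert (Hn := nbhd_unit d g t reg Ht).
    assert (cw := smooth_continuous _ w t sw Hn).
    assert (cw' := smooth_continuous _ _ t (smooth_Derive _ w sw) Hn).
    assert (cs : continuous (fun t => sin (T t)) t).
    { apply (continuous_comp T sin); [exact cTt|]. apply continuity_pt_filterlim, continuity_sin. }
    assert (cc : continuous (fun t => cos (T t)) t).
    { apply (continuous_comp T cos); [exact cTt|]. apply continuity_pt_filterlim, continuity_cos. }
    assert (ci : continuous (fun t => / sin (T t)) t).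
    { apply (continuous_comp (fun t => sin (T t)) Rinv); [exact cs|].
      apply continuous_Rinv. lra. }
    apply (continuous_ext (fun t =>
      (- (kappa * sigma) * T' t * (/ sin (T t) * / sin (T t))) * (w t * w t)
      + (2 * kappa * sigma) * (cos (T t) * / sin (T t)) * (w t * Derive w t))).
    { intros s. simpl. unfold Rdiv. rewrite Rmult_1_r, Rinv_mult. ring. }
    apply (continuous_plus (V:=R_NormedModule));
      repeat apply (continuous_mult (K:=R_AbsRing)); auto; apply continuous_const.
  - unfold V. rewrite w0, w1. ring.
  - intros t Ht. unfold V', mass, dirichlet. rewrite !pow2_abs.
    assert (Hn := nbhd_unit d g t reg Ht).
    assert (h := sinp t Ht). assert (Fp := reg_fst_pos _ _ reg t Hn).
    assert (Sp := reg_speed_pos _ _ reg t Hn). specialize (le t Ht). unfold index in le.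
    generalize (Derive w t). intros w'.
    set (s := sin (T t)) in *. set (c := cos (T t)) in *.
    apply Rle_trans with (sigma ^ 2 * (w t ^ 2 * F t * S t) +
      (- (kappa * sigma * (sigma * S t * (F t / kappa * s ^ 2 + c ^ 2 / (F t / kappa))) / s ^ 2)
        * w t ^ 2 + 2 * kappa * sigma * (c / s) * w t * w')).
    + apply Rplus_le_compat_l, Rplus_le_compat_r, Rmult_le_compat_r; [apply pow2_ge_0|].
      apply Ropp_le_contravar. unfold Rdiv at 1 4. apply Rmult_le_compat_r.
      { apply Rlt_le, Rinv_0_lt_compat, pow_lt, h. }
      apply Rmult_le_compat_l; [|exact le].
      apply Rmult_le_pos; lra.
    + apply Rminus_le.
      replace (_ - _) with (- (F t / S t * (w' - kappa * sigma * (c / s) * (S t / F t) * w t) ^ 2)).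
      2: { field. repeat split; lra. }
      assert (0 <= F t / S t * (w' - kappa * sigma * (c / s) * (S t / F t) * w t) ^ 2); [|lra].
      apply Rmult_le_pos; [|apply pow2_ge_0]. apply Rlt_le, Rdiv_lt_0_compat; lra.
Qed.
End Barta.
End Energy.

Lemma sin_sqr_lipschitz (a b : R) : Rabs (sin a ^ 2 - sin b ^ 2) <= 2 * Rabs (a - b).
Proof.
  destruct (MVT_gen (fun x => sin x ^ 2) b a (fun x => 2 * sin x * cos x)) as [c [_ E]].
  - intros x _. auto_derive; [auto|ring].
  - intros x _. apply ex_derive_continuity_pt. auto_derive; auto.
  - rewrite E, Rabs_mult. apply Rmult_le_compat_r; [apply Rabs_pos|].
    generalize (SIN_bound c) (COS_bound c); intros. apply Rabs_le. nra.
Qed.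

Lemma cos_sqr (a : R) : cos a ^ 2 = 1 - sin a ^ 2.
Proof. generalize (sin2_cos2 a). unfold Rsqr. lra. Qed.

Lemma index_lipschitz (a b x : R) : 0 < x ->
  Rabs (index a x - index b x) <= 2 * (x + / x) * Rabs (a - b).
Proof.
  intros xp. assert (ip := Rinv_0_lt_compat x xp). unfold index, Rdiv. rewrite !cos_sqr.
  replace (_ - _) with ((x - / x) * (sin a ^ 2 - sin b ^ 2)) by ring.
  rewrite Rabs_mult. replace (2 * (x + / x) * Rabs (a - b))
    with ((x + / x) * (2 * Rabs (a - b))) by ring.
  apply Rmult_le_compat; try apply Rabs_pos.
  - apply Rabs_le; lra.
  - apply sin_sqr_lipschitz.
Qed.

Lemma sin_sqr_range (a : R) : 0 <= sin a ^ 2 <= 1.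
Proof. generalize (SIN_bound a); intros; split; nra. Qed.

Lemma index_pos (a x : R) : 0 < x -> 0 < index a x.
Proof.
  intros xp. assert (ip := Rinv_0_lt_compat x xp). unfold index, Rdiv. rewrite cos_sqr.
  generalize (sin_sqr_range a); intros. destruct (Rlt_dec x (/ x)); nra.
Qed.

Lemma index_le (a x : R) : 0 < x -> index a x <= x + / x.
Proof.
  intros xp. assert (ip := Rinv_0_lt_compat x xp). unfold index, Rdiv. rewrite cos_sqr.
  generalize (sin_sqr_range a); intros. nra.
Qed.

Lemma bounded_on_unit (h : R -> R) :
  (forall t, 0 <= t <= 1 -> continuous h t) ->
  exists M, 0 < M /\ forall t, 0 <= t <= 1 -> h t <= M.
Proof.
  intros ch. destruct (continuity_ab_maj h 0 1 Rle_0_1) as [m [Hm _]].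
  - intros c Hc. apply continuity_pt_filterlim. now apply ch.
  - exists (Rabs (h m) + 1). split; [generalize (Rabs_pos (h m)); lra|].
    intros t Ht. generalize (Hm t Ht) (Rle_abs (h m)); lra.
Qed.

Lemma medium_bound (d : R) (g : curve) (kappa : R) : regular_on d g -> 0 < kappa ->
  exists M, 0 < M /\ forall t, 0 <= t <= 1 ->
    speed g t * (fst g t / kappa + / (fst g t / kappa)) <= M.
Proof.
  intros reg kp. apply bounded_on_unit. intros t Ht.
  apply (smooth_continuous (nbhd d)); [|now apply nbhd_unit with g].
  assert (oD := open_nbhd d).
  assert (sx : smooth (nbhd d) (fun t => fst g t / kappa)).
  { apply smooth_div; [exact oD| |apply reg|now apply smooth_const]. intros; lra. }
  apply smooth_mult; [exact oD|apply reg|]. apply smooth_plus; [exact oD|exact sx|].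
  apply smooth_inv; [exact oD| |exact sx].
  intros s Hs. apply Rgt_not_eq, Rdiv_lt_0_compat; [now apply reg | exact kp].
Qed.

(** An angle that ends strictly below pi leaves room for T + eps exp (K t): this
    stays inside ]0, pi[ and, for K above the Lipschitz constant of the right-hand
    side in T, satisfies the inequality with room for a larger sigma. *)
Lemma strict_barta (d : R) (g : curve) (kappa sigma : R) (T T' : R -> R) :
  regular_on d g -> 0 < kappa -> 0 < sigma ->
  (forall t, 0 <= t <= 1 -> is_derive T t (T' t)) ->
  (forall t, 0 <= t <= 1 -> continuous T' t) -> 0 <= T 0 -> T 1 < PI ->
  (forall t, 0 <= t <= 1 ->
     sigma * speed g t * index (T t) (fst g t / kappa) <= T' t) ->
  Rbar_lt (sigma ^ 2) (lambda1 g).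
Proof.
  intros reg kp sp dT cT' T0 T1 le.
  destruct (medium_bound d g kappa reg kp) as [M [Mp HM]].
  (* The growth rate 2 sigma M is the Lipschitz constant of the right-hand side in the
     angle; the extra 1 is the room used to enlarge sigma. *)
  pose (K := 2 * sigma * M + 1).
  assert (sM : 0 < sigma * M) by now apply Rmult_lt_0_compat.
  pose (eps := (PI - T 1) / (2 * exp K)).
  assert (ep : 0 < eps).
  { apply Rdiv_lt_0_compat; [lra|]. generalize (exp_pos K); lra. }
  assert (eK : eps * exp K < PI - T 1).
  { unfold eps. generalize (exp_pos K); intros.
    replace (_ * _) with ((PI - T 1) / 2) by (field; lra). lra. }
  pose (eta := eps / M). assert (etap : 0 < eta) by now apply Rdiv_lt_0_compat.
  assert (xp : forall t, 0 <= t <= 1 -> 0 < fst g t / kappa).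
  { intros t Ht. apply Rdiv_lt_0_compat; [|exact kp]. now apply reg, nbhd_unit with g. }
  assert (Sp : forall t, 0 <= t <= 1 -> 0 < speed g t).
  { intros t Ht. now apply reg, nbhd_unit with g. }
  assert (T'p : forall t, 0 <= t <= 1 -> 0 <= T' t).
  { intros t Ht. apply Rle_trans with (2 := le t Ht). apply Rlt_le.
    apply Rmult_lt_0_compat; [apply Rmult_lt_0_compat|]; auto using index_pos. }
  apply Rbar_lt_le_trans with ((sigma + eta) ^ 2); [simpl; nra|].
  apply (picone d g reg kappa (sigma + eta) kp (fun t => T t + eps * exp (K * t))
    (fun t => T' t + eps * (K * exp (K * t)))).
  - intros t Ht. apply (is_derive_plus T (fun t => eps * exp (K * t))); [now apply dT|].
    auto_derive; [auto|ring].
  - intros t Ht. apply (continuous_plus (V:=R_NormedModule)); [now apply cT'|].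
    apply (ex_derive_continuous (V:=R_NormedModule)). auto_derive; auto.
  - intros t Ht.
    assert (h0 : T 0 <= T t).
    { apply (derive_nonneg_le T T'); [lra| |]; intros s Hs; [apply dT|apply T'p]; lra. }
    assert (h1 : T t <= T 1).
    { apply (derive_nonneg_le T T'); [lra| |]; intros s Hs; [apply dT|apply T'p]; lra. }
    assert (Kp : 0 < K) by (unfold K; lra).
    assert (ht : exp (K * t) <= exp K).
    { destruct (Req_dec t 1) as [->|]; [rewrite Rmult_1_r; lra|].
      apply Rlt_le, exp_increasing. nra. }
    generalize (exp_pos (K * t)); intros h2.
    assert (eps * exp (K * t) <= eps * exp K) by (apply Rmult_le_compat_l; lra).
    assert (0 < eps * exp (K * t)) by now apply Rmult_lt_0_compat.
    lra.
  - lra.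
  - intros t Ht. specialize (le t Ht). specialize (xp t Ht). specialize (Sp t Ht).
    specialize (HM t Ht). set (x := fst g t / kappa) in *. set (E := exp (K * t)) in *.
    assert (E1 : 1 <= E).
    { unfold E. generalize (exp_ineq1_le (K * t)). unfold K. nra. }
    generalize (index_lipschitz (T t + eps * E) (T t) x xp).
    replace (T t + eps * E - T t) with (eps * E) by ring.
    assert (epsE : 0 < eps * E) by (apply Rmult_lt_0_compat; lra).
    rewrite (Rabs_right (eps * E)) by lra. intros h.
    generalize (Rle_abs (index (T t + eps * E) x - index (T t) x)); intros h'.
    generalize (index_le (T t + eps * E) x xp); intros h2.
    set (n1 := index (T t + eps * E) x) in *. set (n0 := index (T t) x) in *.
    assert (a1 : sigma * speed g t * (n1 - n0) <= 2 * sigma * M * (eps * E)).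
    { apply Rle_trans with (sigma * speed g t * (2 * (x + / x) * (eps * E))).
      - apply Rmult_le_compat_l; [apply Rlt_le, Rmult_lt_0_compat|]; lra.
      - replace (_ * _ * _) with ((2 * sigma * (eps * E)) * (speed g t * (x + / x))) by ring.
        replace (2 * sigma * M * (eps * E)) with ((2 * sigma * (eps * E)) * M) by ring.
        apply Rmult_le_compat_l; [nra|exact HM]. }
    assert (a2 : eta * speed g t * n1 <= eps).
    { apply Rle_trans with (eta * M).
      - rewrite Rmult_assoc. apply Rmult_le_compat_l; [lra|].
        apply Rle_trans with (2 := HM). apply Rmult_le_compat_l; lra.
      - unfold eta. apply Req_le. field. lra. }
    assert (a3 : eps <= eps * E) by nra.
    unfold K at 1. replace (eps * ((2 * sigma * M + 1) * E))
      with (2 * sigma * M * (eps * E) + eps * E) by ring.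
    replace ((sigma + eta) * speed g t * n1)
      with (sigma * speed g t * n0 + sigma * speed g t * (n1 - n0) + eta * speed g t * n1) by ring.
    lra.
Qed.

(** * The Pruefer angle *)

Lemma regular_on_smaller (d e : R) (g : curve) :
  regular_on d g -> 0 < e <= d -> regular_on e g.
Proof.
  intros [dp rF rG rS pF pS] He.
  assert (sub : forall t, nbhd e t -> nbhd d t) by (unfold nbhd; intros; lra).
  split; try lra; try (apply smooth_subset with (nbhd d); assumption); auto.
Qed.

(** Projection onto [-e, 1 + e].  Composing the coefficients of the angle equation
    with it makes them bounded on the whole line without changing them on nbhd e. *)
Definition clip (e t : R) : R := Rmax (- e) (Rmin t (1 + e)).

Lemma clip_range (e t : R) : 0 < e -> - e <= clip e t <= 1 + e.
Proof. intros. unfold clip, Rmax, Rmin. repeat destruct Rle_dec; lra. Qed.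

Lemma clip_id (e t : R) : nbhd e t -> clip e t = t.
Proof. unfold nbhd, clip, Rmax, Rmin. intros. repeat destruct Rle_dec; lra. Qed.

Lemma clip_continuous (e t : R) : continuous (clip e) t.
Proof.
  apply (lipschitz_continuous _ 1). clear t. intros s t.
  unfold clip, Rmax, Rmin, Rabs. repeat destruct Rle_dec; repeat destruct Rcase_abs; lra.
Qed.

Lemma clip_bounds (d e : R) (h : R -> R) : 0 < e < d ->
  (forall t, nbhd d t -> continuous h t) -> (forall t, nbhd d t -> 0 < h t) ->
  (forall t, continuous (fun t => h (clip e t)) t) /\
  exists l u, 0 < l /\ forall t, l <= h (clip e t) <= u.
Proof.
  intros He ch hp.
  assert (Hc : forall t, nbhd d (clip e t)).
  { intros t. generalize (clip_range e t (proj1 He)). unfold nbhd. lra. }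
  assert (ch' : forall c, - e <= c <= 1 + e -> continuity_pt h c).
  { intros c Hr. apply continuity_pt_filterlim. apply ch. unfold nbhd; lra. }
  split.
  - intros t. apply (continuous_comp (clip e) h); [apply clip_continuous | now apply ch].
  - destruct (continuity_ab_min h (- e) (1 + e) ltac:(lra) ch') as [m [Hm Hm']].
    destruct (continuity_ab_maj h (- e) (1 + e) ltac:(lra) ch') as [M [HM _]].
    exists (h m), (h M). split; [apply hp; unfold nbhd; lra|].
    intros t. generalize (clip_range e t (proj1 He)). auto.
Qed.

(** The angle T of the solution w of (F w' / |g'|)' + sigma^2 F |g'| w = 0 with
    w 0 = 0, normalized by F w' / (|g'| w) = kappa sigma cot T. *)
Definition pruefer_angle (d kappa sigma : R) (g : curve) (T : R -> R) : Prop :=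
  T 0 = 0 /\ forall t, nbhd d t ->
    is_derive T t (sigma * speed g t * index (T t) (fst g t / kappa)).

(** A lower bound for the derivative on the whole line, so that the angle has a
    global inverse. *)
Definition expanding (T : R -> R) : Prop :=
  exists (T' : R -> R) (l : R),
    0 < l /\ (forall t, is_derive T t (T' t)) /\ (forall t, l <= T' t).

Section Pruefer.
Variables (d kappa : R) (g : curve).
Hypothesis reg : regular_on d g.
Hypothesis kappa_pos : 0 < kappa.
Notation F := (fst g).
Notation S := (speed g).

Lemma smooth_height : smooth (nbhd d) (fun t => F t / kappa).
Proof.
  apply smooth_div; [apply open_nbhd| |apply reg|apply smooth_const, open_nbhd].
  intros; lra.
Qed.

Lemma height_pos (t : R) : nbhd d t -> 0 < F t / kappa.
Proof. intros Ht. apply Rdiv_lt_0_compat; [now apply reg|exact kappa_pos]. Qed.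

(** If T has n derivatives, so does the right-hand side of its equation, and T has
    n + 1. *)
Lemma pruefer_smooth (sigma : R) (T : R -> R) :
  (forall t, nbhd d t -> is_derive T t (sigma * S t * index (T t) (F t / kappa))) ->
  smooth (nbhd d) T.
Proof.
  intros dT n. assert (oD := open_nbhd d).
  induction n as [|n IH]; [easy|].
  apply diff_on_S with (2 := dT); [exact oD|]. unfold index, Rdiv at 2.
  assert (hx := smooth_height n). assert (hS := reg_speed _ _ reg n).
  assert (hs : diff_on (nbhd d) n (fun t => sin (T t))).
  { apply (diff_on_comp _ (fun _ => True)); auto. apply diff_on_sin_cos. }
  assert (hc : diff_on (nbhd d) n (fun t => cos (T t))).
  { apply (diff_on_comp _ (fun _ => True)); auto. apply diff_on_sin_cos. }
  apply diff_on_mult; [exact oD|apply diff_on_mult; auto using diff_on_const|].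
  apply diff_on_ext with
    (fun t => F t / kappa * (sin (T t) * sin (T t)) + cos (T t) * cos (T t) * / (F t / kappa)).
  - exact oD.
  - intros; simpl; ring.
  - apply diff_on_plus; auto; apply diff_on_mult; auto; try (apply diff_on_mult; auto).
    apply diff_on_inv; auto. intros t Ht. generalize (height_pos t Ht); lra.
Qed.

Lemma pruefer_exists (sigma : R) : 0 < sigma ->
  exists T : R -> R, pruefer_angle (d / 2) kappa sigma g T /\ expanding T.
Proof.
  intros sp. assert (dp := reg_width _ _ reg).
  pose (h1 := fun t => sigma * S t * (F t / kappa)).
  pose (h2 := fun t => sigma * S t * / (F t / kappa)).
  assert (oD := open_nbhd d). assert (hx := smooth_height).
  assert (sS : smooth (nbhd d) (fun t => sigma * S t)).
  { apply smooth_mult; auto using smooth_const. apply reg. }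
  assert (pS : forall t, nbhd d t -> 0 < sigma * S t).
  { intros t Ht. apply Rmult_lt_0_compat; [exact sp|]. now apply reg. }
  destruct (clip_bounds d (d / 2) h1) as [c1 [l1 [u1 [l1p b1]]]]; [lra| | |].
  { intros t Ht. apply (smooth_continuous (nbhd d)); [|exact Ht]. now apply smooth_mult. }
  { intros t Ht. apply Rmult_lt_0_compat; auto using height_pos. }
  destruct (clip_bounds d (d / 2) h2) as [c2 [l2 [u2 [l2p b2]]]]; [lra| | |].
  { intros t Ht. apply (smooth_continuous (nbhd d)); [|exact Ht]. apply smooth_mult; auto.
    apply smooth_inv; auto. intros s Hs. generalize (height_pos s Hs); lra. }
  { intros t Ht. apply Rmult_lt_0_compat; auto. now apply Rinv_0_lt_compat, height_pos. }
  pose (f := fun t x => h1 (clip (d / 2) t) * sin x ^ 2 + h2 (clip (d / 2) t) * cos x ^ 2).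
  assert (up : 0 < u1 + u2) by (generalize (b1 0) (b2 0); lra).
  destruct (global_solution f (2 * (u1 + u2)) (u1 + u2)) as [T [T0 dT]].
  - lra.
  - intros t x. unfold f. rewrite cos_sqr. generalize (b1 t) (b2 t) (sin_sqr_range x); intros.
    apply Rabs_le; split; nra.
  - intros t x y. unfold f. rewrite !cos_sqr.
    generalize (b1 t) (b2 t); intros. generalize (sin_sqr_lipschitz x y); intros lip.
    replace (_ - _) with ((h1 (clip (d / 2) t) - h2 (clip (d / 2) t)) * (sin x ^ 2 - sin y ^ 2))
      by ring.
    rewrite Rabs_mult. replace (2 * (u1 + u2) * Rabs (x - y))
      with ((u1 + u2) * (2 * Rabs (x - y))) by ring.
    apply Rmult_le_compat; try apply Rabs_pos; [apply Rabs_le; lra | exact lip].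
  - intros x cx t. unfold f.
    assert (cs : continuous (fun t => sin (x t)) t).
    { apply (continuous_comp x sin); [apply cx|]. apply continuity_pt_filterlim, continuity_sin. }
    assert (cc : continuous (fun t => cos (x t)) t).
    { apply (continuous_comp x cos); [apply cx|]. apply continuity_pt_filterlim, continuity_cos. }
    apply (continuous_ext (fun t => h1 (clip (d / 2) t) * (sin (x t) * sin (x t))
      + h2 (clip (d / 2) t) * (cos (x t) * cos (x t)))).
    { intros s. simpl. ring. }
    apply (continuous_plus (V:=R_NormedModule));
      (apply (continuous_mult (K:=R_AbsRing)); [auto|]);
      now apply (continuous_mult (K:=R_AbsRing)).
  - exists T. split; [split; [exact T0|]|].
    + intros t Ht. evar_last; [apply dT|]. unfold f. rewrite clip_id by exact Ht.
      unfold h1, h2, index, Rdiv. ring.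
    + exists (fun t => f t (T t)), (Rmin l1 l2). split; [now apply Rmin_pos|]. split; [exact dT|].
      intros t. unfold f. rewrite cos_sqr.
      generalize (b1 t) (b2 t) (sin_sqr_range (T t)) (Rmin_l l1 l2) (Rmin_r l1 l2); intros. nra.
Qed.
End Pruefer.

(** * The upper bound for the eigenvalue *)

Lemma flat_slope_le (z : R) : flat 0 z + flat 1 z <= 1.
Proof.
  destruct (Rlt_le_dec 0 z) as [zp|zn]; [|rewrite !flat_neg by lra; lra].
  unfold flat. destruct (Rlt_dec 0 z) as [_|]; [|lra]. simpl. rewrite exp_Ropp.
  generalize (exp_ineq1_le (/ z)) (exp_pos (/ z)); intros h hp.
  apply Rmult_le_reg_r with (exp (/ z)); [exact hp|].
  replace (_ * _) with (1 + / z) by (field; lra). lra.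
Qed.

Lemma flat0_le1 (z : R) : flat 0 z <= 1.
Proof. generalize (flat_slope_le z) (flat_nonneg 1 z); lra. Qed.

Lemma flat0_mono (y z : R) : y <= z -> flat 0 y <= flat 0 z.
Proof.
  intros yz. destruct (Rlt_le_dec 0 y) as [yp|yn].
  - unfold flat. destruct (Rlt_dec 0 y); [|lra]. destruct (Rlt_dec 0 z); [|lra].
    simpl. rewrite !Rmult_1_l. destruct (Req_dec y z) as [->|]; [lra|].
    apply Rlt_le, exp_increasing, Ropp_lt_contravar, Rinv_lt_contravar; [|lra].
    now apply Rmult_lt_0_compat.
  - rewrite (flat_neg 0 y) by exact yn. apply flat_nonneg.
Qed.

Lemma flat0_gap (z : R) : 0 < z -> z * (1 - flat 0 z) <= 1.
Proof.
  intros zp. unfold flat. destruct (Rlt_dec 0 z) as [_|]; [|lra]. simpl.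
  generalize (exp_ineq1_le (- / z)); intros h.
  apply Rle_trans with (z * / z); [|apply Req_le; field; lra].
  apply Rmult_le_compat_l; lra.
Qed.

(** A C^infty substitute for the truncation max (y - eps) 0.  The scale eps^2 in the
    exponent brings it within 2 eps of the identity on y >= 0, for eps <= 1, while its
    slope (1 + r) exp (- r), r = eps^2 / (y - eps), stays at most 1. *)
Definition cut (eps y : R) : R := (y - eps) * flat 0 ((y - eps) / eps ^ 2).

Lemma cut_derive (eps y : R) : 0 < eps ->
  is_derive (cut eps) y (flat 0 ((y - eps) / eps ^ 2) + flat 1 ((y - eps) / eps ^ 2)).
Proof.
  intros ep. unfold cut.
  assert (e2 : 0 < eps ^ 2) by now apply pow_lt.
  assert (d1 : is_derive (fun y => y - eps) y 1) by (auto_derive; [auto|ring]).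
  assert (d2 : is_derive (fun y => (y - eps) / eps ^ 2) y (/ eps ^ 2))
    by (auto_derive; [auto|field; lra]).
  evar_last.
  - apply (is_derive_mult (fun y => y - eps) (fun y => flat 0 ((y - eps) / eps ^ 2))).
    + exact d1.
    + apply (is_derive_comp (flat 0) (fun y => (y - eps) / eps ^ 2)); [apply is_derive_flat|].
      exact d2.
    + intros; apply Rmult_comm.
  - unfold plus, mult, scal; simpl. unfold mult; simpl.
    rewrite (flat_succ 1). field. lra.
Qed.

Lemma cut_smooth (eps : R) : 0 < eps -> smooth (fun _ => True) (cut eps).
Proof.
  intros ep. assert (oT : open (fun _ : R => True)) by apply open_true. unfold cut.
  assert (s1 : smooth (fun _ => True) (fun y => y - eps)).
  { apply smooth_minus; auto using smooth_id, smooth_const. }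
  apply smooth_mult; auto. apply (smooth_comp _ oT (fun _ => True)); auto using smooth_flat.
  apply smooth_div; auto using smooth_const. intros _ _. apply Rgt_not_eq, pow_lt, ep.
Qed.

Lemma cut_zero (eps y : R) : 0 < eps -> y <= eps -> cut eps y = 0.
Proof.
  intros ep ye. unfold cut. rewrite flat_neg; [ring|].
  assert (0 < / eps ^ 2) by now apply Rinv_0_lt_compat, pow_lt.
  unfold Rdiv. nra.
Qed.

Lemma cut_pos (eps y : R) : 0 < eps -> eps < y -> 0 < cut eps y.
Proof.
  intros ep ye. unfold cut. apply Rmult_lt_0_compat; [lra|]. apply flat_pos.
  apply Rdiv_lt_0_compat; [lra|now apply pow_lt].
Qed.

Lemma cut_range (eps y : R) : 0 < eps <= 1 -> 0 <= y -> 0 <= cut eps y <= y /\ y - 2 * eps <= cut eps y.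
Proof.
  intros ep y0. destruct (Rle_lt_dec y eps) as [h|h].
  - rewrite cut_zero by lra. lra.
  - assert (cp := cut_pos eps y (proj1 ep) h).
    assert (e2 : 0 < eps ^ 2) by now apply pow_lt.
    assert (zp : 0 < (y - eps) / eps ^ 2) by (apply Rdiv_lt_0_compat; lra).
    generalize (flat0_gap _ zp) (flat0_le1 ((y - eps) / eps ^ 2)).
    unfold cut in *. set (q := flat 0 ((y - eps) / eps ^ 2)) in *. intros gap le1.
    assert ((y - eps) * (1 - q) <= eps ^ 2).
    { replace (y - eps) with (eps ^ 2 * ((y - eps) / eps ^ 2)) by (field; lra).
      rewrite Rmult_assoc. rewrite <- (Rmult_1_r (eps ^ 2)) at 3.
      apply Rmult_le_compat_l; lra. }
    assert (eps ^ 2 <= eps) by (simpl; nra).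
    repeat split; nra.
Qed.

Lemma cut_decreasing (eps eps1 y : R) : 0 < eps <= eps1 -> cut eps1 y <= cut eps y.
Proof.
  intros h. destruct (Rle_lt_dec y eps1) as [hy|hy].
  - rewrite (cut_zero eps1) by lra.
    destruct (Rle_lt_dec y eps); [rewrite cut_zero; lra|]. apply Rlt_le, cut_pos; lra.
  - unfold cut. apply Rmult_le_compat; [lra|apply flat_nonneg|lra|].
    apply flat0_mono. unfold Rdiv. apply Rmult_le_compat; [lra| |lra|].
    + apply Rlt_le, Rinv_0_lt_compat, pow_lt; lra.
    + apply Rinv_le_contravar; [apply pow_lt; lra|]. apply pow_incr; lra.
Qed.

Lemma primitive_exists (d : R) (r : R -> R) : 0 < d ->
  (forall t, nbhd d t -> continuous r t) ->
  exists P, P 0 = 0 /\ forall t, nbhd d t -> is_derive P t (r t).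
Proof.
  intros dp cr. exists (fun t => RInt r 0 t). split.
  - apply (RInt_point (V:=R_CompleteNormedModule)).
  - intros t Ht. apply (is_derive_RInt (V:=R_NormedModule) r _ 0); [|now apply cr].
    apply (filter_imp (nbhd d)); [|now apply open_nbhd].
    intros s Hs. apply (RInt_correct (V:=R_CompleteNormedModule)).
    apply (ex_RInt_continuous (V:=R_CompleteNormedModule)).
    intros z Hz. apply cr. unfold nbhd in *. unfold Rmin, Rmax in Hz.
    destruct (Rle_dec 0 s); lra.
Qed.

Section UpperBound.
Variables (d kappa sigma : R) (g : curve).
Hypothesis reg : regular_on d g.
Hypothesis kappa_pos : 0 < kappa.
Hypothesis sigma_pos : 0 < sigma.
Notation F := (fst g).
Notation S := (speed g).

(** The amplitude rho is the exponential of the primitive of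
    sigma S sin T cos T (1/x - x), the choice for which rho sin T solves the linear
    equation.  The function v = kappa sigma rho cos T is its momentum F u' / S, so the
    second-order equation is recorded as a first-order system. *)
Lemma pruefer_eigenfunction (T : R -> R) :
  (forall t, nbhd d t -> is_derive T t (sigma * S t * index (T t) (F t / kappa))) ->
  exists u v rho : R -> R,
    smooth (nbhd d) u /\
    (forall t, 0 < rho t /\ u t = rho t * sin (T t)) /\
    (forall t, nbhd d t -> is_derive u t (v t * S t / F t)) /\
    (forall t, nbhd d t -> is_derive v t (- (sigma ^ 2 * S t * F t * u t))).
Proof.
  intros dT. assert (oD := open_nbhd d). assert (dp := reg_width _ _ reg).
  assert (sT := pruefer_smooth d kappa g reg kappa_pos sigma T dT).
  pose (x := fun t => F t / kappa).
  assert (sx := smooth_height d kappa g reg kappa_pos). fold x in sx.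
  assert (xp : forall t, nbhd d t -> 0 < x t) by (intros; now apply height_pos with d).
  pose (r := fun t => sigma * S t * (sin (T t) * cos (T t)) * (/ x t - x t)).
  assert (sr : smooth (nbhd d) r).
  { apply smooth_mult; auto.
    - apply smooth_mult; auto.
      + apply smooth_mult; auto using smooth_const. apply reg.
      + apply smooth_mult; auto using smooth_sin, smooth_cos.
    - apply smooth_minus; auto. apply smooth_inv; auto.
      intros t Ht. generalize (xp t Ht); lra. }
  destruct (primitive_exists d r dp) as [P [_ dP]].
  { intros t Ht. now apply (smooth_continuous (nbhd d)). }
  assert (sP := smooth_primitive _ oD P r dP sr).
  exists (fun t => exp (P t) * sin (T t)), (fun t => kappa * sigma * (exp (P t) * cos (T t))),
    (fun t => exp (P t)).
  split; [|split; [|split]].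
  - apply smooth_mult; auto using smooth_exp, smooth_sin.
  - intros t. split; [apply exp_pos | reflexivity].
  - intros t Ht.
    assert (xt := xp t Ht). assert (Fp := reg_fst_pos _ _ reg t Ht).
    assert (Sp := reg_speed_pos _ _ reg t Ht).
    evar_last.
    + apply (is_derive_mult (fun t => exp (P t)) (fun t => sin (T t))).
      * apply (is_derive_comp exp P); [apply is_derive_exp | now apply dP].
      * apply (is_derive_comp sin T); [apply is_derive_Reals, derivable_pt_lim_sin | now apply dT].
      * intros; apply Rmult_comm.
    + unfold plus, mult, scal; simpl. unfold mult; simpl.
      unfold r, index. fold (x t). replace (F t) with (kappa * x t) by (unfold x; field; lra).
      generalize (sin2_cos2 (T t)). unfold Rsqr. intros e.
      transitivity (exp (P t) * sigma * S t * cos (T t) / x t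
        * (sin (T t) * sin (T t) + cos (T t) * cos (T t))).
      { field. lra. }
      rewrite e. field. lra.
  - intros t Ht.
    assert (xt := xp t Ht). assert (Fp := reg_fst_pos _ _ reg t Ht).
    evar_last.
    + apply (is_derive_scal (fun t => exp (P t) * cos (T t)) t (kappa * sigma)).
      apply (is_derive_mult (fun t => exp (P t)) (fun t => cos (T t))).
      * apply (is_derive_comp exp P); [apply is_derive_exp | now apply dP].
      * apply (is_derive_comp cos T); [apply is_derive_Reals, derivable_pt_lim_cos | now apply dT].
      * intros; apply Rmult_comm.
    + unfold plus, mult, scal; simpl. unfold mult; simpl.
      unfold r, index. fold (x t). replace (F t) with (kappa * x t) by (unfold x; field; lra).
      generalize (sin2_cos2 (T t)). unfold Rsqr. intros e.
      transitivity (- kappa * sigma ^ 2 * exp (P t) * S t * sin (T t) * x t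
        * (sin (T t) * sin (T t) + cos (T t) * cos (T t))).
      { field. lra. }
      rewrite e. ring.
Qed.

Section CutOff.
Variables (t0 : R) (u v : R -> R).
Hypothesis t0_range : 0 < t0 < 1.
Hypothesis u_smooth : smooth (nbhd d) u.
Hypothesis u_pos : forall t, 0 < t < t0 -> 0 < u t.
Hypothesis u_left : u 0 = 0.
Hypothesis u_right : u t0 = 0.
Hypothesis u_derive : forall t, nbhd d t -> is_derive u t (v t * S t / F t).
Hypothesis v_derive :
  forall t, nbhd d t -> is_derive v t (- (sigma ^ 2 * S t * F t * u t)).

(** The eigenfunction up to its first interior zero t0, flattened near both ends of
    [0, t0] so that extension by zero is smooth. *)
Definition cutoff (eps t : R) : R :=
  if Rlt_dec 0 t then if Rlt_dec t t0 then cut eps (u t) else 0 else 0.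

Lemma cutoff_inside (eps t : R) : 0 < t < t0 -> cutoff eps t = cut eps (u t).
Proof. intros. unfold cutoff. repeat destruct Rlt_dec; lra. Qed.

Lemma cutoff_outside (eps t : R) : ~ (0 < t < t0) -> cutoff eps t = 0.
Proof. intros. unfold cutoff. repeat destruct Rlt_dec; lra. Qed.

Lemma cutoff_end (eps t : R) : 0 < eps -> t = 0 \/ t = t0 ->
  exists e, 0 < e /\ forall s, t - e < s < t + e -> cutoff eps s = 0.
Proof.
  intros ep Ht. assert (dp := reg_width _ _ reg).
  assert (ut : u t = 0) by (destruct Ht as [->| ->]; assumption).
  destruct (continuous_pos_nbhd (fun s => eps - u s) t) as [e [e0 He]].
  - apply (continuous_minus (V:=R_NormedModule)); [apply continuous_const|].
    apply (smooth_continuous (nbhd d)); [exact u_smooth|]. unfold nbhd. lra.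
  - lra.
  - exists e. split; [exact e0|]. intros s Hs. unfold cutoff.
    destruct Rlt_dec; [|reflexivity]. destruct Rlt_dec; [|reflexivity].
    apply cut_zero; [exact ep|]. generalize (He s Hs); lra.
Qed.

Lemma locally_of_interval (t e : R) (P : R -> Prop) : 0 < e ->
  (forall s, t - e < s < t + e -> P s) -> locally t P.
Proof.
  intros ep HP. exists (mkposreal e ep). intros s Hs. apply HP.
  now apply Rabs_lt_between'.
Qed.

Lemma cutoff_locally_inside (eps t : R) : 0 < t < t0 ->
  locally t (fun s => cut eps (u s) = cutoff eps s).
Proof.
  intros Ht. apply (filter_imp (fun s => 0 < s < t0)).
  - intros s Hs. now rewrite cutoff_inside.
  - now apply open_bounded_interval.
Qed.

Lemma cutoff_locally_outside (eps t : R) : 0 < eps -> ~ (0 < t < t0) ->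
  locally t (fun s => 0 = cutoff eps s).
Proof.
  intros ep Ht. destruct (Rtotal_order t 0) as [h|[h|h]].
  - apply (locally_of_interval t (- t)); [lra|]. intros s Hs. rewrite cutoff_outside; lra.
  - destruct (cutoff_end eps t ep (or_introl h)) as [e [e0 He]].
    apply (locally_of_interval t e _ e0). intros s Hs. now rewrite He.
  - destruct (Req_dec t t0) as [e|n].
    + destruct (cutoff_end eps t ep (or_intror e)) as [e' [e0 He]].
      apply (locally_of_interval t e' _ e0). intros s Hs. now rewrite He.
    + apply (locally_of_interval t (t - t0)); [lra|]. intros s Hs. rewrite cutoff_outside; lra.
Qed.

Lemma cutoff_test (eps : R) : 0 < eps -> test_function (cutoff eps).
Proof.
  intros ep. assert (dp := reg_width _ _ reg). split.
  - intros n t. destruct (Rlt_dec 0 t) as [h0|h0]; [destruct (Rlt_dec t t0) as [h1|h1]|].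
    + apply ex_derive_n_ext_loc with (fun s => cut eps (u s)).
      * apply cutoff_locally_inside. lra.
      * apply (smooth_ex_derive_n (nbhd d)); [|unfold nbhd; lra].
        apply (smooth_comp _ (open_nbhd d) (fun _ => True)); auto. now apply cut_smooth.
    + apply ex_derive_n_ext_loc with (fun _ => 0); [|apply ex_derive_n_const].
      apply cutoff_locally_outside; lra.
    + apply ex_derive_n_ext_loc with (fun _ => 0); [|apply ex_derive_n_const].
      apply cutoff_locally_outside; lra.
  - destruct (cutoff_end eps 0 ep (or_introl eq_refl)) as [e1 [e10 He1]].
    destruct (cutoff_end eps t0 ep (or_intror eq_refl)) as [e2 [e20 He2]].
    exists (Rmin (e1 / 2) (t0 / 3)), (Rmax (t0 - e2 / 2) (2 * t0 / 3)).
    generalize (Rmin_l (e1 / 2) (t0 / 3)) (Rmin_r (e1 / 2) (t0 / 3))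
      (Rmax_l (t0 - e2 / 2) (2 * t0 / 3)) (Rmax_r (t0 - e2 / 2) (2 * t0 / 3)); intros.
    split; [apply Rmin_pos; lra|]. split; [lra|]. split; [apply Rmax_lub_lt; lra|].
    intros t Ht. destruct (Rlt_dec 0 t) as [h0|h0]; [destruct (Rlt_dec t t0) as [h1|h1]|];
      [|apply cutoff_outside; lra..].
    destruct (Rlt_dec t (Rmin (e1 / 2) (t0 / 3))).
    + apply He1. lra.
    + apply He2. lra.
Qed.

(** Because 0 <= cut' <= 1, the energy density cut'^2 u'^2 F / S is at most
    cut' u' v = (cut (u) v)' + sigma^2 cut (u) u F S, and cut (u) u exceeds
    cut (u)^2 by at most 2 eps u. *)
Lemma cutoff_energy (eps M : R) : 0 < eps <= 1 ->
  (forall t, 0 <= t <= 1 -> u t * F t * S t <= M) -> 0 <= M ->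
  RInt (dirichlet g (cutoff eps)) 0 1
    <= sigma ^ 2 * RInt (mass g (cutoff eps)) 0 1 + 2 * sigma ^ 2 * M * eps.
Proof.
  intros ep HM M0. assert (tw := cutoff_test eps (proj1 ep)).
  assert (cm : forall t, 0 <= t <= 1 -> continuous (mass g (cutoff eps)) t).
  { intros; now apply mass_continuous with d. }
  assert (sw := test_smooth d _ tw). destruct (test_boundary _ tw) as [w0 w1].
  assert (sv : smooth (nbhd d) v).
  { apply smooth_primitive with (2 := v_derive); [apply open_nbhd|].
    apply smooth_ext with (fun t => (-1) * (sigma ^ 2 * S t * F t * u t)); [apply open_nbhd| |].
    - intros; ring.
    - repeat (apply smooth_mult; [apply open_nbhd| |]); try apply reg; auto;
        apply smooth_const, open_nbhd. }
  replace (sigma ^ 2 * RInt (mass g (cutoff eps)) 0 1 + 2 * sigma ^ 2 * M * eps)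
    with (RInt (fun t => sigma ^ 2 * mass g (cutoff eps) t + 2 * sigma ^ 2 * M * eps) 0 1).
  2: { assert (e := is_RInt_plus (V:=R_NormedModule) _ _ _ _ _ _
        (is_RInt_scal (V:=R_NormedModule) _ 0 1 (sigma ^ 2) _
          (RInt_correct (V:=R_CompleteNormedModule) _ _ _ (ex_RInt_unit _ cm)))
        (is_RInt_const (V:=R_NormedModule) 0 1 (2 * sigma ^ 2 * M * eps))).
       apply (is_RInt_unique (V:=R_CompleteNormedModule)) in e. etransitivity; [exact e|].
       unfold plus, scal; simpl. unfold mult; simpl. ring. }
  rewrite <- (Rmult_1_l (RInt (dirichlet _ _) 0 1)).
  pose (V := fun t => (-1) * (cutoff eps t * v t)).
  assert (sV : smooth (nbhd d) V).
  { assert (oD := open_nbhd d). apply smooth_mult; auto using smooth_const.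
    now apply smooth_mult. }
  apply (integral_comparison 1 _ _ V (Derive V)).
  - intros; now apply dirichlet_continuous with d.
  - intros t Ht. apply (continuous_plus (V:=R_NormedModule)); [|apply continuous_const].
    apply (continuous_mult (K:=R_AbsRing)); [apply continuous_const|now apply cm].
  - intros t Ht. apply (smooth_is_derive (nbhd d)); [exact sV|]. now apply nbhd_unit with g.
  - intros t Ht. apply (smooth_continuous (nbhd d)); [now apply smooth_Derive|].
    now apply nbhd_unit with g.
  - unfold V. rewrite w0, w1. ring.
  - intros t Ht. assert (Hn := nbhd_unit d g t reg Ht).
    assert (Fp := reg_fst_pos _ _ reg t Hn). assert (Sp := reg_speed_pos _ _ reg t Hn).
    assert (DV : Derive V t = (-1) * (Derive (cutoff eps) t * v t +
      cutoff eps t * - (sigma ^ 2 * S t * F t * u t))).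
    { apply is_derive_unique. apply (is_derive_scal (fun t => cutoff eps t * v t)).
      apply (is_derive_mult (cutoff eps) v); [|now apply v_derive|intros; apply Rmult_comm].
      now apply (smooth_is_derive (nbhd d)). }
    rewrite DV. clear DV. unfold dirichlet, mass. rewrite !pow2_abs, Rmult_1_l.
    specialize (HM t Ht).
    assert (cst : 0 <= 2 * sigma ^ 2 * M * eps).
    { apply Rmult_le_pos; [|lra]. apply Rmult_le_pos; [|exact M0]. nra. }
    destruct (Rlt_dec 0 t) as [h0|h0]; [destruct (Rlt_dec t t0) as [h1|h1]|].
    2, 3: rewrite <- (Derive_ext_loc _ _ _ (cutoff_locally_outside eps t (proj1 ep) ltac:(lra))),
      Derive_const, cutoff_outside by lra;
      unfold Rdiv; simpl; lra.
    rewrite cutoff_inside by lra.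
    set (q := flat 0 ((u t - eps) / eps ^ 2) + flat 1 ((u t - eps) / eps ^ 2)).
    assert (Dw : Derive (cutoff eps) t = v t * S t / F t * q).
    { rewrite <- (Derive_ext_loc _ _ _ (cutoff_locally_inside eps t ltac:(lra))).
      apply is_derive_unique. apply (is_derive_comp (cut eps) u).
      - apply cut_derive; lra.
      - now apply u_derive. }
    rewrite Dw. clear Dw.
    assert (q1 : 0 <= q <= 1).
    { unfold q. split; [|apply flat_slope_le].
      generalize (flat_nonneg 0 ((u t - eps) / eps ^ 2)) (flat_nonneg 1 ((u t - eps) / eps ^ 2)).
      lra. }
    assert (up := u_pos t (conj h0 h1)).
    destruct (cut_range eps (u t) ep (Rlt_le _ _ up)) as [[w1' w2'] w3'].
    set (w := cut eps (u t)) in *.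
    (* Here q <= 1 enters: it turns the square of the slope into the slope. *)
    assert (a1 : (v t * S t / F t * q) ^ 2 * F t / S t <= v t * S t / F t * q * v t).
    { replace ((v t * S t / F t * q) ^ 2 * F t / S t) with (q * q * (v t ^ 2 * (S t / F t)))
        by (field; lra).
      replace (v t * S t / F t * q * v t) with (q * (v t ^ 2 * (S t / F t))) by (field; lra).
      apply Rmult_le_compat_r; [|nra]. apply Rmult_le_pos; [apply pow2_ge_0|].
      apply Rlt_le, Rdiv_lt_0_compat; lra. }
    assert (a2 : w * (u t - w) * (F t * S t) <= 2 * eps * M).
    { assert (FS : 0 < F t * S t) by now apply Rmult_lt_0_compat.
      apply Rle_trans with (2 * eps * (u t * F t * S t)).
      - replace (2 * eps * (u t * F t * S t)) with (u t * (2 * eps) * (F t * S t)) by ring.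
        apply Rmult_le_compat_r; [lra|]. apply Rmult_le_compat; lra.
      - apply Rmult_le_compat_l; lra. }
    assert (a3 : sigma ^ 2 * (w * (u t - w) * (F t * S t)) <= sigma ^ 2 * (2 * eps * M)).
    { apply Rmult_le_compat_l; [apply pow2_ge_0|exact a2]. }
    lra.
Qed.

(** The masses of the truncations increase as eps decreases, so they stay away from
    zero while the error in the energy estimate tends to zero. *)
Lemma lambda1_le_of_zero : Rbar_le (lambda1 g) (sigma ^ 2).
Proof.
  destruct (Rbar_le_lt_dec (lambda1 g) (sigma ^ 2)) as [h|h]; [exact h|exfalso].
  assert (exists l : R, sigma ^ 2 < l /\ Rbar_le l (lambda1 g)) as [l [sl hl]].
  { destruct (lambda1 g) as [x| |]; simpl in h.
    - exists x. split; [exact h|apply Rle_refl].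
    - exists (sigma ^ 2 + 1). split; [lra|exact I].
    - elim h. }
  assert (oD := open_nbhd d).
  destruct (bounded_on_unit (fun t => u t * F t * S t)) as [M [M0 HM]].
  { intros t Ht. apply (smooth_continuous (nbhd d)); [|now apply nbhd_unit with g].
    apply smooth_mult; auto; [apply smooth_mult; auto|]; apply reg. }
  (* Below u (t0 / 2), so that no truncation in use vanishes identically. *)
  pose (e1 := Rmin 1 (u (t0 / 2) / 2)).
  assert (um := u_pos (t0 / 2) ltac:(lra)).
  assert (e1p : 0 < e1) by (apply Rmin_pos; lra).
  assert (e11 := Rmin_l 1 (u (t0 / 2) / 2)). assert (e1u := Rmin_r 1 (u (t0 / 2) / 2)).
  fold e1 in e11, e1u.
  assert (nz : forall e, 0 < e <= e1 -> exists t, cutoff e t <> 0).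
  { intros e He. exists (t0 / 2). rewrite cutoff_inside by lra.
    apply Rgt_not_eq, cut_pos; lra. }
  pose (c1 := RInt (mass g (cutoff e1)) 0 1).
  assert (c1p : 0 < c1).
  { apply (total_mass_pos d g reg); [now apply cutoff_test|]. apply nz; lra. }
  pose (C := 2 * sigma ^ 2 * M).
  assert (Cp : 0 < C).
  { unfold C. apply Rmult_lt_0_compat; [|exact M0]. assert (0 < sigma ^ 2) by now apply pow_lt. lra. }
  (* Small enough for the error C e to fall below the gap (l - sigma^2) c1. *)
  pose (e := Rmin e1 ((l - sigma ^ 2) * c1 / (2 * C))).
  assert (ee1 := Rmin_l e1 ((l - sigma ^ 2) * c1 / (2 * C))).
  assert (eeC := Rmin_r e1 ((l - sigma ^ 2) * c1 / (2 * C))). fold e in ee1, eeC.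
  assert (lc : 0 < (l - sigma ^ 2) * c1) by (apply Rmult_lt_0_compat; lra).
  assert (ep : 0 < e). { apply Rmin_pos; [exact e1p|]. apply Rdiv_lt_0_compat; lra. }
  assert (tw := cutoff_test e ep). assert (tw1 := cutoff_test e1 e1p).
  assert (low := lambda1_le_energy d g reg l _ hl tw (nz e ltac:(lra))).
  assert (upp := cutoff_energy e M ltac:(lra) HM ltac:(lra)).
  assert (mono : c1 <= RInt (mass g (cutoff e)) 0 1).
  { apply RInt_le; [lra| | |].
    - apply ex_RInt_unit. intros; now apply mass_continuous with d.
    - apply ex_RInt_unit. intros; now apply mass_continuous with d.
    - intros t Ht. assert (Hn := nbhd_unit d g t reg ltac:(lra)).
      unfold mass. rewrite !pow2_abs.
      apply Rmult_le_compat_r; [apply Rlt_le; now apply reg|].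
      apply Rmult_le_compat_r; [apply Rlt_le; now apply reg|].
      destruct (Rlt_dec t t0) as [h1|h1].
      + rewrite !cutoff_inside by lra. assert (up := u_pos t ltac:(lra)).
        apply pow_incr. split; [|apply cut_decreasing; lra].
        apply cut_range; lra.
      + rewrite !cutoff_outside by lra. lra. }
  assert (fin : C * e < (l - sigma ^ 2) * c1).
  { apply Rle_lt_trans with (C * ((l - sigma ^ 2) * c1 / (2 * C))).
    - apply Rmult_le_compat_l; lra.
    - replace (C * ((l - sigma ^ 2) * c1 / (2 * C))) with ((l - sigma ^ 2) * c1 / 2)
        by (field; lra). lra. }
  fold C in upp. nra.
Qed.
End CutOff.

(** Beyond the value pi the eigenfunction rho sin T has already vanished inside
    ]0,1[. *)
Lemma lambda1_le_of_angle (T : R -> R) :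
  pruefer_angle d kappa sigma g T -> PI < T 1 -> Rbar_le (lambda1 g) (sigma ^ 2).
Proof.
  intros [T0 dT] T1.
  assert (nb : forall t, 0 <= t <= 1 -> nbhd d t) by (intros; now apply nbhd_unit with g).
  destruct (pruefer_eigenfunction T dT) as [u [v [rho [su [urho [du dv]]]]]].
  assert (T'p : forall t, 0 <= t <= 1 -> 0 < sigma * S t * index (T t) (F t / kappa)).
  { intros t Ht. apply Rmult_lt_0_compat; [apply Rmult_lt_0_compat; [exact sigma_pos|]|].
    - now apply reg, nb.
    - apply index_pos. apply height_pos with d; auto. }
  assert (incr : forall s t, 0 <= s -> s < t -> t <= 1 -> T s < T t).
  { intros s t Hs st Ht.
    destruct (MVT_gen T s t (fun t => sigma * S t * index (T t) (F t / kappa))) as [c [Hc E]].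
    - rewrite Rmin_left, Rmax_right by lra. intros x Hx. apply dT, nb. lra.
    - rewrite Rmin_left, Rmax_right by lra. intros x Hx.
      apply ex_derive_continuity_pt. eexists. apply dT, nb. lra.
    - rewrite Rmin_left, Rmax_right in Hc by lra.
      assert (0 < sigma * S c * index (T c) (F c / kappa) * (t - s)).
      { apply Rmult_lt_0_compat; [apply T'p|]; lra. }
      lra. }
  assert (exists t0, 0 < t0 < 1 /\ T t0 = PI) as [t0 [Ht0 Tt0]].
  { destruct (IVT_Rbar_incr T 0 1 (T 0) (T 1) PI) as [t0 [h0 [h1 h2]]].
    - apply is_lim_continuity, ex_derive_continuity_pt. eexists. apply dT, nb. lra.
    - apply is_lim_continuity, ex_derive_continuity_pt. eexists. apply dT, nb. lra.
    - intros x h0 h1. simpl in h0, h1. apply ex_derive_continuity_pt.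
      eexists. apply dT, nb. lra.
    - simpl. lra.
    - rewrite T0. simpl. generalize PI_RGT_0. lra.
    - simpl in h0, h1. exists t0. auto. }
  apply (lambda1_le_of_zero t0 u v Ht0 su); auto.
  - intros t Ht. destruct (urho t) as [rp ->]. apply Rmult_lt_0_compat; [exact rp|].
    apply sin_gt_0.
    + rewrite <- T0. apply incr; lra.
    + rewrite <- Tt0. apply incr; lra.
  - destruct (urho 0) as [_ ->]. rewrite T0, sin_0. ring.
  - destruct (urho t0) as [_ ->]. rewrite Tt0, sin_PI. ring.
Qed.
End UpperBound.

(** * The Pruefer angle of a curve of known eigenvalue *)

Section Angle.
Variables (d kappa : R) (g : curve).
Hypothesis reg : regular_on d g.
Hypothesis kappa_pos : 0 < kappa.
Notation F := (fst g).
Notation S := (speed g).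

Lemma angle_rate_pos (sigma : R) (T : R -> R) (t : R) : 0 < sigma -> nbhd d t ->
  0 < sigma * S t * index (T t) (F t / kappa).
Proof.
  intros sp Ht. apply Rmult_lt_0_compat; [apply Rmult_lt_0_compat; [exact sp|]|].
  - now apply reg.
  - apply index_pos. now apply height_pos with d.
Qed.

(** Continuous dependence of the angle on sigma, from the differential inequality
    for the square of the difference. *)
Lemma angle_gronwall (sigma eta M : R) (T U : R -> R) :
  0 < sigma -> 0 < eta -> 0 < M ->
  pruefer_angle d kappa sigma g T -> pruefer_angle d kappa (sigma - eta) g U ->
  (forall t, 0 <= t <= 1 -> S t * (F t / kappa + / (F t / kappa)) <= M) ->
  (T 1 - U 1) ^ 2 <= (eta * M) ^ 2 * exp (4 * sigma * M + 1).
Proof.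
  intros sp ep Mp [T0 dT] [U0 dU] HM. set (K := 4 * sigma * M + 1).
  assert (sM : 0 < sigma * M) by now apply Rmult_lt_0_compat.
  assert (Kp : 0 < K) by (unfold K; lra).
  assert (le : - (T 0 - U 0) ^ 2 * exp (- K * 0) + (eta * M) ^ 2 * 0
    <= - (T 1 - U 1) ^ 2 * exp (- K * 1) + (eta * M) ^ 2 * 1).
  { apply (derive_nonneg_le
      (fun t => - (T t - U t) ^ 2 * exp (- K * t) + (eta * M) ^ 2 * t)
      (fun t => (K * (T t - U t) ^ 2 - 2 * (T t - U t) *
        (sigma * S t * index (T t) (F t / kappa)
         - (sigma - eta) * S t * index (U t) (F t / kappa))) * exp (- K * t)
        + (eta * M) ^ 2)); [lra| |].
    - intros t Ht. assert (Hn := nbhd_unit d g t reg Ht).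
      assert (dT' := dT t Hn). assert (dU' := dU t Hn).
      auto_derive.
      + repeat split; eexists; eassumption.
      + eta. rewrite (is_derive_unique T t _ dT'), (is_derive_unique U t _ dU').
        simpl. ring.
    - intros t Ht. assert (Hn := nbhd_unit d g t reg Ht). specialize (HM t Ht).
      assert (Sp := reg_speed_pos _ _ reg t Hn).
      assert (xp := height_pos d kappa g reg kappa_pos t Hn).
      set (x := F t / kappa) in *.
      generalize (index_lipschitz (T t) (U t) x xp) (index_le (U t) x xp)
        (index_pos (U t) x xp). intros lip n2 n2p.
      set (D := T t - U t) in *. set (n := index (T t) x) in *. set (k := index (U t) x) in *.
      assert (E1 : 0 < exp (- K * t) <= 1).
      { split; [apply exp_pos|]. rewrite <- exp_0.
        destruct (Req_dec t 0) as [->|]; [rewrite Rmult_0_r; lra|].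
        apply Rlt_le, exp_increasing. nra. }
      assert (b1 : 2 * D * (sigma * S t * (n - k)) <= 4 * sigma * M * D ^ 2).
      { apply Rle_trans with (1 := Rle_abs _).
        rewrite !Rabs_mult, (Rabs_right 2), (Rabs_right sigma), (Rabs_right (S t)) by lra.
        rewrite <- (pow2_abs D).
        apply Rle_trans with (2 * Rabs D * (sigma * S t * (2 * (x + / x) * Rabs D))).
        - apply Rmult_le_compat_l; [generalize (Rabs_pos D); lra|].
          apply Rmult_le_compat_l; [nra|exact lip].
        - replace (2 * Rabs D * (sigma * S t * (2 * (x + / x) * Rabs D)))
            with ((4 * sigma * Rabs D ^ 2) * (S t * (x + / x))) by ring.
          replace (4 * sigma * M * Rabs D ^ 2) with ((4 * sigma * Rabs D ^ 2) * M) by ring.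
          apply Rmult_le_compat_l; [|exact HM].
          apply Rmult_le_pos; [lra|apply pow2_ge_0]. }
      assert (b2 : 2 * D * (eta * S t * k) <= D ^ 2 + (eta * M) ^ 2).
      { assert (Sk : 0 <= S t * k <= M).
        { split; [apply Rlt_le, Rmult_lt_0_compat; assumption|].
          apply Rle_trans with (2 := HM). apply Rmult_le_compat_l; lra. }
        apply Rle_trans with (D ^ 2 + (eta * (S t * k)) ^ 2).
        - generalize (pow2_ge_0 (D - eta * (S t * k))). nra.
        - apply Rplus_le_compat_l, pow_incr. split.
          + apply Rmult_le_pos; lra.
          + apply Rmult_le_compat_l; lra. }
      assert (b3 : - (eta * M) ^ 2 <= K * D ^ 2 -
        2 * D * (sigma * S t * n - (sigma - eta) * S t * k)).
      { unfold K. lra. }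
      generalize (pow2_ge_0 (eta * M)). set (Q := (eta * M) ^ 2) in *. intros Q0.
      set (L := K * D ^ 2 - _) in *. nra. }
  rewrite T0, U0, !Rmult_0_r, Rminus_diag, !Rmult_1_r in le.
  replace (exp K) with (/ exp (- K)) by (rewrite exp_Ropp; field; apply Rgt_not_eq, exp_pos).
  assert (EK := exp_pos (- K)).
  apply Rmult_le_reg_r with (exp (- K)); [exact EK|].
  rewrite Rmult_assoc, Rinv_l by lra. simpl in le |- *. lra.
Qed.

End Angle.

Section AngleEnd.
Variables (d kappa : R) (g : curve).
Hypothesis reg : regular_on d g.
Hypothesis kappa_pos : 0 < kappa.

(** Below pi, the lower bound would be strict; above pi, the same would hold for the
    angle of a slightly smaller sigma, which would bound lambda1 by a smaller square. *)
Lemma angle_end (sigma : R) (T : R -> R) :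
  0 < sigma -> pruefer_angle d kappa sigma g T -> lambda1 g = Finite (sigma ^ 2) ->
  T 1 = PI.
Proof.
  intros sp pT lam. pose proof pT as [T0 dT].
  assert (nb : forall t, 0 <= t <= 1 -> nbhd d t) by (intros; now apply nbhd_unit with g).
  assert (sT := pruefer_smooth d kappa g reg kappa_pos sigma T dT).
  destruct (Rtotal_order (T 1) PI) as [lt|[eq|gt]]; [exfalso|exact eq|exfalso].
  - assert (h : Rbar_lt (sigma ^ 2) (lambda1 g)).
    { apply (strict_barta d g kappa sigma T (Derive T)); auto.
      - intros t Ht. apply (smooth_is_derive (nbhd d)); auto.
      - intros t Ht. apply (smooth_continuous (nbhd d)); auto. now apply smooth_Derive.
      - rewrite T0. lra.
      - intros t Ht. rewrite (is_derive_unique _ _ _ (dT t (nb t Ht))). lra. }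
    rewrite lam in h. simpl in h. lra.
  - destruct (medium_bound d g kappa reg kappa_pos) as [M [Mp HM]].
    set (K := 4 * sigma * M + 1). assert (EK := exp_pos (/ 2 * K)).
    set (delta := T 1 - PI). assert (dp : 0 < delta) by (unfold delta; lra).
    (* Half the excess over pi survives the change of sigma. *)
    pose (eta := Rmin (sigma / 2) (delta / (2 * (M * exp (/ 2 * K))))).
    assert (ME : 0 < M * exp (/ 2 * K)) by now apply Rmult_lt_0_compat.
    assert (h1 := Rmin_l (sigma / 2) (delta / (2 * (M * exp (/ 2 * K))))).
    assert (h2 := Rmin_r (sigma / 2) (delta / (2 * (M * exp (/ 2 * K))))).
    fold eta in h1, h2.
    assert (ep : 0 < eta). { apply Rmin_pos; [lra|]. apply Rdiv_lt_0_compat; lra. }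
    assert (dh : 0 < d / 2 <= d) by (generalize (reg_width _ _ reg); lra).
    assert (reg2 := regular_on_smaller d (d / 2) g reg dh).
    destruct (pruefer_exists d kappa g reg kappa_pos (sigma - eta) ltac:(lra))
      as [U [[U0 dU] _]].
    assert (sub : forall t, nbhd (d / 2) t -> nbhd d t) by (unfold nbhd; intros; lra).
    assert (close : (T 1 - U 1) ^ 2 <= (delta / 2) ^ 2).
    { apply Rle_trans with ((eta * M * exp (/ 2 * K)) ^ 2).
      - replace ((eta * M * exp (/ 2 * K)) ^ 2) with ((eta * M) ^ 2 * exp K).
        2: { replace K with (/ 2 * K + / 2 * K) at 1 by field. rewrite exp_plus. ring. }
        apply (angle_gronwall (d / 2) kappa g reg2 kappa_pos sigma eta M T U); auto.
        + split; auto.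
        + now split.
      - apply pow_incr. split; [apply Rlt_le; repeat apply Rmult_lt_0_compat; assumption|].
        replace (delta / 2) with (delta / (2 * (M * exp (/ 2 * K))) * (M * exp (/ 2 * K)))
          by (field; split; lra).
        rewrite Rmult_assoc. apply Rmult_le_compat_r; lra. }
    assert (U1 : PI < U 1).
    { apply Rnot_le_lt. intros h. assert (delta <= T 1 - U 1) by (unfold delta; lra). nra. }
    assert (h := lambda1_le_of_angle (d / 2) kappa (sigma - eta) g reg2 kappa_pos
      ltac:(lra) U (conj U0 dU) U1).
    rewrite lam in h. simpl in h. nra.
Qed.
End AngleEnd.

(** * Short curves: a priori bounds and the refractive index *)

(** The harmonic lower bound: (x + 1/x) n - 1 is a convex combination of x^2 and
    1/x^2. *)
Lemma index_ge (a x : R) : 0 < x -> / (x + / x) <= index a x.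
Proof.
  intros xp. assert (ip := Rinv_0_lt_compat x xp). unfold index, Rdiv. rewrite cos_sqr.
  generalize (sin_sqr_range a); intros hs. set (s := sin a ^ 2) in *.
  assert (e : x * / x = 1) by (field; lra). set (y := / x) in *.
  apply Rmult_le_reg_r with (x + y); [lra|]. rewrite Rinv_l by lra.
  assert (0 <= s * (x * x)) by (apply Rmult_le_pos; nra).
  assert (0 <= (1 - s) * (y * y)) by (apply Rmult_le_pos; nra).
  replace ((x * s + (1 - s) * y) * (x + y))
    with (s * (x * x) + (1 - s) * (y * y) + (x * y)) by ring. lra.
Qed.

(** For sigma large enough the angle passes pi before the end of the curve. *)
Lemma lambda1_bounded (d : R) (g : curve) : regular_on d g ->
  exists sigma, Rbar_le (lambda1 g) (sigma ^ 2).
Proof.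
  intros reg. assert (oD := open_nbhd d).
  assert (sF := reg_fst _ _ reg). assert (sS := reg_speed _ _ reg).
  assert (Fp := reg_fst_pos _ _ reg). assert (Sp := reg_speed_pos _ _ reg).
  destruct (bounded_on_unit (fun t => (fst g t / 1 + / (fst g t / 1)) / speed g t))
    as [M [Mp HM]].
  { intros t Ht. apply (smooth_continuous (nbhd d)); [|now apply nbhd_unit with g].
    assert (sx := smooth_height d 1 g reg Rlt_0_1).
    apply smooth_div; auto.
    - intros s Hs. generalize (Sp s Hs); lra.
    - apply smooth_plus; auto. apply smooth_inv; auto.
      intros s Hs. generalize (Fp s Hs); lra. }
  (* The angle then gains at least 5 > pi. *)
  exists (5 * M).
  assert (dh : 0 < d / 2 <= d) by (generalize (reg_width _ _ reg); lra).
  assert (reg2 := regular_on_smaller d (d / 2) g reg dh).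
  destruct (pruefer_exists d 1 g reg Rlt_0_1 (5 * M) ltac:(lra)) as [T [[T0 dT] _]].
  apply (lambda1_le_of_angle (d / 2) 1 (5 * M) g reg2 Rlt_0_1 ltac:(lra) T (conj T0 dT)).
  apply Rlt_le_trans with 5; [generalize PI_4; lra|].
  assert (le : T 0 - 5 * 0 <= T 1 - 5 * 1); [|lra].
  apply (derive_nonneg_le (fun t => T t - 5 * t)
    (fun t => 5 * M * speed g t * index (T t) (fst g t / 1) - 5)); [lra| |].
  - intros t Ht. apply (is_derive_minus T (fun t => 5 * t)).
    + apply dT. now apply nbhd_unit with g.
    + auto_derive; [auto|ring].
  - intros t Ht. assert (Hn := nbhd_unit d g t reg Ht).
    specialize (HM t Ht). assert (S0 := Sp t Hn).
    assert (xp := height_pos d 1 g reg Rlt_0_1 t Hn). set (x := fst g t / 1) in *.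
    generalize (index_ge (T t) x xp). set (n := index (T t) x). intros hn.
    assert (q : 0 < x + / x) by (generalize (Rinv_0_lt_compat x xp); lra).
    assert (1 <= M * (speed g t * n)); [|lra].
    apply Rle_trans with ((x + / x) / speed g t * (speed g t * / (x + / x))).
    + apply Req_le. field. repeat split; try lra.
      generalize (pow2_ge_0 x); simpl; lra.
    + apply Rmult_le_compat; try lra.
      * apply Rlt_le, Rdiv_lt_0_compat; lra.
      * apply Rlt_le, Rmult_lt_0_compat; [lra|]. now apply Rinv_0_lt_compat.
      * apply Rmult_le_compat_l; lra.
Qed.

Definition segment (p q : R * R) : curve :=
  (fun t => fst p + t * (fst q - fst p), fun t => snd p + t * (snd q - snd p)).

Lemma dist_plane_sqr (p q : R * R) :
  dist_plane p q ^ 2 = (fst q - fst p) ^ 2 + (snd q - snd p) ^ 2.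
Proof.
  unfold dist_plane, dist_euc. rewrite pow2_sqrt; unfold Rsqr; [ring|].
  generalize (Rle_0_sqr (fst p - fst q)) (Rle_0_sqr (snd p - snd q)). unfold Rsqr. lra.
Qed.

Lemma dist_plane_nonneg (p q : R * R) : 0 <= dist_plane p q.
Proof. apply sqrt_pos. Qed.

Lemma dist_plane_pos (p q : R * R) : q <> p -> 0 < dist_plane p q.
Proof.
  intros ne. destruct (dist_plane_nonneg p q) as [h|h]; [exact h|exfalso].
  assert (e := dist_plane_sqr p q). rewrite <- h in e.
  generalize (pow2_ge_0 (fst q - fst p)) (pow2_ge_0 (snd q - snd p)); intros h1 h2.
  apply ne. destruct p as [a b], q as [a' b']; simpl fst in *; simpl snd in *.
  f_equal; apply Rminus_diag_uniq; apply Rsqr_0_uniq; unfold Rsqr; simpl in *; lra.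
Qed.

Lemma smooth_affine (D : R -> Prop) (a b : R) : open D -> smooth D (fun t => a + t * b).
Proof.
  intros oD. apply smooth_plus; auto using smooth_const.
  apply smooth_mult; auto using smooth_const, smooth_id.
Qed.

Lemma smooth_on_I_of_smooth (d : R) (f : R -> R) :
  0 < d -> smooth (nbhd d) f -> smooth_on_I f.
Proof.
  intros dp sf. exists d. split; [exact dp|]. intros n t Ht.
  now apply (smooth_ex_derive_n (nbhd d)).
Qed.

Lemma segment_speed (p q : R * R) (t : R) : speed (segment p q) t = dist_plane p q.
Proof.
  assert (e : forall a b s, Derive (fun t => a + t * b) s = b).
  { intros a b s. apply is_derive_unique. auto_derive; [auto|ring]. }
  unfold speed, segment; simpl fst; simpl snd. rewrite !e, <- dist_plane_sqr.
  apply sqrt_pow2, dist_plane_nonneg.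
Qed.

Lemma segment_admissible (p q : R * R) :
  half_plane p -> half_plane q -> q <> p -> admissible p q (segment p q).
Proof.
  intros hp hq ne. unfold half_plane in *.
  split; [|split; [|split; [|split; [|split]]]].
  - apply (smooth_on_I_of_smooth 1); [lra|]. apply smooth_affine, open_nbhd.
  - apply (smooth_on_I_of_smooth 1); [lra|]. apply smooth_affine, open_nbhd.
  - intros t Ht. unfold half_plane; simpl. nra.
  - intros t _ e. assert (e1 := f_equal fst e). assert (e2 := f_equal snd e).
    assert (s := segment_speed p q t). unfold speed in s.
    change (Derive (fst (segment p q)) t = 0) in e1.
    change (Derive (snd (segment p q)) t = 0) in e2. rewrite e1, e2 in s.
    replace (0 ^ 2 + 0 ^ 2) with 0 in s by ring. rewrite sqrt_0 in s.
    generalize (dist_plane_pos p q ne). lra.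
  - destruct p; unfold point; simpl; f_equal; ring.
  - destruct q; unfold point; simpl; f_equal; ring.
Qed.

(** The affine angle 1/2 + t is slow enough to be admissible in the Picone bound for
    a short segment.  This forces the eigenvalue of maximizers to be large when q is
    close to p. *)
Lemma segment_lambda1 (p q : R * R) :
  half_plane p -> half_plane q -> q <> p -> dist_plane p q <= fst p / 2 ->
  Rbar_le ((/ (4 * dist_plane p q)) ^ 2) (lambda1 (segment p q)).
Proof.
  intros hp hq ne small.
  destruct (admissible_regular p q _ (segment_admissible p q hp hq ne)) as [d reg].
  assert (dp := dist_plane_pos p q ne). unfold half_plane in hp.
  apply (picone d _ reg (fst p) (/ (4 * dist_plane p q)) hp (fun t => / 2 + t) (fun _ => 1)).
  - intros t _. auto_derive; [auto|ring].
  - intros t _. apply continuous_const.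
  - intros t Ht. generalize PI2_3_2. lra.
  - apply Rlt_le, Rinv_0_lt_compat. lra.
  - intros t Ht. rewrite segment_speed.
    assert (diff : Rabs (fst q - fst p) <= dist_plane p q).
    { apply Rsqr_incr_0_var; [|lra]. rewrite <- Rsqr_abs. unfold Rsqr.
      assert (e := dist_plane_sqr p q). generalize (pow2_ge_0 (snd q - snd p)). simpl in *. lra. }
    apply Rabs_le_between in diff.
    set (x := fst (segment p q) t / fst p).
    assert (hx : / 2 <= x <= 3 / 2).
    { unfold x. simpl. split.
      - apply Rle_div_r; [exact hp|]. nra.
      - apply Rle_div_l; [exact hp|]. nra. }
    generalize (index_le (/ 2 + t) x ltac:(lra)). intros hn.
    assert (hi : / x <= 2).
    { rewrite <- (Rinv_inv 2). apply Rinv_le_contravar; lra. }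
    replace (/ (4 * dist_plane p q) * dist_plane p q) with (/ 4) by (field; lra).
    lra.
Qed.

Section Height.
Variables (d kappa sigma : R) (g : curve) (T : R -> R).
Hypothesis reg : regular_on d g.
Hypothesis kappa_pos : 0 < kappa.
Hypothesis sigma_pos : 0 < sigma.
Hypothesis angle : pruefer_angle d kappa sigma g T.

Lemma Derive_fst_le_speed (t : R) : Rabs (Derive (fst g) t) <= speed g t.
Proof.
  unfold speed. rewrite <- sqrt_Rsqr_abs. apply sqrt_le_1_alt. unfold Rsqr.
  generalize (pow2_ge_0 (Derive (snd g) t)). simpl. lra.
Qed.

(** Since (1 + x^2) n(T, x) >= x for every T, the logarithm of 1 + x^2 varies at most
    2 / (sigma kappa) times as fast as the angle; this holds for all heights, so no
    continuity argument is needed to bound x. *)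
Lemma height_rate (t : R) : nbhd d t ->
  let x := fst g t / kappa in
  2 * x * (Rabs (Derive (fst g) t) / kappa) <= 2 / (sigma * kappa) * (1 + x ^ 2)
     * (sigma * speed g t * index (T t) x).
Proof.
  intros Hn x. assert (xp : 0 < x) by now apply height_pos with d.
  assert (Sp := reg_speed_pos _ _ reg t Hn).
  assert (n : x <= (1 + x ^ 2) * index (T t) x).
  { unfold index, Rdiv. rewrite cos_sqr. generalize (sin_sqr_range (T t)).
    set (s := sin (T t) ^ 2). intros hs. assert (ip := Rinv_0_lt_compat x xp).
    replace ((1 + x ^ 2) * (x * s + (1 - s) * / x))
      with (x + (s * (x * x * x) + (1 - s) * / x)) by (field; lra).
    assert (0 <= s * (x * x * x)).
    { apply Rmult_le_pos; [lra|]. apply Rlt_le.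
      apply Rmult_lt_0_compat; [apply Rmult_lt_0_compat|]; exact xp. }
    assert (0 <= (1 - s) * / x) by (apply Rmult_le_pos; lra). lra. }
  apply Rle_trans with (2 * x * (speed g t / kappa)).
  - apply Rmult_le_compat_l; [lra|]. apply Rmult_le_compat_r; [|apply Derive_fst_le_speed].
    apply Rlt_le, Rinv_0_lt_compat, kappa_pos.
  - replace (2 / (sigma * kappa) * (1 + x ^ 2) * (sigma * speed g t * index (T t) x))
      with (2 * (speed g t / kappa) * ((1 + x ^ 2) * index (T t) x)) by (field; lra).
    replace (2 * x * (speed g t / kappa)) with (2 * (speed g t / kappa) * x) by ring.
    apply Rmult_le_compat_l; [|exact n].
    apply Rlt_le, Rmult_lt_0_compat; [lra|]. apply Rdiv_lt_0_compat; lra.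
Qed.

(** Over the whole curve the angle grows by pi, so 1 + x^2 stays close to its initial
    value 2 when sigma kappa is large. *)
Lemma height_range (t : R) :
  fst g 0 = kappa -> T 1 = PI -> 32 <= sigma * kappa -> 0 <= t <= 1 ->
  / 2 <= fst g t / kappa <= 2.
Proof.
  intros F0 T1 large Ht. destruct angle as [T0 dT].
  pose (c := 2 / (sigma * kappa)). pose (x := fun t => fst g t / kappa).
  assert (cp : 0 < c) by (apply Rdiv_lt_0_compat; lra).
  assert (x0 : x 0 = 1) by (unfold x; rewrite F0; field; lra).
  assert (nb : forall t, 0 <= t <= 1 -> nbhd d t) by (intros; now apply nbhd_unit with g).
  assert (dF : forall t, nbhd d t -> is_derive (fst g) t (Derive (fst g) t)).
  { intros s Hs. apply (smooth_is_derive (nbhd d)); [apply reg|exact Hs]. }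
  pose (W := fun k s => (2 * x s * (Derive (fst g) s / kappa) + k * (c * (1 + x s ^ 2) *
       (sigma * speed g s * index (T s) (x s)))) * exp (k * (c * T s))).
  assert (dx : forall k s, nbhd d s ->
    is_derive (fun t => (1 + x t ^ 2) * exp (k * (c * T t))) s (W k s)).
  { intros k s Hs. unfold W. assert (d1 := dT s Hs). assert (d2 := dF s Hs). unfold x.
    auto_derive.
    - repeat split; eexists; eassumption.
    - eta. rewrite (is_derive_unique _ _ _ d1). fold (x s). simpl. unfold x. field. lra. }
  assert (rate : forall s, 0 <= s <= 1 -> Rabs (2 * x s * (Derive (fst g) s / kappa)) <=
    c * (1 + x s ^ 2) * (sigma * speed g s * index (T s) (x s))).
  { intros s Hs. apply Rle_trans with (2 := height_rate s (nb s Hs)).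
    assert (xp : 0 < x s) by (apply height_pos with d; auto).
    unfold Rdiv. rewrite !Rabs_mult, (Rabs_right 2), (Rabs_right (x s)) by lra.
    rewrite (Rabs_right (/ kappa)); [apply Rle_refl|].
    apply Rle_ge, Rlt_le, Rinv_0_lt_compat, kappa_pos. }
  assert (Tt : 0 <= T t <= PI).
  { split; [rewrite <- T0|rewrite <- T1];
      apply (derive_nonneg_le T (fun t => sigma * speed g t * index (T t) (fst g t / kappa)));
      try lra; intros s Hs; try (apply dT, nb; lra);
      apply Rlt_le, (angle_rate_pos d kappa g reg kappa_pos); auto; apply nb; lra. }
  assert (up : (1 + x t ^ 2) * exp (-1 * (c * T t)) <= (1 + x 0 ^ 2) * exp (-1 * (c * T 0))).
  { apply Ropp_le_cancel.
    apply (derive_nonneg_le (fun t => - ((1 + x t ^ 2) * exp (-1 * (c * T t))))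
      (fun s => - W (-1) s) 0 t);
      [lra|intros s Hs; apply (is_derive_opp (fun t => (1 + x t ^ 2) * exp (-1 * (c * T t))));
           apply dx, nb; lra|].
    intros s Hs. assert (h := rate s ltac:(lra)). apply Rabs_le_between in h.
    unfold W.
    generalize (exp_pos (-1 * (c * T s))). nra. }
  assert (down : (1 + x 0 ^ 2) * exp (1 * (c * T 0)) <= (1 + x t ^ 2) * exp (1 * (c * T t))).
  { apply (derive_nonneg_le (fun t => (1 + x t ^ 2) * exp (1 * (c * T t))) (W 1) 0 t);
      [lra|intros s Hs; apply dx, nb; lra|].
    intros s Hs. assert (h := rate s ltac:(lra)). apply Rabs_le_between in h.
    unfold W. apply Rmult_le_pos; [lra|apply Rlt_le, exp_pos]. }
  rewrite T0, x0, !Rmult_0_r, exp_0 in up, down.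
  assert (c4 : c * T t <= / 4).
  { apply Rle_trans with (c * 4); [generalize PI_4; nra|]. unfold c.
    replace (2 / (sigma * kappa) * 4) with (8 * / (sigma * kappa)) by (field; lra).
    apply Rle_trans with (8 * / 32); [|lra]. apply Rmult_le_compat_l; [lra|].
    apply Rinv_le_contravar; lra. }
  assert (c0 : 0 <= c * T t) by (apply Rmult_le_pos; lra).
  assert (em : 3 / 4 <= exp (-1 * (c * T t))).
  { generalize (exp_ineq1_le (-1 * (c * T t))); lra. }
  assert (ee : exp (1 * (c * T t)) * exp (-1 * (c * T t)) = 1).
  { rewrite <- exp_plus. replace (_ + _) with 0 by ring. apply exp_0. }
  fold (x t). assert (xp : 0 < x t) by (apply height_pos with d; auto).
  set (E := exp (-1 * (c * T t))) in *. set (G := exp (1 * (c * T t))) in *.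
  assert (Gp : 0 < G) by apply exp_pos.
  assert (G43 : G <= 4 / 3) by nra.
  assert (low : 3 / 2 <= 1 + x t ^ 2) by nra.
  assert (upp : 1 + x t ^ 2 <= 8 / 3) by nra.
  split; nra.
Qed.
End Height.

Section SemiConcave.
Variable s : R.
Hypothesis s_range : 0 <= s <= 1.

Let Q (x : R) : R := s * x ^ 2 + (1 - s).

Lemma denominator_range (x : R) : / 2 <= x <= 2 -> / 4 <= Q x <= 4.
Proof.
  intros hx. unfold Q. assert (h : / 4 <= x ^ 2 <= 4) by (simpl; split; nra).
  set (y := x ^ 2) in *. split; nra.
Qed.

(** Second-order Taylor bound from above for the square of 1 / n, written with
    s = sin^2 T.  The remainder is divisible by (x - y)^2 explicitly; the constant is
    far from optimal, only its finiteness matters. *)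
Lemma semiconcave (x y : R) : / 2 <= x <= 2 -> / 2 <= y <= 2 ->
  (x / Q x) ^ 2 - (y / Q y) ^ 2
    - 2 * (y / Q y) * (((1 - s) - s * y ^ 2) / Q y ^ 2) * (x - y)
  <= 20000 * (x - y) ^ 2.
Proof.
  intros hx hy. assert (qx := denominator_range x hx). assert (qy := denominator_range y hy).
  pose (a := / Q x). pose (b := / Q y).
  assert (ha : 0 < a <= 4).
  { unfold a. split; [apply Rinv_0_lt_compat; lra|]. rewrite <- (Rinv_inv 4).
    apply Rinv_le_contravar; lra. }
  assert (hb : 0 < b <= 4).
  { unfold b. split; [apply Rinv_0_lt_compat; lra|]. rewrite <- (Rinv_inv 4).
    apply Rinv_le_contravar; lra. }
  pose (u := ((1 - s) - s * x * y) * (a * b)).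
  pose (r := s * (s * x * y ^ 2 - (1 - s) * (2 * y + x)) * (a * b * b)).
  assert (E : (x / Q x) ^ 2 - (y / Q y) ^ 2
    - 2 * (y / Q y) * (((1 - s) - s * y ^ 2) / Q y ^ 2) * (x - y)
    = (u ^ 2 + 2 * (y * b) * r) * (x - y) ^ 2).
  { unfold u, r, a, b. assert (Q x <> 0) by lra. assert (Q y <> 0) by lra.
    unfold Q in *. field. split; assumption. }
  rewrite E. apply Rmult_le_compat_r; [apply pow2_ge_0|].
  assert (ab : 0 < a * b <= 16) by (split; nra).
  assert (abb : 0 < a * b * b <= 64) by (split; nra).
  assert (xy : / 4 <= x * y <= 4) by (split; nra).
  assert (m1 : -4 <= (1 - s) - s * x * y <= 4).
  { rewrite Rmult_assoc. split; nra. }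
  assert (hu : -64 <= u <= 64).
  { unfold u. set (v := 1 - s - s * x * y) in *. split; nra. }
  assert (m2 : s * (s * x * y ^ 2 - (1 - s) * (2 * y + x)) <= 8).
  { assert (0 <= s * (1 - s) * (2 * y + x)).
    { apply Rmult_le_pos; [nra|lra]. }
    assert (s * (s * x * y ^ 2) <= 8).
    { replace (s * (s * x * y ^ 2)) with ((s * s) * ((x * y) * y)) by ring.
      assert (0 <= s * s <= 1) by (split; nra). assert (0 <= x * y * y <= 8) by (split; nra).
      nra. }
    lra. }
  assert (hr : r <= 512).
  { unfold r. set (v := s * _) in *. nra. }
  assert (yb : 0 < y * b <= 8) by (split; nra).
  assert (u ^ 2 <= 4096) by nra.
  assert (2 * (y * b) * r <= 8192) by nra.
  lra.
Qed.
End SemiConcave.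

Lemma index_inv (T x : R) : 0 < x ->
  / index T x = x / (sin T ^ 2 * x ^ 2 + (1 - sin T ^ 2)).
Proof.
  intros xp. unfold index. rewrite cos_sqr. generalize (sin_sqr_range T).
  set (s := sin T ^ 2). intros hs. assert (0 < s * x ^ 2 + (1 - s)).
  { destruct (Rlt_dec s 1); [|assert (s = 1) by lra; subst s; nra].
    generalize (pow2_ge_0 x); nra. }
  field. repeat split; try lra.
Qed.

Lemma index_range (T x : R) : / 2 <= x <= 2 -> / 2 <= index T x <= 4.
Proof.
  intros hx. assert (hi : / 2 <= / x <= 2).
  { split; [|rewrite <- (Rinv_inv 2)]; apply Rinv_le_contravar; lra. }
  unfold index, Rdiv. rewrite cos_sqr. generalize (sin_sqr_range T). intros. split; nra.
Qed.

(** Weighted mean of the Taylor bounds at the mean height, where the first-order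
    terms cancel. *)
Lemma index_inv_semiconcave (T x y tau : R) : / 2 <= x <= 2 -> / 2 <= y <= 2 -> 0 <= tau <= 1 ->
  (1 - tau) * (/ index T y) ^ 2 + tau * (/ index T x) ^ 2
    <= (/ index T (y + tau * (x - y))) ^ 2 + 20000 * (tau * (1 - tau)) * (x - y) ^ 2.
Proof.
  intros hx hy ht. set (m := y + tau * (x - y)).
  assert (hm : / 2 <= m <= 2) by (unfold m; split; nra).
  rewrite !index_inv by lra. assert (hs := sin_sqr_range T). set (s := sin T ^ 2) in *.
  assert (h1 := semiconcave s hs x m hx hm). assert (h2 := semiconcave s hs y m hy hm).
  cbv beta zeta in h1, h2.
  set (gx := (x / (s * x ^ 2 + (1 - s))) ^ 2) in *.
  set (gy := (y / (s * y ^ 2 + (1 - s))) ^ 2) in *.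
  set (gm := (m / (s * m ^ 2 + (1 - s))) ^ 2) in *.
  set (slope := 2 * (m / (s * m ^ 2 + (1 - s))) * (((1 - s) - s * m ^ 2) / (s * m ^ 2 + (1 - s)) ^ 2)) in *.
  replace (x - m) with ((1 - tau) * (x - y)) in h1 by (unfold m; ring).
  replace (y - m) with (- tau * (x - y)) in h2 by (unfold m; ring).
  apply (Rmult_le_compat_l tau) in h1; [|lra].
  apply (Rmult_le_compat_l (1 - tau)) in h2; [|lra].
  nra.
Qed.

(** * Pointwise estimates for the weighted mean of two curves *)

(** A weight below 1/9 keeps the competitor regular: the speeds of the two curves
    differ by a factor at most 8, so (1 - tau) b + tau a cannot vanish. *)
Definition tau : R := / 10.

Section Pointwise.
Variables sigma omega T xa xb a1 a2 b1 b2 Sa Sb Sm : R.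
Hypothesis sigma_pos : 0 < sigma.
Hypothesis omega_pos : 0 < omega.
Hypothesis xa_range : / 2 <= xa <= 2.
Hypothesis xb_range : / 2 <= xb <= 2.
Hypothesis Sa_pos : 0 < Sa.
Hypothesis Sb_pos : 0 < Sb.
Hypothesis Sm_nonneg : 0 <= Sm.
Hypothesis Sa_sqr : Sa ^ 2 = a1 ^ 2 + a2 ^ 2.
Hypothesis Sb_sqr : Sb ^ 2 = b1 ^ 2 + b2 ^ 2.
Hypothesis Sm_sqr : Sm ^ 2 = (b1 + tau * (a1 - b1)) ^ 2 + (b2 + tau * (a2 - b2)) ^ 2.
Hypothesis rate_a : sigma * Sa * index T xa = omega.
Hypothesis rate_b : sigma * Sb * index T xb = omega.

Let xm : R := xb + tau * (xa - xb).
Let E2 : R := (a1 - b1) ^ 2 + (a2 - b2) ^ 2.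

Lemma mean_height_range : / 2 <= xm <= 2.
Proof. unfold xm, tau. lra. Qed.

(** The parallelogram identity, source of the gain tau (1 - tau) E2. *)
Lemma mean_speed_sqr : Sm ^ 2 = (1 - tau) * Sb ^ 2 + tau * Sa ^ 2 - tau * (1 - tau) * E2.
Proof. rewrite Sm_sqr, Sa_sqr, Sb_sqr. unfold E2. ring. Qed.

Lemma speed_ratio : Sa <= 8 * Sb.
Proof.
  assert (ha := index_range T xa xa_range). assert (hb := index_range T xb xb_range).
  apply Rmult_le_reg_l with (sigma * / 2); [lra|].
  apply Rle_trans with omega.
  - rewrite <- rate_a. assert (0 < sigma * Sa) by now apply Rmult_lt_0_compat. nra.
  - rewrite <- rate_b. assert (0 < sigma * Sb) by now apply Rmult_lt_0_compat. nra.
Qed.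

Lemma mean_speed_pos : 0 < Sm.
Proof.
  destruct Sm_nonneg as [h|h]; [exact h|exfalso].
  assert (r := speed_ratio). rewrite <- h in Sm_sqr.
  set (m1 := b1 + tau * (a1 - b1)) in *. set (m2 := b2 + tau * (a2 - b2)) in *.
  assert (h1 : m1 = 0) by (generalize (pow2_ge_0 m1) (pow2_ge_0 m2); nra).
  assert (h2 : m2 = 0) by (generalize (pow2_ge_0 m1) (pow2_ge_0 m2); nra).
  unfold m1 in h1. unfold m2 in h2.
  unfold tau in h1, h2.
  assert (e1 : a1 = - 9 * b1) by lra. assert (e2 : a2 = - 9 * b2) by lra.
  assert (Sa ^ 2 = 81 * Sb ^ 2) by (rewrite Sa_sqr, Sb_sqr, e1, e2; ring).
  assert (0 <= (8 * Sb - Sa) * (8 * Sb + Sa)) by (apply Rmult_le_pos; lra).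
  assert (0 < Sb * Sb) by now apply Rmult_lt_0_compat. simpl in *. lra.
Qed.

Lemma rescaled_sqr (S n : R) : 0 < n -> sigma * S * n = omega ->
  sigma ^ 2 * S ^ 2 = omega ^ 2 * (/ n) ^ 2.
Proof. intros np e. rewrite <- e. field. lra. Qed.

Lemma mean_speed_le : sigma * Sm <= 2 * omega.
Proof.
  assert (ha := index_range T xa xa_range). assert (hb := index_range T xb xb_range).
  assert (ra := rescaled_sqr Sa (index T xa) ltac:(lra) rate_a).
  assert (rb := rescaled_sqr Sb (index T xb) ltac:(lra) rate_b).
  assert (inv2 : forall n, / 2 <= n -> (/ n) ^ 2 <= 4).
  { intros n hn. assert (0 < / n <= 2).
    { split; [apply Rinv_0_lt_compat; lra|]. rewrite <- (Rinv_inv 2).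
      apply Rinv_le_contravar; lra. }
    set (y := / n) in *. assert (y * y <= 2 * 2) by (apply Rmult_le_compat; lra).
    simpl. lra. }
  assert (ia := inv2 _ (proj1 ha)). assert (ib := inv2 _ (proj1 hb)).
  assert (E0 : 0 <= E2) by (unfold E2; generalize (pow2_ge_0 (a1 - b1)) (pow2_ge_0 (a2 - b2)); lra).
  assert (o2 : 0 < omega ^ 2) by now apply pow_lt.
  assert (s2 : 0 < sigma ^ 2) by now apply pow_lt.
  assert (sq : (sigma * Sm) ^ 2 <= (2 * omega) ^ 2).
  { rewrite Rpow_mult_distr, mean_speed_sqr.
    replace (sigma ^ 2 * ((1 - tau) * Sb ^ 2 + tau * Sa ^ 2 - tau * (1 - tau) * E2))
      with ((1 - tau) * (sigma ^ 2 * Sb ^ 2) + tau * (sigma ^ 2 * Sa ^ 2)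
        - tau * (1 - tau) * (sigma ^ 2 * E2)) by ring.
    rewrite ra, rb. assert (0 <= sigma ^ 2 * E2) by (apply Rmult_le_pos; lra).
    assert (omega ^ 2 * (/ index T xa) ^ 2 <= omega ^ 2 * 4) by (apply Rmult_le_compat_l; lra).
    assert (omega ^ 2 * (/ index T xb) ^ 2 <= omega ^ 2 * 4) by (apply Rmult_le_compat_l; lra).
    unfold tau. lra. }
  apply Rsqr_incr_0_var; unfold Rsqr; lra.
Qed.

(** Gain from strict convexity of the norm against loss from the variation of the
    index, after taking square roots by 1 + 2 Z <= (1 + Z)^2.  Here 320000 is
    16 * 20000, as n^2 lies between 1/4 and 16. *)
Lemma mean_rate :
  sigma * Sm * index T xm <= omega + tau * (1 - tau) / 2 *
    (320000 * omega * (xa - xb) ^ 2 - sigma ^ 2 / 4 * E2 / omega).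
Proof.
  assert (ha := index_range T xa xa_range). assert (hb := index_range T xb xb_range).
  assert (hm := index_range T xm mean_height_range).
  assert (ra := rescaled_sqr Sa (index T xa) ltac:(lra) rate_a).
  assert (rb := rescaled_sqr Sb (index T xb) ltac:(lra) rate_b).
  assert (sc := index_inv_semiconcave T xa xb tau xa_range xb_range ltac:(unfold tau; lra)).
  fold xm in sc. set (na := index T xa) in *. set (nb := index T xb) in *.
  set (n := index T xm) in *.
  assert (E0 : 0 <= E2) by (unfold E2; generalize (pow2_ge_0 (a1 - b1)) (pow2_ge_0 (a2 - b2)); lra).
  assert (o2 : 0 < omega ^ 2) by now apply pow_lt.
  assert (s2 : 0 < sigma ^ 2) by now apply pow_lt.
  assert (n2 : / 4 <= n ^ 2 <= 16) by (split; nra).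
  assert (d2 := pow2_ge_0 (xa - xb)).
  set (q := tau * (1 - tau) / 2). assert (qp : 0 < q) by (unfold q, tau; lra).
  set (Z := q * (320000 * omega * (xa - xb) ^ 2 - sigma ^ 2 / 4 * E2 / omega)).
  assert (sq : (sigma * Sm * n) ^ 2 <= omega ^ 2 + 2 * (omega * Z)).
  { replace ((sigma * Sm * n) ^ 2) with (n ^ 2 * (sigma ^ 2 * Sm ^ 2)) by ring.
    rewrite mean_speed_sqr.
    replace (sigma ^ 2 * ((1 - tau) * Sb ^ 2 + tau * Sa ^ 2 - tau * (1 - tau) * E2))
      with ((1 - tau) * (sigma ^ 2 * Sb ^ 2) + tau * (sigma ^ 2 * Sa ^ 2)
        - 2 * q * (sigma ^ 2 * E2)) by (unfold q; field).
    rewrite ra, rb.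
    replace ((1 - tau) * (omega ^ 2 * (/ nb) ^ 2) + tau * (omega ^ 2 * (/ na) ^ 2)
      - 2 * q * (sigma ^ 2 * E2))
      with (omega ^ 2 * ((1 - tau) * (/ nb) ^ 2 + tau * (/ na) ^ 2) - 2 * q * (sigma ^ 2 * E2))
      by ring.
    replace (omega * Z) with (q * (320000 * omega ^ 2 * (xa - xb) ^ 2 - sigma ^ 2 / 4 * E2))
      by (unfold Z; field; lra).
    apply (Rmult_le_compat_l (n ^ 2 * omega ^ 2)) in sc; [|apply Rmult_le_pos; lra].
    replace (tau * (1 - tau)) with (2 * q) in sc by (unfold q; field).
    replace (n ^ 2 * omega ^ 2 * ((/ n) ^ 2 + 20000 * (2 * q) * (xa - xb) ^ 2))
      with (omega ^ 2 + n ^ 2 * (20000 * (2 * q) * (omega ^ 2 * (xa - xb) ^ 2))) in sc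
      by (field; lra).
    assert (t1 : n ^ 2 * (20000 * (2 * q) * (omega ^ 2 * (xa - xb) ^ 2))
      <= 16 * (20000 * (2 * q) * (omega ^ 2 * (xa - xb) ^ 2))).
    { apply Rmult_le_compat_r; [|lra]. apply Rmult_le_pos; [lra|]. apply Rmult_le_pos; lra. }
    assert (t2 : / 4 * (2 * q * (sigma ^ 2 * E2)) <= n ^ 2 * (2 * q * (sigma ^ 2 * E2))).
    { apply Rmult_le_compat_r; [|lra]. apply Rmult_le_pos; [lra|]. apply Rmult_le_pos; lra. }
    lra. }
  (* The square root may be compared with omega + Z only once the latter is positive;
     the bound on the square forces Z >= - omega / 2. *)
  assert (Zb : 0 < omega + Z).
  { assert (0 <= omega ^ 2 + 2 * (omega * Z)) by (apply Rle_trans with (2 := sq), pow2_ge_0).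
    nra. }
  fold Z. apply Rsqr_incr_0_var; [|lra]. unfold Rsqr. generalize (pow2_ge_0 Z). nra.
Qed.

(** The shift of the angle by q (Y |D|^2 - z) produces, through its derivative, the
    cross term 2 Y D . D', which Young's inequality balances with the gain in |D'|^2.
    The remaining multiple of |D|^2 absorbs the loss; the rates 11 and 10 come from
    the bound 10 omega on the change of the index per unit of shift, and one further
    unit of omega |D|^2 feeds z. *)
Lemma corrected_rate (K D1 D2 Y z e : R) :
  320000 * (xa - xb) ^ 2 <= K * (D1 ^ 2 + D2 ^ 2) ->
  0 <= K -> 2 * (K + 1) <= Y -> Y <= sigma ^ 2 / 8 -> 0 <= z -> e <= 1 ->
  let q := tau * (1 - tau) / 2 in
  sigma * Sm * index (T + q * (Y * (D1 ^ 2 + D2 ^ 2) - z)) xm <=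
    omega + q * (11 * Y * omega * (D1 ^ 2 + D2 ^ 2)
      + 2 * Y * (D1 * (a1 - b1) + D2 * (a2 - b2))
      - (e * omega * (D1 ^ 2 + D2 ^ 2) - 10 * omega * z)).
Proof.
  intros hK K0 YK Ym z0 e1 q. set (h := q * (Y * (D1 ^ 2 + D2 ^ 2) - z)).
  assert (qp : 0 < q) by (unfold q, tau; lra).
  assert (rate := mean_rate). fold q in rate.
  assert (hx := mean_height_range).
  assert (lip := index_lipschitz (T + h) T xm ltac:(lra)).
  replace (T + h - T) with h in lip by ring.
  assert (dn := Rle_abs (index (T + h) xm - index T xm)).
  set (n' := index (T + h) xm) in *. set (n := index T xm) in *.
  set (D := D1 ^ 2 + D2 ^ 2) in *.
  assert (D0 : 0 <= D) by (unfold D; generalize (pow2_ge_0 D1) (pow2_ge_0 D2); lra).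
  assert (Y0 : 0 < Y) by lra.
  assert (ah : Rabs h <= q * (Y * D + z)).
  { unfold h. rewrite Rabs_mult, (Rabs_right q) by lra.
    apply Rmult_le_compat_l; [lra|]. assert (0 <= Y * D) by (apply Rmult_le_pos; lra).
    apply Rabs_le; lra. }
  assert (hi : / xm <= 2).
  { rewrite <- (Rinv_inv 2). apply Rinv_le_contravar; lra. }
  assert (hi' : xm + / xm <= 5 / 2).
  { assert (xe : xm * / xm = 1) by (field; lra). set (y := / xm) in *.
    assert (0 < y) by (unfold y; apply Rinv_0_lt_compat; lra). nra. }
  assert (xi : 0 < / xm) by (apply Rinv_0_lt_compat; lra).
  assert (n'n : n' - n <= 5 * Rabs h).
  { apply Rle_trans with (1 := dn). apply Rle_trans with (1 := lip).
    apply Rmult_le_compat_r; [apply Rabs_pos|lra]. }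
  assert (ms := mean_speed_le).
  assert (sm0 : 0 <= sigma * Sm) by (apply Rmult_le_pos; lra).
  assert (step : sigma * Sm * (n' - n) <= 10 * omega * (q * (Y * D + z))).
  { apply Rle_trans with (2 * omega * (5 * (q * (Y * D + z)))); [|lra].
    apply Rle_trans with (sigma * Sm * (5 * (q * (Y * D + z)))).
    - apply Rmult_le_compat_l; lra.
    - apply Rmult_le_compat_r; [|exact ms]. generalize (Rabs_pos h). lra. }
  replace (sigma * Sm * n') with (sigma * Sm * n + sigma * Sm * (n' - n)) by ring.
  set (I := D1 * (a1 - b1) + D2 * (a2 - b2)).
  assert (young : - (sigma ^ 2 / 4 * E2 / omega) - Y / 2 * (omega * D) <= 2 * Y * I).
  { assert (s2 : 0 < sigma ^ 2) by now apply pow_lt.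
    (* Young's inequality, as the positivity of squares with weight k. *)
    pose (k := sigma ^ 2 / (4 * omega)).
    assert (kp : 0 < k) by (apply Rdiv_lt_0_compat; lra).
    assert (sqs : 0 <= k * ((a1 - b1) + Y / k * D1) ^ 2 + k * ((a2 - b2) + Y / k * D2) ^ 2).
    { apply Rplus_le_le_0_compat; apply Rmult_le_pos; try lra; apply pow2_ge_0. }
    replace (k * ((a1 - b1) + Y / k * D1) ^ 2 + k * ((a2 - b2) + Y / k * D2) ^ 2)
      with (k * E2 + 2 * Y * I + Y * (Y / k) * D) in sqs
      by (unfold E2, I, D; field; lra).
    assert (Yk : Y / k <= omega / 2).
    { unfold k. replace (Y / (sigma ^ 2 / (4 * omega))) with (Y * (4 * omega / sigma ^ 2))
        by (field; split; lra).
      apply Rle_trans with (sigma ^ 2 / 8 * (4 * omega / sigma ^ 2)).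
      - apply Rmult_le_compat_r; [|exact Ym]. apply Rlt_le, Rdiv_lt_0_compat; lra.
      - apply Req_le. field. lra. }
    assert (Y * (Y / k) * D <= Y / 2 * (omega * D)).
    { replace (Y / 2 * (omega * D)) with (Y * (omega / 2) * D) by field.
      apply Rmult_le_compat_r; [exact D0|]. apply Rmult_le_compat_l; lra. }
    replace (sigma ^ 2 / 4 * E2 / omega) with (k * E2) by (unfold k; field; lra).
    lra. }
  assert (oD : 0 <= omega * D) by (apply Rmult_le_pos; lra).
  assert (kd : omega * (320000 * (xa - xb) ^ 2) <= K * (omega * D)).
  { replace (K * (omega * D)) with (omega * (K * D)) by ring.
    apply Rmult_le_compat_l; lra. }
  assert (yd : 2 * (K + 1) * (omega * D) <= Y * (omega * D)) by (apply Rmult_le_compat_r; lra).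
  assert (ed : e * (omega * D) <= omega * D) by nra.
  set (W := sigma ^ 2 / 4 * E2 / omega) in *.
  assert (fin : 320000 * omega * (xa - xb) ^ 2 - W + 10 * omega * (Y * D + z)
    <= 11 * Y * omega * D + 2 * Y * I - (e * omega * D - 10 * omega * z)) by lra.
  apply (Rmult_le_compat_l q) in fin; [|lra]. lra.
Qed.
End Pointwise.

(** * Uniqueness of the maximizer *)

Lemma expanding_lt (T : R -> R) (s t : R) : expanding T -> s < t -> T s < T t.
Proof.
  intros [T' [l [lp [dT lT]]]] st.
  assert (T s - l * s <= T t - l * t); [|nra].
  apply (derive_nonneg_le (fun t => T t - l * t) (fun t => T' t - l)); [lra| |].
  - intros r _. apply (is_derive_minus T (fun t => l * t)); [apply dT|].
    auto_derive; [auto|ring].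
  - intros r _. generalize (lT r); lra.
Qed.

(** The coupling is Ta^(-1) o Tb, smooth by the bootstrap for
    phi' = Tb' / Ta' (phi). *)
Lemma coupling_exists (d : R) (Ta Tb : R -> R) :
  0 < d -> expanding Ta -> expanding Tb -> smooth (nbhd d) Ta -> smooth (nbhd d) Tb ->
  Ta 0 = 0 -> Tb 0 = 0 -> Ta 1 = Tb 1 ->
  exists (phi : R -> R) (e : R), 0 < e <= d /\ smooth (nbhd e) phi /\
    (forall t, nbhd e t -> nbhd d (phi t)) /\
    (forall t, Ta (phi t) = Tb t) /\ phi 0 = 0 /\ phi 1 = 1 /\
    (forall t, 0 < Derive phi t) /\ (forall t, continuous phi t) /\
    (forall t, Derive Tb t = Derive phi t * Derive Ta (phi t)).
Proof.
  intros dp xa xb sa sb a0 b0 ab1.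
  pose proof xa as [Ta' [la [lap [dTa hla]]]]. pose proof xb as [Tb' [lb [lbp [dTb hlb]]]].
  destruct (global_inverse Ta Ta' la lap dTa hla) as [psi [Tpsi [psiT dpsi]]].
  pose (phi := fun t => psi (Tb t)).
  assert (dphi : forall t, is_derive phi t (Tb' t * / Ta' (phi t))).
  { intros t. apply (is_derive_comp psi Tb); [apply dpsi|apply dTb]. }
  assert (cphi : forall t, continuous phi t).
  { intros t. apply (ex_derive_continuous (V:=R_NormedModule)). eexists. apply dphi. }
  assert (phi0 : phi 0 = 0) by (unfold phi; rewrite b0; rewrite <- a0 at 1; apply psiT).
  assert (phi1 : phi 1 = 1) by (unfold phi; rewrite <- ab1; apply psiT).
  assert (mono : forall s t, s < t -> phi s < phi t).
  { intros s t st. destruct (Rlt_le_dec (phi s) (phi t)) as [h|h]; [exact h|exfalso].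
    assert (h1 := expanding_lt Tb s t xb st).
    rewrite <- (Tpsi (Tb s)), <- (Tpsi (Tb t)) in h1. fold (phi s) in h1. fold (phi t) in h1.
    destruct h as [h|h]; [generalize (expanding_lt Ta _ _ xa h); lra|rewrite h in h1; lra]. }
  destruct (positive_extends d (fun t => phi t + d) dp) as [e1 [he1 H1]].
  { intros t _. apply (continuous_plus (V:=R_NormedModule)); [apply cphi|apply continuous_const]. }
  { intros t Ht. destruct (Req_dec t 0) as [->|]; [lra|].
    generalize (mono 0 t ltac:(lra)). lra. }
  destruct (positive_extends d (fun t => 1 + d - phi t) dp) as [e2 [he2 H2]].
  { intros t _. apply (continuous_minus (V:=R_NormedModule)); [apply continuous_const|apply cphi]. }
  { intros t Ht. destruct (Req_dec t 1) as [->|]; [lra|].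
    generalize (mono t 1 ltac:(lra)). lra. }
  pose (e := Rmin e1 e2).
  assert (h1 := Rmin_l e1 e2). assert (h2 := Rmin_r e1 e2). fold e in h1, h2.
  assert (ep : 0 < e) by (apply Rmin_pos; lra).
  assert (into : forall t, nbhd e t -> nbhd d (phi t)).
  { intros t Ht. unfold nbhd in *.
    generalize (H1 t ltac:(lra)) (H2 t ltac:(lra)). lra. }
  assert (DTa : forall t, Derive Ta t = Ta' t) by (intros; apply is_derive_unique, dTa).
  assert (DTb : forall t, Derive Tb t = Tb' t) by (intros; apply is_derive_unique, dTb).
  assert (Dphi : forall t, Derive phi t = Tb' t * / Ta' (phi t)).
  { intros; apply is_derive_unique, dphi. }
  exists phi, e. split; [lra|]. split; [|split; [exact into|split; [|split; [|split; [|split; [|split]]]]]].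
  - intros n. assert (oD := open_nbhd e).
    induction n as [|n IH]; [easy|].
    apply diff_on_S with (fun t => Derive Tb t * / Derive Ta (phi t)); [exact oD| |].
    + intros t Ht. rewrite DTa, DTb. apply dphi.
    + apply diff_on_mult; [exact oD| |].
      * apply diff_on_subset with (nbhd d); [unfold nbhd; intros; lra|]. now apply smooth_Derive.
      * apply diff_on_inv; [exact oD| |].
        -- intros t _. rewrite DTa. generalize (hla (phi t)). lra.
        -- apply (diff_on_comp (nbhd e) (nbhd d)); auto. now apply smooth_Derive.
  - intros t. apply Tpsi.
  - exact phi0.
  - exact phi1.
  - intros t. rewrite Dphi. apply Rmult_lt_0_compat; [generalize (hlb t); lra|].
    apply Rinv_0_lt_compat. generalize (hla (phi t)). lra.
  - exact cphi.
  - intros t. rewrite Dphi, DTa, DTb. field. generalize (hla (phi t)). lra.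
Qed.

Section Uniqueness.
Variables (p q : R * R) (alpha beta : curve) (d e sigma : R) (Ta Tb phi : R -> R).
Let kappa := fst p.
Hypothesis kappa_pos : 0 < kappa.
Hypothesis sigma_pos : 0 < sigma.
Hypothesis alpha_adm : admissible p q alpha.
Hypothesis beta_adm : admissible p q beta.
Hypothesis alpha_reg : regular_on d alpha.
Hypothesis beta_reg : regular_on d beta.
Hypothesis alpha_angle : pruefer_angle d kappa sigma alpha Ta.
Hypothesis beta_angle : pruefer_angle d kappa sigma beta Tb.
Hypothesis alpha_end : Ta 1 = PI.
Hypothesis beta_end : Tb 1 = PI.
Hypothesis e_range : 0 < e <= d.
Hypothesis phi_smooth : smooth (nbhd e) phi.
Hypothesis phi_into : forall t, nbhd e t -> nbhd d (phi t).
Hypothesis phi_unit : forall t, 0 <= t <= 1 -> 0 <= phi t <= 1.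
Hypothesis phi_angle : forall t, Ta (phi t) = Tb t.
Hypothesis phi_0 : phi 0 = 0.
Hypothesis phi_1 : phi 1 = 1.
Hypothesis phi_pos : forall t, 0 < Derive phi t.
Hypothesis phi_rate : forall t, Derive Tb t = Derive phi t * Derive Ta (phi t).

Let K : R := 320000 / kappa ^ 2.
Let Y0 : R := 2 * (K + 1).
Hypothesis sigma_kappa : 32 <= sigma * kappa.
Hypothesis sigma_large : 8 * (Y0 * exp 44) <= sigma ^ 2.
Hypothesis maximal : forall g, admissible p q g -> Rbar_le (lambda1 g) (sigma ^ 2).

Let D1 (t : R) : R := fst alpha (phi t) - fst beta t.
Let D2 (t : R) : R := snd alpha (phi t) - snd beta t.
Let D (t : R) : R := D1 t ^ 2 + D2 t ^ 2.
Let omega (t : R) : R := Derive Tb t.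
Let mean : curve := (fun t => fst beta t + tau * D1 t, fun t => snd beta t + tau * D2 t).
Let a1 (t : R) : R := Derive phi t * Derive (fst alpha) (phi t).
Let a2 (t : R) : R := Derive phi t * Derive (snd alpha) (phi t).
Let b1 (t : R) : R := Derive (fst beta) t.
Let b2 (t : R) : R := Derive (snd beta) t.
Let xa (t : R) : R := fst alpha (phi t) / kappa.
Let xb (t : R) : R := fst beta t / kappa.

Lemma nbhd_sub (t : R) : nbhd e t -> nbhd d t.
Proof. unfold nbhd. lra. Qed.

Lemma unit_nbhd (t : R) : 0 <= t <= 1 -> nbhd e t.
Proof. unfold nbhd. lra. Qed.

Lemma smooth_alpha_phi (f : R -> R) : smooth (nbhd d) f -> smooth (nbhd e) (fun t => f (phi t)).
Proof. intros sf. apply (smooth_comp _ (open_nbhd e) (nbhd d)); auto. Qed.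

Lemma smooth_narrow (f : R -> R) : smooth (nbhd d) f -> smooth (nbhd e) f.
Proof. apply smooth_subset, nbhd_sub. Qed.

Lemma smooth_D1 : smooth (nbhd e) D1.
Proof.
  apply smooth_minus; [apply open_nbhd|apply smooth_alpha_phi, alpha_reg|].
  apply smooth_narrow, beta_reg.
Qed.

Lemma smooth_D2 : smooth (nbhd e) D2.
Proof.
  apply smooth_minus; [apply open_nbhd|apply smooth_alpha_phi, alpha_reg|].
  apply smooth_narrow, beta_reg.
Qed.

Lemma smooth_mean_fst : smooth (nbhd e) (fst mean).
Proof.
  apply smooth_plus; [apply open_nbhd|apply smooth_narrow, beta_reg|].
  apply smooth_mult; [apply open_nbhd|apply smooth_const, open_nbhd|apply smooth_D1].
Qed.

Lemma smooth_mean_snd : smooth (nbhd e) (snd mean).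
Proof.
  apply smooth_plus; [apply open_nbhd|apply smooth_narrow, beta_reg|].
  apply smooth_mult; [apply open_nbhd|apply smooth_const, open_nbhd|apply smooth_D2].
Qed.

Lemma is_derive_diff (f h : R -> R) (t : R) : nbhd e t ->
  smooth (nbhd d) f -> smooth (nbhd d) h ->
  is_derive (fun t => f (phi t) - h t) t (Derive phi t * Derive f (phi t) - Derive h t).
Proof.
  intros Ht sf sh. apply (is_derive_minus (fun t => f (phi t)) h).
  - apply (is_derive_comp f phi).
    + apply (smooth_is_derive (nbhd d)); auto.
    + apply (smooth_is_derive (nbhd e)); auto.
  - apply (smooth_is_derive (nbhd d)); auto using nbhd_sub.
Qed.

Lemma is_derive_D1 (t : R) : nbhd e t -> is_derive D1 t (a1 t - b1 t).
Proof. intros Ht. apply is_derive_diff; [exact Ht|apply alpha_reg|apply beta_reg]. Qed.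

Lemma is_derive_D2 (t : R) : nbhd e t -> is_derive D2 t (a2 t - b2 t).
Proof. intros Ht. apply is_derive_diff; [exact Ht|apply alpha_reg|apply beta_reg]. Qed.

Lemma Derive_mean_fst (t : R) : nbhd e t ->
  Derive (fst mean) t = b1 t + tau * (a1 t - b1 t).
Proof.
  intros Ht. apply is_derive_unique.
  apply (is_derive_plus (fst beta) (fun t => tau * D1 t)).
  - apply (smooth_is_derive (nbhd d)); [apply beta_reg|now apply nbhd_sub].
  - apply (is_derive_scal D1). now apply is_derive_D1.
Qed.

Lemma Derive_mean_snd (t : R) : nbhd e t ->
  Derive (snd mean) t = b2 t + tau * (a2 t - b2 t).
Proof.
  intros Ht. apply is_derive_unique.
  apply (is_derive_plus (snd beta) (fun t => tau * D2 t)).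
  - apply (smooth_is_derive (nbhd d)); [apply beta_reg|now apply nbhd_sub].
  - apply (is_derive_scal D2). now apply is_derive_D2.
Qed.

Lemma speed_sqr (g : curve) (t : R) :
  speed g t ^ 2 = Derive (fst g) t ^ 2 + Derive (snd g) t ^ 2.
Proof.
  unfold speed. apply pow2_sqrt.
  generalize (pow2_ge_0 (Derive (fst g) t)) (pow2_ge_0 (Derive (snd g) t)). lra.
Qed.

Lemma beta_rate (t : R) : nbhd e t -> sigma * speed beta t * index (Tb t) (xb t) = omega t.
Proof.
  intros Ht. symmetry. apply is_derive_unique. apply beta_angle. now apply nbhd_sub.
Qed.

Lemma alpha_rate (t : R) : nbhd e t ->
  sigma * (Derive phi t * speed alpha (phi t)) * index (Tb t) (xa t) = omega t.
Proof.
  intros Ht. unfold omega. rewrite phi_rate.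
  rewrite (is_derive_unique _ _ _ (proj2 alpha_angle _ (phi_into t Ht))).
  rewrite phi_angle. unfold xa. ring.
Qed.

Lemma omega_pos (t : R) : nbhd e t -> 0 < omega t.
Proof.
  intros Ht. rewrite <- beta_rate by exact Ht.
  apply (angle_rate_pos d kappa beta beta_reg kappa_pos); [exact sigma_pos|now apply nbhd_sub].
Qed.

Lemma start_height (g : curve) : admissible p q g -> fst g 0 = kappa.
Proof. intros [_ [_ [_ [_ [h _]]]]]. unfold kappa. rewrite <- h. reflexivity. Qed.

Lemma beta_height (t : R) : 0 <= t <= 1 -> / 2 <= xb t <= 2.
Proof.
  apply (height_range d kappa sigma beta Tb); auto. now apply start_height.
Qed.

Lemma alpha_height (t : R) : 0 <= t <= 1 -> / 2 <= xa t <= 2.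
Proof.
  intros Ht. apply (height_range d kappa sigma alpha Ta); auto. now apply start_height.
Qed.

Lemma alpha_speed_pos (t : R) : nbhd e t -> 0 < Derive phi t * speed alpha (phi t).
Proof.
  intros Ht. apply Rmult_lt_0_compat; [apply phi_pos|].
  apply (reg_speed_pos _ _ alpha_reg), phi_into, Ht.
Qed.

Lemma alpha_speed_sqr (t : R) :
  (Derive phi t * speed alpha (phi t)) ^ 2 = a1 t ^ 2 + a2 t ^ 2.
Proof. rewrite Rpow_mult_distr, speed_sqr. unfold a1, a2. ring. Qed.

Lemma mean_velocity_sqr (t : R) : nbhd e t ->
  speed mean t ^ 2 = (b1 t + tau * (a1 t - b1 t)) ^ 2 + (b2 t + tau * (a2 t - b2 t)) ^ 2.
Proof. intros Ht. now rewrite speed_sqr, Derive_mean_fst, Derive_mean_snd. Qed.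

Lemma mean_height (t : R) : fst mean t / kappa = xb t + tau * (xa t - xb t).
Proof. unfold mean, xa, xb, D1. simpl. field. lra. Qed.

Lemma D_ends : D1 0 = 0 /\ D2 0 = 0 /\ D1 1 = 0 /\ D2 1 = 0.
Proof.
  destruct alpha_adm as [_ [_ [_ [_ [pa qa]]]]].
  destruct beta_adm as [_ [_ [_ [_ [pb qb]]]]].
  rewrite <- pb in pa. rewrite <- qb in qa. unfold point in pa, qa.
  injection pa as p1 p2. injection qa as q1 q2.
  unfold D1, D2. rewrite phi_0, phi_1. repeat split; lra.
Qed.

(** Convexity of the half plane gives positivity, and mean_speed_pos regularity. *)
Lemma mean_admissible : admissible p q mean.
Proof.
  destruct D_ends as [u1 [u2 [u3 u4]]].
  split; [|split; [|split; [|split; [|split]]]].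
  - apply (smooth_on_I_of_smooth e); [lra|apply smooth_mean_fst].
  - apply (smooth_on_I_of_smooth e); [lra|apply smooth_mean_snd].
  - intros t Ht. unfold half_plane.
    assert (h : 0 < fst mean t / kappa).
    { rewrite mean_height. generalize (alpha_height t Ht) (beta_height t Ht). unfold tau. lra. }
    change (0 < fst mean t). replace (fst mean t) with (fst mean t / kappa * kappa) by (field; lra).
    now apply Rmult_lt_0_compat.
  - intros t Ht v0. assert (Hn := unit_nbhd t Ht).
    assert (h : 0 < speed mean t).
    { apply (mean_speed_pos sigma (omega t) (Tb t) (xa t) (xb t) (a1 t) (a2 t) (b1 t) (b2 t)
        (Derive phi t * speed alpha (phi t)) (speed beta t)); auto.
      - now apply alpha_height.
      - now apply beta_height.
      - now apply alpha_speed_pos.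
      - apply (reg_speed_pos _ _ beta_reg), nbhd_sub, Hn.
      - apply sqrt_pos.
      - apply alpha_speed_sqr.
      - apply speed_sqr.
      - now apply mean_velocity_sqr.
      - now apply alpha_rate.
      - now apply beta_rate. }
    unfold velocity in v0.
    assert (v1 : Derive (fst mean) t = 0) by exact (f_equal fst v0).
    assert (v2 : Derive (snd mean) t = 0) by exact (f_equal snd v0).
    unfold speed in h. rewrite v1, v2 in h.
    replace (0 ^ 2 + 0 ^ 2) with 0 in h by ring. rewrite sqrt_0 in h. lra.
  - destruct beta_adm as [_ [_ [_ [_ [pb _]]]]]. rewrite <- pb. unfold point, mean; simpl.
    rewrite u1, u2. f_equal; ring.
  - destruct beta_adm as [_ [_ [_ [_ [_ qb]]]]]. rewrite <- qb. unfold point, mean; simpl.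
    rewrite u3, u4. f_equal; ring.
Qed.

Lemma Tb_range (t : R) : 0 <= t <= 1 -> 0 <= Tb t <= PI.
Proof.
  intros Ht. destruct beta_angle as [T0 dT].
  split; [rewrite <- T0|rewrite <- beta_end];
    apply (derive_nonneg_le Tb (fun t => sigma * speed beta t * index (Tb t) (fst beta t / kappa)));
    try lra; intros s Hs; assert (Hn : nbhd d s) by (apply nbhd_sub, unit_nbhd; lra);
    try (now apply dT); apply Rlt_le, (angle_rate_pos d kappa beta beta_reg kappa_pos); auto.
Qed.

(** Otherwise z is positive at the end, and the corrected angle shows that the
    eigenvalue of the mean curve exceeds the maximum. *)
Lemma same_trace (t : R) : 0 <= t <= 1 -> D t = 0.
Proof.
  intros Ht. destruct (Req_dec (D t) 0) as [h|nz]; [exact h|exfalso].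
  assert (oE := open_nbhd e).
  assert (D0 : forall s, 0 <= D s).
  { intros s. unfold D. generalize (pow2_ge_0 (D1 s)) (pow2_ge_0 (D2 s)). lra. }
  destruct D_ends as [u1 [u2 [u3 u4]]].
  assert (De : D 0 = 0 /\ D 1 = 0) by (unfold D; rewrite u1, u2, u3, u4; split; ring).
  assert (Tin : 0 < t < 1).
  { destruct (Req_dec t 0) as [->|]; [tauto|]. destruct (Req_dec t 1) as [->|]; [tauto|]. lra. }
  assert (sTb : smooth (nbhd e) Tb).
  { apply smooth_narrow. apply (pruefer_smooth d kappa beta beta_reg kappa_pos sigma), beta_angle. }
  assert (somega : smooth (nbhd e) omega) by now apply smooth_Derive.
  assert (sD : smooth (nbhd e) D).
  { apply smooth_plus; auto; apply smooth_pow2; auto using smooth_D1, smooth_D2. }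
  assert (soD : smooth (nbhd e) (fun t => omega t * D t)) by now apply smooth_mult.
  destruct (primitive_exists e (fun t => omega t * D t)) as [Z [Z0 dZ]]; [lra| |].
  { intros s Hs. now apply (smooth_continuous (nbhd e)). }
  assert (sZ : smooth (nbhd e) Z) by now apply smooth_primitive with (2 := dZ).
  assert (oD0 : forall s, 0 <= s <= 1 -> 0 <= omega s * D s).
  { intros s Hs. apply Rmult_le_pos; [|apply D0]. now apply Rlt_le, omega_pos, unit_nbhd. }
  assert (Zpos : forall s, 0 <= s <= 1 -> 0 <= Z s).
  { intros s Hs. rewrite <- Z0.
    apply (derive_nonneg_le Z (fun t => omega t * D t)); [lra| |].
    - intros r Hr. apply dZ, unit_nbhd. lra.
    - intros r Hr. apply oD0. lra. }
  assert (Z1 : 0 < Z 1).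
  { assert (hz : is_RInt (fun t => omega t * D t) 0 1 (Z 1 - Z 0)).
    { apply (is_RInt_derive (V:=R_CompleteNormedModule)); intros s;
        rewrite Rmin_left, Rmax_right by lra; intros Hs.
      - now apply dZ, unit_nbhd.
      - apply (smooth_continuous (nbhd e)); [exact soD|now apply unit_nbhd]. }
    apply (is_RInt_unique (V:=R_CompleteNormedModule)) in hz.
    rewrite Z0, Rminus_0_r in hz. rewrite <- hz. apply RInt_pos with t; auto.
    - intros s Hs. apply (smooth_continuous (nbhd e)); [exact soD|now apply unit_nbhd].
    - apply Rmult_lt_0_compat; [now apply omega_pos, unit_nbhd|]. generalize (D0 t). lra. }
  pose (c := tau * (1 - tau) / 2). assert (cp : 0 < c) by (unfold c, tau; lra).
  pose (Y := fun t => Y0 * exp (11 * Tb t)). pose (z := fun t => exp (- (10 * Tb t)) * Z t).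
  pose (U := fun t => Tb t + c * (Y t * D t - z t)).
  assert (sU : smooth (nbhd e) U).
  { unfold U, Y, z. apply smooth_plus; auto. apply smooth_mult; auto using smooth_const.
    apply smooth_minus; auto.
    - apply smooth_mult; auto. apply smooth_mult; auto using smooth_const.
      apply smooth_exp; auto. apply smooth_mult; auto using smooth_const.
    - apply smooth_mult; auto. apply smooth_exp; auto.
      apply smooth_ext with (fun t => (-10) * Tb t); auto; [intros; ring|].
      apply smooth_mult; auto using smooth_const. }
  assert (dU : forall s, nbhd e s -> Derive U s = omega s + c *
    (11 * Y s * omega s * (D1 s ^ 2 + D2 s ^ 2)
     + 2 * Y s * (D1 s * (a1 s - b1 s) + D2 s * (a2 s - b2 s))
     - (exp (- (10 * Tb s)) * omega s * (D1 s ^ 2 + D2 s ^ 2) - 10 * omega s * z s))).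
  { intros s Hs. apply is_derive_unique. unfold U, Y, z, D.
    assert (k1 := is_derive_D1 s Hs). assert (k2 := is_derive_D2 s Hs).
    assert (k3 := dZ s Hs). assert (k4 := smooth_is_derive _ _ s sTb Hs). fold (omega s) in k4.
    auto_derive.
    - repeat split; eexists; eassumption.
    - eta. rewrite (is_derive_unique _ _ _ k1), (is_derive_unique _ _ _ k2),
        (is_derive_unique _ _ _ k3). fold (omega s). unfold D. simpl. ring. }
  assert (Kp : 0 <= K).
  { unfold K. apply Rlt_le, Rdiv_lt_0_compat; [lra|now apply pow_lt]. }
  destruct (admissible_regular p q mean mean_admissible) as [dm mreg].
  assert (strict : Rbar_lt (sigma ^ 2) (lambda1 mean)).
  { apply (strict_barta dm mean kappa sigma U (Derive U) mreg kappa_pos sigma_pos).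
    - intros s Hs. apply (smooth_is_derive (nbhd e)); [exact sU|now apply unit_nbhd].
    - intros s Hs. apply (smooth_continuous (nbhd e)); [now apply smooth_Derive|now apply unit_nbhd].
    - unfold U, z. rewrite (proj1 beta_angle), Z0, (proj1 De). lra.
    - unfold U. rewrite beta_end, (proj2 De).
      assert (0 < z 1). { apply Rmult_lt_0_compat; [apply exp_pos|exact Z1]. }
      assert (0 < c * z 1) by now apply Rmult_lt_0_compat. lra.
    - intros s Hs. assert (Hn := unit_nbhd s Hs). rewrite dU, mean_height by exact Hn.
      assert (Tr := Tb_range s Hs). assert (Y0p : 0 < Y0) by (unfold Y0; lra).
      apply (corrected_rate sigma (omega s) (Tb s) (xa s) (xb s) (a1 s) (a2 s) (b1 s) (b2 s)
        (Derive phi s * speed alpha (phi s)) (speed beta s) (speed mean s)) with (K := K); auto.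
      + now apply omega_pos.
      + now apply alpha_height.
      + now apply beta_height.
      + apply sqrt_pos.
      + apply alpha_speed_sqr.
      + apply speed_sqr.
      + now apply mean_velocity_sqr.
      + now apply alpha_rate.
      + now apply beta_rate.
      + replace (xa s - xb s) with (D1 s / kappa) by (unfold xa, xb, D1; field; lra).
        unfold K. replace (320000 * (D1 s / kappa) ^ 2) with (320000 / kappa ^ 2 * D1 s ^ 2)
          by (field; lra).
        apply Rmult_le_compat_l; [exact Kp|]. generalize (pow2_ge_0 (D2 s)). lra.
      + fold Y0. unfold Y. rewrite <- (Rmult_1_r Y0) at 1. apply Rmult_le_compat_l; [lra|].
        generalize (exp_ineq1_le (11 * Tb s)). lra.
      + apply Rle_trans with (Y0 * exp 44); [|lra]. apply Rmult_le_compat_l; [lra|].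
        (* The constant 44 is an upper bound for 11 pi, the final value of 11 Tb. *)
        assert (h44 : 11 * Tb s <= 44) by (generalize PI_4; lra).
        destruct h44 as [h44|h44]; [now apply Rlt_le, exp_increasing|rewrite h44; lra].
      + apply Rmult_le_pos; [apply Rlt_le, exp_pos|now apply Zpos].
      + rewrite <- exp_0. destruct (Req_dec (Tb s) 0) as [->|];
          [rewrite Rmult_0_r, Ropp_0; lra|]. apply Rlt_le, exp_increasing. lra. }
  apply (Rbar_lt_not_le _ _ strict). apply maximal, mean_admissible.
Qed.
End Uniqueness.

Lemma angle_of_maximizer (p q : R * R) (g : curve) (sigma : R) :
  admissible p q g -> 0 < fst p -> 0 < sigma -> lambda1 g = Finite (sigma ^ 2) ->
  exists d T, regular_on d g /\ pruefer_angle d (fst p) sigma g T /\ expanding T /\ T 1 = PI.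
Proof.
  intros adm kp sp lam. destruct (admissible_regular p q g adm) as [d reg].
  assert (dh : 0 < d / 2 <= d) by (generalize (reg_width _ _ reg); lra).
  assert (reg2 := regular_on_smaller d (d / 2) g reg dh).
  destruct (pruefer_exists d (fst p) g reg kp sigma sp) as [T [pT xT]].
  exists (d / 2), T. split; [exact reg2|]. split; [exact pT|]. split; [exact xT|].
  exact (angle_end (d / 2) (fst p) g reg2 kp sigma T sp pT lam).
Qed.

Lemma pruefer_angle_smaller (d e kappa sigma : R) (g : curve) (T : R -> R) :
  e <= d -> pruefer_angle d kappa sigma g T -> pruefer_angle e kappa sigma g T.
Proof.
  intros h [T0 dT]. split; [exact T0|]. intros t Ht. apply dT. unfold nbhd in *; lra.
Qed.

(** The supremum is a finite number because it is attained, and it is at least the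
    eigenvalue of the segment. *)
Lemma maximum_attained (p q : R * R) (alpha : curve) :
  half_plane p -> half_plane q -> q <> p -> dist_plane p q <= fst p / 2 ->
  admissible p q alpha -> lambda1 alpha = sup_lambda1 p q ->
  exists sigma, / (4 * dist_plane p q) <= sigma /\ lambda1 alpha = Finite (sigma ^ 2) /\
    forall g, admissible p q g -> Rbar_le (lambda1 g) (sigma ^ 2).
Proof.
  intros hp hq ne small adm lam.
  assert (ub : forall g, admissible p q g -> Rbar_le (lambda1 g) (lambda1 alpha)).
  { intros g ag. rewrite lam. unfold sup_lambda1, Rbar_lub.
    apply (proj2_sig (Rbar_ex_lub _)). exists g. auto. }
  assert (low := Rbar_le_trans _ _ _ (segment_lambda1 p q hp hq ne small)
    (ub _ (segment_admissible p q hp hq ne))).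
  destruct (admissible_regular p q alpha adm) as [d reg].
  destruct (lambda1_bounded d alpha reg) as [s0 upp].
  destruct (lambda1 alpha) as [l| |] eqn:E; simpl in low, upp; try contradiction.
  assert (dp := dist_plane_pos p q ne).
  assert (ip : 0 < / (4 * dist_plane p q)) by (apply Rinv_0_lt_compat; lra).
  assert (l0 : 0 <= l) by (apply Rle_trans with (2 := low); apply (pow2_ge_0 (/ (4 * dist_plane p q)))).
  assert (sl : sqrt l ^ 2 = l) by now apply pow2_sqrt.
  exists (sqrt l). rewrite sl. split; [|split; [reflexivity|exact ub]].
  rewrite <- (sqrt_pow2 (/ (4 * dist_plane p q))) by lra. now apply sqrt_le_1_alt.
Qed.

Theorem lemma1p3 :
  forall p : R * R, half_plane p ->
  exists eps : R, 0 < eps /\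
    forall q : R * R, half_plane q -> q <> p -> dist_plane p q < eps ->
    forall alpha beta : curve,
      admissible p q alpha -> lambda1 alpha = sup_lambda1 p q ->
      admissible p q beta -> lambda1 beta = sup_lambda1 p q ->
      reparametrization alpha beta.
Proof.
  intros p hp. assert (kp : 0 < fst p) by exact hp.
  set (B := 8 * (2 * (320000 / fst p ^ 2 + 1) * exp 44)).
  assert (B1 : 1 <= B).
  { unfold B. assert (0 < 320000 / fst p ^ 2) by (apply Rdiv_lt_0_compat; [lra|now apply pow_lt]).
    generalize (exp_ineq1_le 44). nra. }
  exists (Rmin (fst p / 128) (/ (4 * B))). split.
  { apply Rmin_pos; [lra|]. apply Rinv_0_lt_compat. lra. }
  intros q hq ne near alpha beta aa la ab lb.
  assert (n1 := Rlt_le_trans _ _ _ near (Rmin_l _ _)).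
  assert (n2 := Rlt_le_trans _ _ _ near (Rmin_r _ _)).
  assert (dp := dist_plane_pos p q ne).
  destruct (maximum_attained p q alpha hp hq ne ltac:(lra) aa la) as [sigma [sge [ls ub]]].
  assert (s1 : 32 <= sigma * fst p).
  { apply Rle_trans with (/ (4 * dist_plane p q) * (128 * dist_plane p q)).
    - apply Req_le. field. lra.
    - apply Rmult_le_compat; try lra. apply Rlt_le, Rinv_0_lt_compat; lra. }
  assert (sB : B <= sigma).
  { apply Rle_trans with (2 := sge). rewrite <- (Rinv_inv B). apply Rinv_le_contravar; [lra|].
    replace (/ B) with (4 * / (4 * B)) by (field; lra). lra. }
  assert (s2 : B <= sigma ^ 2) by nra.
  assert (sp : 0 < sigma) by lra.
  assert (lbs : lambda1 beta = Finite (sigma ^ 2)) by now rewrite lb, <- la.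
  destruct (angle_of_maximizer p q alpha sigma aa kp sp ls) as [da [Ta [ra [pa [xa ea]]]]].
  destruct (angle_of_maximizer p q beta sigma ab kp sp lbs) as [db [Tb [rb [pb [xb eb]]]]].
  assert (da0 := reg_width _ _ ra). assert (db0 := reg_width _ _ rb).
  set (d := Rmin da db). assert (h1 := Rmin_l da db). assert (h2 := Rmin_r da db).
  fold d in h1, h2. assert (d0 : 0 < d) by now apply Rmin_pos.
  apply (regular_on_smaller _ d) in ra; [|lra]. apply (regular_on_smaller _ d) in rb; [|lra].
  apply (pruefer_angle_smaller _ d) in pa; [|lra]. apply (pruefer_angle_smaller _ d) in pb; [|lra].
  assert (sa := pruefer_smooth d (fst p) alpha ra kp sigma Ta (proj2 pa)).
  assert (sb := pruefer_smooth d (fst p) beta rb kp sigma Tb (proj2 pb)).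
  destruct (coupling_exists d Ta Tb d0 xa xb sa sb (proj1 pa) (proj1 pb) ltac:(lra))
    as [phi [e [he [sphi [into [ang [phi0 [phi1 [phip [cphi rate]]]]]]]]]].
  assert (unit : forall t, 0 <= t <= 1 -> 0 <= phi t <= 1).
  { assert (dphi : forall t, 0 <= t <= 1 -> is_derive phi t (Derive phi t)).
    { intros t Ht. apply (smooth_is_derive (nbhd e)); [exact sphi|]. unfold nbhd; lra. }
    intros t Ht. split; [rewrite <- phi0|rewrite <- phi1];
      apply (derive_nonneg_le phi (Derive phi)); try lra; intros s Hs;
      try (apply dphi; lra); apply Rlt_le, phip. }
  exists phi. split; [|split; [exact unit|split; [|split]]].
  - apply (smooth_on_I_of_smooth e); [lra|exact sphi].
  - intros s Hs. destruct (IVT_gen phi 0 1 s) as [t [Ht E]].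
    + intros t. apply continuity_pt_filterlim, cphi.
    + rewrite phi0, phi1, Rmin_left, Rmax_right; lra.
    + rewrite Rmin_left, Rmax_right in Ht by lra. now exists t.
  - intros t _. apply Rgt_not_eq, phip.
  - intros t Ht.
    assert (Dt := same_trace p q alpha beta d e sigma Ta Tb phi kp sp aa ab ra rb pa pb ea eb he
      sphi into unit ang phi0 phi1 phip rate s1 s2 ub t Ht).
    cbv beta in Dt.
    generalize (pow2_ge_0 (fst alpha (phi t) - fst beta t))
      (pow2_ge_0 (snd alpha (phi t) - snd beta t)); intros g1 g2.
    unfold point. f_equal; apply Rminus_diag_uniq_sym, Rsqr_0_uniq; unfold Rsqr; simpl in *; lra.
Qed.
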